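(* For every $\bm{p}=(p_1,p_2)$ with $p_1,p_2$ positive integers, there is a constant $c=c_{\bm{p}}>0$ such that, if $Q:\mathbb{Z}^2\to\mathbb{R}$ is $\bm{p}$-periodic and $\|Q\|_\infty\le c$, then the following hold for $H_Q=\Delta_{\mathrm{sqn}}+Q$: (1) $\sigma(H_Q)$ consists of no more than two intervals. (2) If at least one of $p_1$ or $p_2$ is not divisible by three, then $\sigma(H_Q)$ consists of a single interval. Moreover, the gap in the first setting may only open at the energy $E=-1$; that is, for every $\varepsilon>0$ there is $\delta\in(0,c]$ such that whenever $Q$ is $\bm{p}$-periodic with $\|Q\|_\infty\le\delta$, every bounded connected component of $\mathbb{R}\setminus\sigma(H_Q)$ is contained in $(-1-\varepsilon,-1+\varepsilon)$.
   Context: EHM lattice (square lattice with next-nearest neighbor interactions): the vertex set is $\mathcal{V}_{\mathrm{sqn}}=\mathbb{Z}^2$, and $\bm{n}\sim\bm{n}'$ iff $\|\bm{n}-\bm{n}'\|_\infty=1$ (so each vertex has eight neighbors). The Laplacian $\Delta_{\mathrm{sqn}}$ is the bounded self-adjoint operator on $\ell^2(\mathbb{Z}^2)$ given by $[\Delta_{\mathrm{sqn}}\psi]_{\bm{n}}=\sum_{\bm{n}'\sim\bm{n}}\psi_{\bm{n}'}$ (the adjacency operator). A bounded function $Q:\mathbb{Z}^2\to\mathbb{R}$ acts on $\ell^2(\mathbb{Z}^2)$ by multiplication. $Q$ is $(p_1,p_2)$-periodic if $Q(n+p_1,m)=Q(n,m+p_2)=Q(n,m)$ for all $(n,m)\in\mathbb{Z}^2$.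 $\sigma$ denotes spectrum. *)

(* Defs.v *)
From mathcomp Require Import all_boot all_order all_algebra.
From mathcomp Require Import complex.
From mathcomp Require Import all_classical all_reals all_analysis.

Set Implicit Arguments.
Unset Strict Implicit.
Unset Printing Implicit Defensive.

Import Order.TTheory GRing.Theory Num.Theory.
Import numFieldNormedType.Exports.

Local Open Scope classical_set_scope.
Local Open Scope complex_scope.
Local Open Scope ring_scope.

(* Operators on l^2(Z^2) are encoded as maps on all functions Z^2 -> C; only
   their action on [ell2] is ever used, and operator identities are required
   on [ell2] only. *)

Notation Z2 := (int * int)%type.

Section EHM.
Variable R : realType.
Implicit Types (psi phi : Z2 -> R[i]) (T : (Z2 -> R[i]) -> Z2 -> R[i]).

Definition sqmod psi (n : Z2) : \bar R :=
  (ComplexField.Normc.normc (psi n) ^+ 2)%:E.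

Definition ell2 : set (Z2 -> R[i]) :=
  [set psi | summable [set: Z2] (sqmod psi)].

Definition ell2norm psi : R :=
  Num.sqrt (fine (\esum_(n in [set: Z2]) sqmod psi n)).

Definition bounded_operator T : Prop :=
  [/\ forall psi, ell2 psi -> ell2 (T psi),
      forall (a : R[i]) psi phi, ell2 psi -> ell2 phi ->
        T (fun n => a * psi n + phi n) = (fun n => a * T psi n + T phi n)
    & exists M : R, forall psi, ell2 psi -> ell2norm (T psi) <= M * ell2norm psi].

Definition shift_operator T (z : R[i]) : (Z2 -> R[i]) -> Z2 -> R[i] :=
  fun psi n => T psi n - z * psi n.

Definition resolvent_set T : set R[i] :=
  [set z | exists2 S, bounded_operator S & forall psi, ell2 psi ->
     S (shift_operator T z psi) = psi /\ shift_operator T z (S psi) = psi].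

Definition spectrum T : set R[i] := ~` resolvent_set T.

Definition nbr_sqn (n n' : Z2) : bool :=
  Num.max `|n.1 - n'.1| `|n.2 - n'.2| == 1.

(* The index set has eight elements, so this [fsbigop] sum, which is 0 by
   convention on an infinite support, is the usual finite sum. *)
Definition laplacian_sqn psi (n : Z2) : R[i] :=
  \sum_(n' \in [set n' | nbr_sqn n n']) psi n'.

Definition schrodinger_sqn (Q : Z2 -> R) psi (n : Z2) : R[i] :=
  laplacian_sqn psi n + (Q n)%:C * psi n.

Definition biperiodic (p1 p2 : nat) (Q : Z2 -> R) : Prop :=
  forall n m : int, Q (n + p1%:Z, m) = Q (n, m) /\ Q (n, m + p2%:Z) = Q (n, m).

(* [sup] is the genuine supremum only for bounded [Q], e.g. periodic [Q] with
   positive periods. *)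
Definition sup_norm (Q : Z2 -> R) : R := sup (range (fun n => `|Q n|)).

Definition embedC (A : set R) : set R[i] := [set x%:C | x in A].

Definition single_interval (S : set R[i]) : Prop :=
  exists a b : R, a < b /\ S = embedC `[a, b].

Definition at_most_two_intervals (S : set R[i]) : Prop :=
  exists a b c d : R, [/\ a < b, c < d & S = embedC (`[a, b] `|` `[c, d])].

End EHM.

(* Main.v *)
(** Idea. The symbol of the free operator is [f x * f y - 1] with
    [f t = 1 + 2 cos t].  In the basis of plane waves the fibre of [H_Q] at
    quasimomentum [(x, y)] is the Hermitian matrix [diag (freeval x y) + B],
    where [B], the matrix of the potential, does not depend on [(x, y)] and has
    norm at most [|Q|].  If [E] is not in the spectrum then no fibre has the
    eigenvalue [E], so the number of eigenvalues below [E] is constant in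
    [(x, y)].  Hence [E] lies in the spectrum of [H_Q], for all small [Q], as soon
    as two quasimomenta have different counts for the free operator; and two
    points of the resolvent set with the same count have no spectrum in between.

    With [lam = E + 1], [lam <> 0], the counts differ between [(x0, s)] and
    [(x0 + O(s^2), s)], where [f x0 = lam / 3]: the values equal to [lam] at
    [(x0, 0)] with vanishing [y]-derivative all move towards [0] at [(x0, s)],
    while the shift in [x] moves one of them away from [0] and is too small to
    affect those with nonzero [y]-derivative.  At [E = -1] the counts differ if
    [p1] is not a multiple of [3], because then exactly one point of the grid
    through [2 pi / 3] is a zero of [f].  In general some quasimomentum has no
    free eigenvalue equal to [-4], [-1] or [8], which determines the count near
    these energies and leaves room for one gap only, at [-1]. *)

Require Import Defs.
From mathcomp Require Import all_boot all_order all_algebra.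
From mathcomp Require Import complex.
From mathcomp Require Import all_classical all_reals all_analysis.
From mathcomp Require Import ring lra zify.

Import Order.TTheory GRing.Theory Num.Theory.
Import numFieldNormedType.Exports.

Local Open Scope classical_set_scope.
Local Open Scope complex_scope.
Local Open Scope ring_scope.

Set Implicit Arguments.
Unset Strict Implicit.
Unset Printing Implicit Defensive.

(** * Eigenvalue counts of Hermitian matrices *)

Section Inertia.
Local Open Scope sesquilinear_scope.
Variable C : numClosedFieldType.

(** The spectrum is defined through bounded inverses on l^2(Z^2), whereas the counting lives on
    finite matrices. The bridge is [below], a lower bound for [H_Q - E] on finitely supported
    functions. On these the Floquet transform is a finite Fourier transform over a box whose side is
    a multiple of both periods, so a bound uniform over the fibres gives [below] by Parseval;
    conversely an eigenvector of a fibre extends to a Bloch wave whose truncations violate the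
    bound. Bounded inverses are built by a Neumann series for [(H_Q - x)^2 + y^2], which handles
    non-real energies at the same time. Counts are compared only through subspaces on which a
    quadratic form has a sign. The constant [c] depends on the periods only: [overlap E c] is stable
    under small changes of [E], so compactness gives a common margin for the energies between -4 and
    8 at distance at least [k] from -4, -1 and 8. The remaining windows are controlled by one fixed
    quasimomentum, whose free eigenvalues avoid these three energies by [eta]; hence [k] and [c] are
    at most a quarter of [eta]. *)

Definition qform n (M : 'M[C]_n) (v : 'rV[C]_n) : C := (v *m M *m v ^t*) 0 0.

Definition sqnorm n (v : 'rV[C]_n) : C := \sum_j `|v 0 j| ^+ 2.

Lemma sqnormE n (v : 'rV[C]_n) : sqnorm v = (v *m v ^t*) 0 0.
Proof. by rewrite mxE; apply: eq_bigr => j _; rewrite !mxE normCK. Qed.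

Lemma sqnorm_ge0 n (v : 'rV[C]_n) : 0 <= sqnorm v.
Proof. by apply: sumr_ge0 => j _; rewrite exprn_ge0. Qed.

Lemma sqnorm_gt0 n (v : 'rV[C]_n) : v != 0 -> 0 < sqnorm v.
Proof.
move=> v0; rewrite lt_def sqnorm_ge0 andbT; apply: contra_neq v0 => /eqP.
rewrite psumr_eq0 => [/allP h|j _]; last by rewrite exprn_ge0.
apply/rowP => j; rewrite mxE; have := h j (mem_index_enum _).
by rewrite sqrf_eq0 normr_eq0 => /eqP.
Qed.

Lemma sqnorm_unitary m n (v : 'rV[C]_m) (P : 'M[C]_(m, n)) :
  P \is unitarymx -> sqnorm (v *m P) = sqnorm v.
Proof.
move=> /unitarymxP PP; rewrite !sqnormE trmx_mul map_mxM mulmxA -(mulmxA v).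
by rewrite PP mulmx1.
Qed.

Lemma qformD n (M N : 'M[C]_n) v : qform (M + N) v = qform M v + qform N v.
Proof. by rewrite /qform mulmxDr mulmxDl mxE. Qed.

Lemma qform_diag n (d : 'rV[C]_n) v :
  qform (diag_mx d) v = \sum_j d 0 j * `|v 0 j| ^+ 2.
Proof.
rewrite /qform mul_mx_diag mxE; apply: eq_bigr => j _.
by rewrite !mxE normCK mulrAC mulrC.
Qed.

Variable n : nat.
Implicit Types (M N : 'M[C]_n) (v : 'rV[C]_n).

Definition eigcoord M v := v *m (spectralmx M) ^t*.

Lemma sqnorm_eigcoord M v : sqnorm (eigcoord M v) = sqnorm v.
Proof. by rewrite sqnorm_unitary // trmxC_unitary spectral_unitarymx. Qed.

Lemma spectralE M : M \is hermsymmx ->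
  M = (spectralmx M) ^t* *m diag_mx (spectral_diag M) *m spectralmx M.
Proof.
move=> /hermitian_normalmx /orthomx_spectralP {1}->.
by rewrite invmx_unitary // spectral_unitarymx.
Qed.

Lemma qform_eig M v : M \is hermsymmx ->
  qform M v = \sum_j spectral_diag M 0%R j * `|eigcoord M v 0 j| ^+ 2.
Proof.
move=> hM; rewrite -qform_diag /qform {1}(spectralE hM) /eigcoord.
by rewrite trmx_mul map_mxM trmxCK !mulmxA.
Qed.

Lemma spectral_diag_real M j : M \is hermsymmx -> spectral_diag M 0%R j \is Num.real.
Proof. by move=> /hermitian_spectral_diag_real /mxOverP. Qed.

Lemma spectral_diag_neq0 M j : M \is hermsymmx -> M \in unitmx ->
  spectral_diag M 0%R j != 0.
Proof.
move=> hM; rewrite {1}(spectralE hM) !unitmx_mul => /andP[/andP[_]].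
rewrite unitmxE det_diag unitfE => /prodf_neq0 h _; exact: h.
Qed.

Lemma qform_real M v : M \is hermsymmx -> qform M v \is Num.real.
Proof.
move=> hM; rewrite qform_eig //; apply: rpred_sum => j _.
by rewrite realM ?spectral_diag_real // rpredX // normr_real.
Qed.

Definition signidx (s : C) M := #|[pred j | s * spectral_diag M 0%R j < 0]|.

(** Dimension count: if [a] exceeded the index, a nonzero combination of the rows of [A] would have
    no component along the eigenvectors with [s * eigenvalue < 0], and [s] times the form would be
    nonnegative on it. The sign [s] covers both indices at once. *)
Lemma signidx_ge (s : C) M a (A : 'M[C]_(a, n)) : s \is Num.real ->
  M \is hermsymmx ->
  (forall x : 'rV_a, x != 0 -> s * qform M (x *m A) < 0) -> (a <= signidx s M)%N.
Proof.
move=> sr hM hA; rewrite leqNgt; apply/negP => lt_a.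
pose J := [pred j | s * spectral_diag M 0%R j < 0].
(* Components of the rows of [A] along these eigenvectors: fewer columns than rows, hence a left
   kernel. *)
pose F : 'M[C]_(a, #|J|) := \matrix_(i, k) eigcoord M (row i A) 0 (enum_val k).
have : ~~ row_free F.
  by rewrite /row_free neq_ltn (leq_ltn_trans (rank_leq_col F)).
rewrite -kermx_eq0 => /rowV0Pn[x /sub_kermxP xF x0].
have := lt_geF (hA x x0); suff -> : 0 <= s * qform M (x *m A) by [].
rewrite qform_eig // mulr_sumr big_seq; apply: sumr_ge0 => j _; rewrite mulrA.
have [jJ|] := boolP (j \in J).
  suff -> : eigcoord M (x *m A) 0 j = 0 by rewrite normr0 expr0n mulr0.
  have <- : (x *m F) 0 (enum_rank_in jJ j) = 0 by rewrite xF mxE.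
  rewrite /eigcoord -mulmxA !mxE.
  apply: eq_bigr => i _; rewrite !mxE enum_rankK_in //; congr (_ * _).
  by apply: eq_bigr => k _; rewrite !mxE.
rewrite inE -real_leNgt ?realM ?spectral_diag_real ?real0 // => jJ.
by rewrite mulr_ge0 // exprn_ge0.
Qed.

Definition negidx M := signidx 1 M.
Definition posidx M := signidx (-1) M.

Lemma negidxE M : negidx M = #|[pred j | spectral_diag M 0%R j < 0]|.
Proof. by apply: eq_card => j; rewrite !inE mul1r. Qed.

Lemma posidxE M : posidx M = #|[pred j | 0 < spectral_diag M 0%R j]|.
Proof. by apply: eq_card => j; rewrite !inE mulN1r oppr_lt0. Qed.

Lemma negidxD M : M \is hermsymmx -> M \in unitmx -> (negidx M + posidx M = n)%N.
Proof.
move=> hM uM; rewrite negidxE posidxE -[RHS]card_ord.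
rewrite -(cardC [pred j | spectral_diag M 0%R j < 0]); congr addn.
apply: eq_card => j; rewrite !inE -real_leNgt ?real0 ?spectral_diag_real //.
by rewrite le_eqVlt eq_sym (negPf (spectral_diag_neq0 j hM uM)).
Qed.

Lemma negidx_ge M a (A : 'M[C]_(a, n)) : M \is hermsymmx ->
  (forall x : 'rV_a, x != 0 -> qform M (x *m A) < 0) -> (a <= negidx M)%N.
Proof.
by move=> hM h; apply: (@signidx_ge 1 _ _ A) => // x /h; rewrite mul1r.
Qed.

Lemma posidx_ge M a (A : 'M[C]_(a, n)) : M \is hermsymmx ->
  (forall x : 'rV_a, x != 0 -> 0 < qform M (x *m A)) -> (a <= posidx M)%N.
Proof.
move=> hM h; apply: (@signidx_ge (-1) _ _ A) => // x /h.
by rewrite mulN1r oppr_lt0.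
Qed.

Definition eigrows M (J : {pred 'I_n}) : 'M[C]_(#|J|, n) :=
  rowsub enum_val (spectralmx M).

Lemma eigcoord_eigrows M (J : {pred 'I_n}) (x : 'rV_#|J|) k :
  eigcoord M (x *m eigrows M J) 0 (enum_val k) = x 0 k.
Proof.
rewrite /eigcoord /eigrows -mulmxA mul_rowsub_mx.
have /unitarymxP -> := spectral_unitarymx M.
rewrite mxE (bigD1 k) //= !mxE eqxx mulr1 big1 ?addr0 // => i ik.
rewrite !mxE (inj_eq enum_val_inj) (negPf ik) mulr0 //.
Qed.

Lemma eigcoord_eigrows0 M (J : {pred 'I_n}) (x : 'rV_#|J|) j : j \notin J ->
  eigcoord M (x *m eigrows M J) 0 j = 0.
Proof.
move=> jJ; rewrite /eigcoord /eigrows -mulmxA mul_rowsub_mx.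
have /unitarymxP -> := spectral_unitarymx M.
rewrite mxE big1 // => i _; rewrite !mxE.
case: eqVneq => [e|]; last by rewrite mulr0.
by move: jJ; rewrite -e enum_valP.
Qed.

Lemma sqnorm_eigrows M (J : {pred 'I_n}) (x : 'rV_#|J|) :
  sqnorm (x *m eigrows M J) = sqnorm x.
Proof.
apply: sqnorm_unitary; apply/unitarymxP; apply/matrixP => i k.
rewrite /eigrows; have /unitarymxP/matrixP := spectral_unitarymx M.
move=> /(_ (enum_val i) (enum_val k)); rewrite !mxE (inj_eq enum_val_inj) => <-.
by apply: eq_bigr => j _; rewrite !mxE.
Qed.

Lemma qform_eigrows M (J : {pred 'I_n}) (x : 'rV_#|J|) : M \is hermsymmx ->
  qform M (x *m eigrows M J)
  = \sum_k spectral_diag M 0 (enum_val k) * `|x 0 k| ^+ 2.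
Proof.
move=> hM; rewrite qform_eig // (bigID (mem J)) /= [X in _ + X]big1 ?addr0.
  rewrite big_enum_val; apply: eq_bigr => k _.
  by rewrite eigcoord_eigrows.
by move=> j jJ; rewrite eigcoord_eigrows0 // normr0 expr0n mulr0.
Qed.

(* The eigenspaces of the negative and of the positive spectrum of [M0] keep
   their sign for [M], so neither index can drop, and their sum is fixed. *)
Lemma negidx_locally_constant M0 : M0 \is hermsymmx -> M0 \in unitmx ->
  exists2 mu : C, 0 < mu & forall M, M \is hermsymmx -> M \in unitmx ->
    (forall v, v != 0 -> `|qform (M - M0) v| < mu * sqnorm v) ->
    negidx M = negidx M0.
Proof.
move=> hM0 uM0; pose d j := spectral_diag M0 0 j.
have [mu mu0 dmu] : exists2 mu : C, 0 < mu & forall j, mu <= `|d j|.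
  have d0 j : 0 < `|d j| by rewrite normr_gt0 spectral_diag_neq0.
  (* An explicit lower bound for the moduli of the eigenvalues in place of their minimum; the
     summand 1 keeps it positive for [n = 0]. *)
  exists ((1 + \sum_j `|d j|^-1)^-1).
    by rewrite invr_gt0 ltr_wpDr // sumr_ge0 // => j _; rewrite invr_ge0.
  move=> j; rewrite -[leRHS]invrK lef_pV2 ?posrE ?invr_gt0 //.
    by rewrite (bigD1 j) //= addrCA lerDl addr_ge0 // sumr_ge0 // => k _.
  by rewrite ltr_wpDr // sumr_ge0 // => k _; rewrite invr_ge0.
exists mu => // M hM uM hMM0.
have pert v : v != 0 -> `|qform M v - qform M0 v| < mu * sqnorm v.
  move=> v0; have := hMM0 v v0.
  suff -> : qform (M - M0) v = qform M v - qform M0 v by [].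
  by apply/eqP; rewrite eq_sym subr_eq -qformD subrK.
have dr j : d j \is Num.real by rewrite spectral_diag_real.
have nz (J : {pred 'I_n}) (x : 'rV_#|J|) : x != 0 -> x *m eigrows M0 J != 0.
  move=> /sqnorm_gt0 h; apply/eqP => e; move: h.
  by rewrite -(sqnorm_eigrows M0) e sqnormE mul0mx mxE ltxx.
have neg_le : (negidx M0 <= negidx M)%N.
  rewrite negidxE; apply: (@negidx_ge _ _ (eigrows M0 _)) => // x x0.
  have := pert _ (nz _ _ x0); rewrite real_ltr_norml ?realB ?qform_real //.
  case/andP=> _; rewrite ltrBlDl => /lt_le_trans; apply.
  rewrite qform_eigrows // sqnorm_eigrows mulr_sumr -big_split /=.
  apply: sumr_le0 => k _; rewrite -mulrDl mulr_le0_ge0 ?exprn_ge0 //.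
  have dk : d (enum_val k) < 0 by exact: (enum_valP k).
  by have := dmu (enum_val k); rewrite ltr0_norm // => h; rewrite addrC -lerBrDr sub0r.
have pos_le : (posidx M0 <= posidx M)%N.
  rewrite posidxE; apply: (@posidx_ge _ _ (eigrows M0 _)) => // x x0.
  have := pert _ (nz _ _ x0); rewrite real_ltr_norml ?realB ?qform_real //.
  case/andP=> + _; rewrite ltrBrDr => /(le_lt_trans _); apply.
  rewrite qform_eigrows // sqnorm_eigrows mulr_sumr addrC -sumrB.
  apply: sumr_ge0 => k _; rewrite -mulrBl mulr_ge0 ?exprn_ge0 //.
  have dk : 0 < d (enum_val k) by exact: (enum_valP k).
  by have := dmu (enum_val k); rewrite gtr0_norm // => h; rewrite subr_ge0.
by have := negidxD hM uM; have := negidxD hM0 uM0; lia.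
Qed.

Lemma hermsymE M : (M \is hermsymmx) = (M == M ^t*).
Proof.
apply/idP/eqP => [/is_hermitianmxP|hM]; first by rewrite expr0 scale1r.
by apply/is_hermitianmxP; rewrite expr0 scale1r.
Qed.

Lemma hermsym_shift M e : e \is Num.real -> M \is hermsymmx ->
  M - e%:M \is hermsymmx.
Proof.
move=> er; rewrite !hermsymE => /eqP hM; apply/eqP.
rewrite linearB /= map_mxB -hM tr_scalar_mx map_scalar_mx /=.
by congr (_ - _%:M); apply/esym/CrealP.
Qed.

Lemma spectral_shiftE M e : M \is hermsymmx ->
  M - e%:M = (spectralmx M) ^t* *m
    diag_mx (\row_j (spectral_diag M 0%R j - e)) *m spectralmx M.
Proof.
move=> hM; have -> : diag_mx (\row_j (spectral_diag M 0%R j - e))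
    = diag_mx (spectral_diag M) - e%:M.
  by apply/matrixP => i j; rewrite !mxE mulrnBl.
rewrite mulmxBr mulmxBl -(spectralE hM) mul_mx_scalar -scalemxAl.
by rewrite -(invmx_unitary (spectral_unitarymx M)) mulVmx ?spectral_unit // scalemx1.
Qed.

Lemma spectral_diag_shift M e j : M \is hermsymmx -> M - e%:M \in unitmx ->
  spectral_diag M 0%R j - e != 0.
Proof.
move=> hM; rewrite spectral_shiftE // !unitmx_mul => /andP[/andP[_]].
by rewrite unitmxE det_diag unitfE => /prodf_neq0 /(_ j isT); rewrite mxE.
Qed.

Lemma sqnorm_shift M e v : M \is hermsymmx -> sqnorm (v *m (M - e%:M))
  = \sum_j `|spectral_diag M 0%R j - e| ^+ 2 * `|eigcoord M v 0 j| ^+ 2.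
Proof.
move=> hM; rewrite spectral_shiftE // !mulmxA.
rewrite sqnorm_unitary ?spectral_unitarymx // mul_mx_diag.
by apply: eq_bigr => j _; rewrite !mxE normrM exprMn mulrC.
Qed.

Lemma qform_shift_eigrows M e (J : {pred 'I_n}) (x : 'rV_#|J|) :
  M \is hermsymmx -> qform (M - e%:M) (x *m eigrows M J)
  = \sum_k (spectral_diag M 0 (enum_val k) - e) * `|x 0 k| ^+ 2.
Proof.
move=> hM; rewrite qformD qform_eigrows //.
have -> v : qform (- e%:M) v = - (e * sqnorm v).
  by rewrite /qform mulmxN mulNmx mxE mul_mx_scalar -scalemxAl mxE -sqnormE.
by rewrite sqnorm_eigrows mulr_sumr -sumrB; apply: eq_bigr => k _; rewrite mulrBl.
Qed.

(** The diagonalisation chosen for [M - e%:M] is not tied to the one of [M]. The eigenspaces of [M]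
    below and above [e] bound the two indices from below, and as both pairs of counts add up to [n],
    equality follows. *)
Lemma negidx_shift M e : e \is Num.real -> M \is hermsymmx ->
  M - e%:M \in unitmx ->
  negidx (M - e%:M) = #|[pred j | spectral_diag M 0%R j < e]|.
Proof.
move=> er hM uM; have hMe := hermsym_shift er hM.
have pos m (u : 'rV[C]_m) (a : 'I_m -> C) : u != 0 -> (forall k, 0 < a k) ->
    0 < \sum_k a k * `|u 0 k| ^+ 2.
  move=> u0 a0; rewrite lt_def; apply/andP; split; last first.
    by apply: sumr_ge0 => k _; rewrite mulr_ge0 ?exprn_ge0 // ltW.
  apply: contra_neq u0 => /eqP; rewrite psumr_eq0 => [/allP h|k _]; last first.
    by rewrite mulr_ge0 ?exprn_ge0 // ltW.
  apply/rowP => k; rewrite mxE; have := h k (mem_index_enum _).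
  by rewrite mulf_eq0 sqrf_eq0 normr_eq0 gt_eqF //= => /eqP.
have negh : (#|[pred j | (spectral_diag M 0%R j < e)%R]| <= negidx (M - e%:M))%N.
  apply: (@negidx_ge _ _ (eigrows M _)) => // x x0.
  rewrite qform_shift_eigrows // -oppr_gt0 -sumrN.
  under eq_bigr do rewrite -mulNr.
  by apply: pos => // k; rewrite oppr_gt0 subr_lt0; exact: (enum_valP k).
have posh : (#|[pred j | (e < spectral_diag M 0%R j)%R]| <= posidx (M - e%:M))%N.
  apply: (@posidx_ge _ _ (eigrows M _)) => // x x0.
  rewrite qform_shift_eigrows //.
  by apply: pos => // k; rewrite subr_gt0; exact: (enum_valP k).
have cn : (#|[pred j | (spectral_diag M 0%R j < e)%R]|
    + #|[pred j | (e < spectral_diag M 0%R j)%R]| = n)%N.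
  rewrite -[RHS]card_ord -(cardC [pred j | spectral_diag M 0%R j < e]).
  congr addn; apply: eq_card => j; rewrite !inE.
  rewrite -real_leNgt ?spectral_diag_real // le_eqVlt.
  by rewrite eq_sym -subr_eq0 (negPf (spectral_diag_shift j hM uM)).
by have := negidxD hMe uM; lia.
Qed.

(* Equal indices at [e1] and [e2] mean that no eigenvalue lies in between. *)
Lemma sqnorm_shift_ge M (e1 e2 e r : C) v : e1 \is Num.real -> e2 \is Num.real ->
  M \is hermsymmx -> M - e1%:M \in unitmx -> M - e2%:M \in unitmx ->
  negidx (M - e1%:M) = negidx (M - e2%:M) ->
  0 <= r -> e1 + r <= e -> e + r <= e2 ->
  r ^+ 2 * sqnorm v <= sqnorm (v *m (M - e%:M)).
Proof.
move=> e1r e2r hM u1 u2; rewrite !negidx_shift // => ec r0 e1e ee2.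
have e12 : e1 <= e2.
  apply: le_trans ee2; apply: le_trans (_ : e <= _); last by rewrite lerDl.
  by apply: le_trans e1e; rewrite lerDl.
have sub : {subset [pred j | spectral_diag M 0 j < e1]
    <= [pred j | spectral_diag M 0 j < e2]}.
  by move=> j; rewrite !inE => /lt_le_trans; apply.
(* An inclusion between sets of equal size is an equality: no eigenvalue lies in [[e1, e2)]. *)
have := subset_leqif_card (introT fintype.subsetP sub).
rewrite ec => /geq_leqif; rewrite leqnn => /esym /fintype.subsetP h.
rewrite sqnorm_shift // -(sqnorm_eigcoord M v) mulr_sumr.
apply: ler_sum => j _; rewrite ler_wpM2r ?exprn_ge0 //.
rewrite lerXn2r ?nnegrE //.
have dr := spectral_diag_real j hM.
have [lt1|ge1] := boolP (spectral_diag M 0 j < e1).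
  have le_re : r <= e - spectral_diag M 0 j.
    rewrite lerBrDl (le_trans _ e1e) // lerD2r ltW //.
  by rewrite distrC ger0_norm // (le_trans r0).
have ge2 : e2 <= spectral_diag M 0 j.
  rewrite real_leNgt //; apply/negP => lt2.
  by move/negP: ge1; apply; exact: (h j lt2).
have le_re : r <= spectral_diag M 0 j - e by rewrite lerBrDl (le_trans ee2).
by rewrite ger0_norm // (le_trans r0).
Qed.

End Inertia.

(** * Sums over boxes *)

Section BoxSums.

(** Half-open range [[-N, N)], so that a box has side [2 N], which can be a multiple of both periods
    and serves as order of the finite Fourier transform. *)
Definition isum (V : nmodType) N (f : int -> V) : V :=
  \sum_(i < N.*2) f (i%:Z - N%:Z).

Definition bsum (V : nmodType) N (F : Z2 -> V) : V :=
  isum N (fun a => isum N (fun b => F (a, b))).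

Definition inbox N (n : Z2) : bool :=
  [&& - N%:Z <= n.1, n.1 < N%:Z, - N%:Z <= n.2 & n.2 < N%:Z].

Definition supp (V : nmodType) N (F : Z2 -> V) : Prop :=
  forall n, ~~ inbox N n -> F n = 0.

Variable V : comNzRingType.
Implicit Types (f g : int -> V) (F G : Z2 -> V).

Lemma isumS N f : isum N.+1 f = isum N f + f N%:Z + f (- N.+1%:Z).
Proof.
rewrite /isum doubleS big_ord_recl big_ord_recr /= addrC; congr (_ + _ + _).
- by apply: eq_bigr => i _; congr f; rewrite /bump /=; lia.
- by congr f; rewrite /bump /=; lia.
- by congr f; lia.
Qed.

Lemma eq_isum N f g : (forall n, - N%:Z <= n -> n < N%:Z -> f n = g n) ->
  isum N f = isum N g.
Proof. by move=> fg; apply: eq_bigr => i _; apply: fg; have := ltn_ord i; lia. Qed.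

Lemma isum_shift N f : isum N (fun n => f (n + 1)) = isum N f + f N%:Z - f (- N%:Z).
Proof.
elim: N f => [|N IH] f; first by rewrite /isum !big_ord0 add0r subrr.
rewrite !isumS IH.
have -> : N%:Z + 1 = N.+1%:Z by lia.
have -> : - N.+1%:Z + 1 = - N%:Z by lia.
ring.
Qed.

Lemma isum_ext N M f : (forall n, n < - N%:Z \/ N%:Z <= n -> f n = 0) ->
  (N <= M)%N -> isum M f = isum N f.
Proof.
move=> f0 /subnK <-; elim: (M - N)%N => // k IH.
by rewrite addSn isumS IH !f0 ?addr0 //; lia.
Qed.

Lemma isum_shift_supp N M (a : int) f :
  (forall n, n < - N%:Z \/ N%:Z <= n -> f n = 0) -> (N < M)%N -> `|a| <= 1 ->
  isum M (fun n => f (n + a)) = isum M f.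
Proof.
move=> f0 NM a1; have [->|[->|->]] : a = 0 \/ a = 1 \/ a = -1 by lia.
- by apply: eq_bigr => i _; rewrite addr0.
- by rewrite isum_shift !f0 ?addr0 ?subr0 //; lia.
have := isum_shift M (fun n => f (n - 1)).
rewrite (f0 (M%:Z - 1)) ?(f0 (- M%:Z - 1)) ?subr0 ?addr0 => [<-||]; try lia.
by apply: eq_bigr => i _; congr f; lia.
Qed.

Lemma isum0 N f : (forall n, - N%:Z <= n -> n < N%:Z -> f n = 0) -> isum N f = 0.
Proof.
by move=> f0; apply: big1 => i _; apply: f0; have := ltn_ord i; lia.
Qed.

Lemma eq_bsum N F G : (forall n, inbox N n -> F n = G n) -> bsum N F = bsum N G.
Proof.
move=> FG; apply: eq_isum => a a1 a2; apply: eq_isum => b b1 b2; apply: FG.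
by rewrite /inbox /= a1 a2 b1 b2.
Qed.

Lemma bsum_ext N M F : supp N F -> (N <= M)%N -> bsum M F = bsum N F.
Proof.
move=> F0 NM; rewrite /bsum (@isum_ext N) //.
  apply: eq_bigr => i _; apply: isum_ext => // n hn.
  by apply: F0; rewrite /inbox /=; lia.
move=> n hn; apply: isum0 => m _ _; apply: F0; rewrite /inbox /=; lia.
Qed.

Lemma bsum_shift N M (a b : int) F : supp N F -> (N < M)%N ->
  `|a| <= 1 -> `|b| <= 1 ->
  bsum M (fun n => F (n.1 + a, n.2 + b)) = bsum M F.
Proof.
move=> F0 NM a1 b1; rewrite /bsum /=.
rewrite -(@isum_shift_supp N M a (fun n => isum M (fun m => F (n, m)))) //.
  apply: eq_bigr => i _.
  apply: (@isum_shift_supp N M b (fun m => F (i%:Z - M%:Z + a, m))) => // n hn.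
  by apply: F0; rewrite /inbox /=; lia.
by move=> n hn; apply: isum0 => m _ _; apply: F0; rewrite /inbox /=; lia.
Qed.

Lemma bsumD N F G : bsum N (fun n => F n + G n) = bsum N F + bsum N G.
Proof. by rewrite /bsum /isum -big_split; apply: eq_bigr => i _; rewrite big_split. Qed.

Lemma bsumZ N (c : V) F : bsum N (fun n => c * F n) = c * bsum N F.
Proof.
by rewrite /bsum /isum mulr_sumr; apply: eq_bigr => i _; rewrite mulr_sumr.
Qed.

Lemma bsum_sum (I : Type) (r : seq I) N (F : I -> Z2 -> V) :
  bsum N (fun n => \sum_(i <- r) F i n) = \sum_(i <- r) bsum N (F i).
Proof.
rewrite /bsum /isum; under eq_bigr do rewrite exchange_big.
by rewrite exchange_big.
Qed.

Lemma suppS N F : supp N F -> supp N.+1 F.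
Proof. by move=> F0 n hn; apply: F0; move: hn; rewrite /inbox; lia. Qed.

Lemma supp_shift N (a b : int) F : supp N F -> `|a| <= 1 -> `|b| <= 1 ->
  supp N.+1 (fun n => F (n.1 + a, n.2 + b)).
Proof.
by move=> F0 a1 b1 n hn; apply: F0; move: hn; rewrite /inbox /=; lia.
Qed.

End BoxSums.

Section RealBoxSums.
Variable R : realType.
Implicit Types (f g : int -> R) (F G : Z2 -> R).

Lemma isum_le N f g : (forall n, f n <= g n) -> isum N f <= isum N g.
Proof. by move=> fg; apply: ler_sum => i _. Qed.

Lemma bsum_le N F G : (forall n, F n <= G n) -> bsum N F <= bsum N G.
Proof. by move=> FG; apply: isum_le => a; apply: isum_le => b. Qed.

Lemma isum_ge0 N f : (forall n, 0 <= f n) -> 0 <= isum N f.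
Proof. by move=> f0; apply: sumr_ge0 => i _. Qed.

Lemma bsum_ge0 N F : (forall n, 0 <= F n) -> 0 <= bsum N F.
Proof. by move=> F0; apply: isum_ge0 => a; apply: isum_ge0 => b. Qed.

Lemma isum_shift_le N (a : int) f : (forall n, 0 <= f n) -> `|a| <= 1 ->
  isum N (fun n => f (n + a)) <= isum N.+1 f.
Proof.
move=> f0 a1; have [->|[->|->]] : a = 0 \/ a = 1 \/ a = -1 by lia.
- rewrite isumS -addrA (eq_isum (g := f)) ?lerDl ?addr_ge0 // => n _ _.
  by rewrite addr0.
- rewrite isum_shift isumS; have := f0 (- N%:Z); have := f0 (- N.+1%:Z).
  lra.
- have : isum N f = isum N (fun n => f (n - 1)) + f (N%:Z - 1) - f (- N%:Z - 1).
    rewrite -(isum_shift N (fun n => f (n - 1))).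
    by apply: eq_isum => n _ _; congr f; lia.
  rewrite isumS.
  rewrite (_ : - N%:Z - 1 = - N.+1%:Z); last by lia.
  have := f0 (N%:Z); have := f0 (N%:Z - 1); lra.
Qed.

Lemma bsum_shift_le N (a b : int) F : (forall n, 0 <= F n) ->
  `|a| <= 1 -> `|b| <= 1 ->
  bsum N (fun n => F (n.1 + a, n.2 + b)) <= bsum N.+1 F.
Proof.
move=> F0 a1 b1; rewrite /bsum /=.
apply: le_trans (@isum_shift_le N a (fun n => isum N.+1 (fun m => F (n, m))) _ a1).
  apply: isum_le => n; exact: (@isum_shift_le N b (fun m => F (_, m))).
by move=> n; apply: isum_ge0 => m.
Qed.

Lemma bsum_mono N M F : (forall n, 0 <= F n) -> (N <= M)%N -> bsum N F <= bsum M F.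
Proof.
move=> F0 /subnK <-; elim: (M - N)%N => // k IH; rewrite addSn (le_trans IH) //.
rewrite -[leLHS](_ : bsum (k + N) (fun n => F (n.1 + 0, n.2 + 0)) = _).
  exact: bsum_shift_le.
by apply: eq_bsum => -[a b] _ /=; rewrite !addr0.
Qed.

Lemma le_bsum N F n : (forall n, 0 <= F n) -> inbox N n -> F n <= bsum N F.
Proof.
case: n => a b F0 /and4P[/= a1 a2 b1 b2].
have aN : (absz (a + N%:Z)%R < N.*2)%N by lia.
have bN : (absz (b + N%:Z)%R < N.*2)%N by lia.
rewrite /bsum /isum (bigD1 (Ordinal aN)) //= (bigD1 (Ordinal bN)) //=.
have -> : (absz (a + N%:Z))%:Z - N%:Z = a by lia.
have -> : (absz (b + N%:Z))%:Z - N%:Z = b by lia.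
rewrite -addrA lerDl addr_ge0 // sumr_ge0 // => i _.
exact: sumr_ge0.
Qed.

Lemma bsum1 N : bsum N (fun=> 1 : R) = (N.*2 ^ 2)%:R.
Proof. by rewrite /bsum /isum !sumr_const !card_ord -mulrnA mulnn. Qed.

End RealBoxSums.

(** * Characters and Parseval's identity *)

Section Trig.
Variable R : realType.
Local Notation C := R[i].
Implicit Types (x y t : R) (z w : C).

(** The squared modulus as an element of [R]; the norm of [R[i]] takes its values in [R[i]]. *)
Definition nsq z : R := complex.Re z ^+ 2 + complex.Im z ^+ 2.

Lemma nsqE z : (nsq z)%:C = z * z^*.
Proof. by rewrite add_Re2_Im2 sqr_normc. Qed.

Lemma nsq_normE z : (nsq z)%:C = `|z| ^+ 2.
Proof. exact: add_Re2_Im2. Qed.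

Lemma nsqM z w : nsq (z * w) = nsq z * nsq w.
Proof. by apply: complexI; rewrite rmorphM /= !nsq_normE normrM exprMn. Qed.

Lemma nsq_ge0 z : 0 <= nsq z.
Proof. by rewrite addr_ge0 ?sqr_ge0. Qed.

Lemma nsq0 : nsq 0 = 0.
Proof. by rewrite /nsq /= expr0n addr0. Qed.

Lemma nsq_eq0 z : (nsq z == 0) = (z == 0).
Proof.
case: z => a b; rewrite /nsq /= paddr_eq0 ?sqr_ge0 // !sqrf_eq0.
by rewrite eq_complex.
Qed.

Lemma nsqJ z : nsq z^* = nsq z.
Proof. by case: z => a b; rewrite /nsq /= sqrrN. Qed.

Lemma nsqN z : nsq (- z) = nsq z.
Proof. by case: z => a b; rewrite /nsq /= !sqrrN. Qed.

Lemma nsqC x : nsq x%:C = x ^+ 2.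
Proof. by rewrite /nsq /= expr0n addr0. Qed.

Lemma nsqD_le z w : nsq (z + w) <= 2 * nsq z + 2 * nsq w.
Proof.
case: z w => a b [c d]; rewrite /nsq /=.
have := sqr_ge0 (a - c); have := sqr_ge0 (b - d); lra.
Qed.

Lemma conjM z w : (z * w)^* = z^* * w^*.
Proof. exact: rmorphM. Qed.

Lemma conjX z n : (z ^+ n)^* = z^* ^+ n.
Proof. exact: rmorphXn. Qed.

Lemma conj_sum (J : Type) (r : seq J) (F : J -> C) :
  (\sum_(i <- r) F i)^* = \sum_(i <- r) (F i)^*.
Proof. exact: rmorph_sum. Qed.

Lemma conjR x : (x%:C)^* = x%:C :> C.
Proof. exact: conjc_real. Qed.

Definition expi t : C := cos t +i* sin t.

Lemma expiD x y : expi (x + y) = expi x * expi y.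
Proof. by rewrite /expi cosD sinD; congr (_ +i* _); rewrite addrC. Qed.

Lemma expi0 : expi 0 = 1.
Proof. by rewrite /expi cos0 sin0. Qed.

Lemma expiN x : expi (- x) = (expi x)^*.
Proof. by rewrite /expi cosN sinN. Qed.

Lemma nsq_expi x : nsq (expi x) = 1.
Proof. exact: cos2Dsin2. Qed.

Lemma expiMn x n : expi (x *+ n) = expi x ^+ n.
Proof. by elim: n => [|n IH]; rewrite ?expi0 // mulrS exprS expiD IH. Qed.

Lemma expi2pi : expi (2 * pi) = 1.
Proof. by rewrite /expi mulr_natl cos2pi sin2pi. Qed.

Lemma expi2piz (k : int) : expi (2 * pi * k%:~R) = 1.
Proof.
have e n : expi (2 * pi * n%:R) = 1 by rewrite mulr_natr expiMn expi2pi expr1n.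
case: k => n; first exact: e.
rewrite NegzE mulrNz mulrN expiN e; exact: conjc1.
Qed.

Lemma cos_lt1 t : 0 < t -> t < 2 * pi -> cos t < 1.
Proof.
move=> t0 t2; have -> : t = (t / 2) *+ 2 by lra.
rewrite cos_mulr2n; have : 0 < sin (t / 2) by apply: sin_gt0_pi; lra.
move/(fun h => exprn_gt0 2 h); rewrite sin2cos2; lra.
Qed.

Definition omega (K : nat) : C := expi (2 * pi / K%:R).

Lemma omegaX K d : omega K ^+ d = expi (2 * pi * d%:R / K%:R).
Proof. by rewrite /omega -expiMn -[X in expi X]mulr_natr mulrAC. Qed.

Lemma omega_unity K : (0 < K)%N -> omega K ^+ K = 1.
Proof.
by move=> K0; rewrite omegaX -mulrA divff ?mulr1 ?expi2pi // pnatr_eq0 -lt0n.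
Qed.

Lemma omega_neq0 K : omega K != 0.
Proof. by rewrite -nsq_eq0 nsq_expi oner_eq0. Qed.

Lemma omegaV K : (omega K)^* = (omega K)^-1.
Proof.
apply: (mulfI (omega_neq0 K)); rewrite divff ?omega_neq0 //.
by rewrite -nsqE nsq_expi.
Qed.

(** After reduction of [d] modulo [K] the angle lies in [[0, 2 pi)], where the cosine is 1 only at
    0. Besides orthogonality of characters, this locates the zeros of [fc] on grids. *)
Lemma cos_dvdn K d : (0 < K)%N -> cos (2 * pi * d%:R / K%:R) = 1 :> R -> (K %| d)%N.
Proof.
move=> K0 h; have k0 : 0 < K%:R :> R by rewrite ltr0n.
have : complex.Re (omega K ^+ d) = 1 by rewrite omegaX.
rewrite (divn_eq d K) exprD mulnC exprM omega_unity // expr1n mul1r omegaX /=.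
move=> h'; rewrite dvdn_addr ?dvdn_mulr //.
have [->//|r0] := posnP (d %% K)%N.
suff : cos (2 * pi * (d %% K)%:R / K%:R) < 1 :> R by rewrite h' ltxx.
have p0 := pi_gt0 R; apply: cos_lt1; first by rewrite !mulr_gt0 ?invr_gt0 ?ltr0n.
by rewrite ltr_pdivrMr // ltr_pM2l ?mulr_gt0 // ltr_nat ltn_mod.
Qed.

Lemma omega_eq1 K d : (0 < K)%N -> omega K ^+ d = 1 -> (K %| d)%N.
Proof.
move=> K0; rewrite omegaX => /(congr1 (@complex.Re R)) /= h; exact: cos_dvdn h.
Qed.

Lemma omega_orth K (i i' : 'I_K) :
  \sum_(j < K) (omega K ^+ i * (omega K)^* ^+ i') ^+ j = (K * (i == i'))%:R.
Proof.
have K0 : (0 < K)%N by rewrite (leq_ltn_trans _ (ltn_ord i)).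
set z := omega K ^+ i * _; have [ii|ii] := eqVneq i i'.
  rewrite (_ : z = 1); last by rewrite /z ii omegaV -exprMn divff ?omega_neq0 ?expr1n.
  by under eq_bigr do rewrite expr1n; rewrite sumr_const card_ord muln1.
have z1 : z - 1 != 0.
  rewrite subr_eq0; apply: contra ii => /eqP; rewrite /z omegaV exprVn => zz.
  have {}zz : omega K ^+ i = omega K ^+ i'.
    by rewrite -[RHS]mul1r -zz mulfVK // expf_neq0 // omega_neq0.
  have wlog (a b : 'I_K) : (a <= b)%N -> omega K ^+ a = omega K ^+ b -> a == b.
    move=> ab e; have : omega K ^+ (b - a) = 1.
      apply: (mulfI (expf_neq0 a (omega_neq0 K))).
      by rewrite -exprD subnKC // mulr1.
    move/(omega_eq1 K0) => /dvdn_leq h.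
    have [ba|ba] := posnP (b - a)%N; first by rewrite -val_eqE eqn_leq ab -subn_eq0 ba.
    by have := h ba; have := ltn_ord b; lia.
  have [ab|ab] := leqP i i'; first exact: wlog.
  by rewrite eq_sym; apply: wlog => //; exact: ltnW.
apply: (mulfI z1); rewrite -subrX1 muln0 mulr0.
rewrite exprMn -!exprM ![(_ * K)%N]mulnC !exprM omegaV exprVn omega_unity //.
by rewrite invr1 !expr1n mulr1 subrr.
Qed.

Lemma nsq_sumE (I : finType) (F : I -> C) :
  (nsq (\sum_i F i))%:C = \sum_i \sum_j F i * (F j)^*.
Proof.
rewrite nsqE conj_sum mulr_suml; apply: eq_bigr => i _.
by rewrite mulr_sumr.
Qed.

Lemma parseval1 K (g : 'I_K -> C) :
  \sum_(j < K) nsq (\sum_(i < K) g i * omega K ^+ (i * j)) = K%:R * \sum_i nsq (g i).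
Proof.
apply: complexI; rewrite rmorphM rmorph_nat !rmorph_sum /= mulr_sumr.
under eq_bigr => j _.
  rewrite nsq_sumE.
  over.
rewrite exchange_big /=; apply: eq_bigr => i _; rewrite exchange_big /=.
rewrite (bigD1 i) //= [X in _ + X]big1 ?addr0 => [|i' ii'].
  under eq_bigr => j _.
    rewrite conjM conjX omegaV mulrACA -nsqE exprVn divff ?mulr1.
    over.
    by rewrite expf_neq0 // omega_neq0.
  by rewrite sumr_const card_ord mulr_natl.
under eq_bigr => j _.
  rewrite conjM conjX mulrACA [(i * j)%N]mulnC [(i' * j)%N]mulnC.
  rewrite ![(j * _)%N]mulnC !exprM -exprMn.
  over.
by rewrite -mulr_sumr omega_orth eq_sym (negPf ii') muln0 mulr0.
Qed.

Lemma parseval2 K1 K2 (g : 'I_K1 -> 'I_K2 -> C) :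
  \sum_(j1 < K1) \sum_(j2 < K2) nsq (\sum_(i1 < K1) \sum_(i2 < K2)
    g i1 i2 * (omega K1 ^+ (i1 * j1) * omega K2 ^+ (i2 * j2)))
  = (K1 * K2)%:R * \sum_i1 \sum_i2 nsq (g i1 i2).
Proof.
rewrite exchange_big /=.
under eq_bigr => j2 _.
  under eq_bigr => j1 _.
    under eq_bigr => i1 _.
      under eq_bigr do rewrite mulrCA mulrC.
      rewrite -mulr_suml.
      over.
    over.
  rewrite (parseval1 (fun i1 => \sum_(i2 < K2) g i1 i2 * omega K2 ^+ (i2 * j2))).
  over.
rewrite -mulr_sumr exchange_big /= natrM -mulrA; congr (_ * _).
rewrite mulr_sumr; by apply: eq_bigr => i1 _; rewrite parseval1.
Qed.

End Trig.

(** * The operator on plane waves *)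

Section Operator.

Definition offs : seq int := [:: -1; 0; 1].

(** The full three by three block minus its centre: the block sum factorises on plane waves, which
    gives the symbol [fc x * fc y - 1]. *)
Definition lap (K : pzRingType) (u : Z2 -> K) (n : Z2) : K :=
  \sum_(a <- offs) \sum_(b <- offs) u (n.1 + a, n.2 + b) - u n.

(** Over any ring, since it acts on complex functions and, in the Neumann series, on real ones. *)
Definition hop (K : pzRingType) (q : Z2 -> K) (u : Z2 -> K) (n : Z2) : K :=
  lap u n + q n * u n.

Lemma sum_offs (V : nmodType) (F : int -> V) :
  \sum_(a <- offs) F a = F (-1) + (F 0 + F 1).
Proof. by rewrite /offs !big_cons big_nil addr0. Qed.

Lemma offs_norm a : a \in offs -> `|a| <= 1.
Proof. by rewrite !inE => /or3P[] /eqP ->. Qed.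

Lemma offsN (V : nmodType) (F : int -> V) :
  \sum_(a <- offs) F (- a) = \sum_(a <- offs) F a.
Proof. by rewrite !sum_offs opprK oppr0 addrA addrC addrA addrAC -addrA. Qed.

Lemma supp_hop (K : comNzRingType) N (q : Z2 -> K) (z : K) (u : Z2 -> K) : supp N u -> supp N.+1 (fun n => hop q u n - z * u n).
Proof.
move=> u0 n nb; rewrite /hop /lap (suppS u0 nb) !mulr0 !subr0 addr0 big_seq.
apply: big1 => a ao; rewrite big_seq; apply: big1 => b bo.
by apply: (supp_shift u0) => //; exact: offs_norm.
Qed.


End Operator.

(** Splits the frequencies of a large box into a base frequency [t] and a multiple of [L]; the
    multiples run through the plane waves of one fibre. *)
Lemma big_ord_regroup (V : nmodType) p L (F : nat -> V) :
  \sum_(j < p * L) F j = \sum_(t < L) \sum_(l < p) F (t + L * l)%N.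
Proof.
rewrite exchange_big /= -(big_mkord xpredT F) big_nat_mul big_mkord.
apply: eq_bigr => l _; rewrite -{1}[(l * L)%N]add0n mulSn big_addn addnK.
by rewrite big_mkord; apply: eq_bigr => t _; rewrite mulnC.
Qed.

Lemma mod_ord p (p0 : (0 < p)%N) (k : int) : (absz (k %% p)%Z < p)%N.
Proof.
have p0' : p%:Z != 0 by lia.
have := modz_ge0 k p0'; have := @ltz_pmod k p%:Z; lia.
Qed.


Lemma per_mod (V : Type) p (f : int -> V) : (forall k, f (k + p%:Z) = f k) ->
  forall k, f k = f (k %% p)%Z.
Proof.
move=> fp k; have fn m k' : f (k' + (m * p)%N%:Z) = f k'.
  elim: m k' => [|m IH] k'; first by rewrite mul0n addr0.
  by rewrite mulSn PoszD addrA IH fp.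
rewrite {1}(divz_eq k p); case: (k %/ p)%Z => m.
  by rewrite addrC -PoszM fn.
rewrite NegzE -[in LHS](fn m.+1); congr f; lia.
Qed.


Section Waves.
Variable R : realType.
Local Notation C := R[i].

Definition pw (x y : R) (n : Z2) : C := expi (x * n.1%:~R + y * n.2%:~R).

Definition ft N (u : Z2 -> C) (x y : R) : C := bsum N (fun n => u n * pw x y n).

Lemma nsq_pw x y n : nsq (pw x y n) = 1.
Proof. exact: nsq_expi. Qed.

Lemma pwD x y n a b : pw x y (n.1 + a, n.2 + b) = pw x y n * pw x y (a, b).
Proof. by rewrite /pw /= -expiD !intrD; congr expi; ring. Qed.

Lemma parseval_box N (u : Z2 -> C) : (0 < N)%N ->
  \sum_(j1 < N.*2) \sum_(j2 < N.*2)
    nsq (ft N u (2 * pi * j1%:R / (N.*2)%:R) (2 * pi * j2%:R / (N.*2)%:R))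
  = (N.*2 * N.*2)%:R * bsum N (fun n => nsq (u n)).
Proof.
move=> N0; have K0 : (N.*2)%:R != 0 :> R by rewrite pnatr_eq0; lia.
pose g (i1 i2 : 'I_(N.*2)) := u (i1%:Z - N%:Z, i2%:Z - N%:Z).
rewrite /bsum /isum -(parseval2 g).
apply: eq_bigr => j1 _; apply: eq_bigr => j2 _.
set x := 2 * pi * j1%:R / _; set y := 2 * pi * j2%:R / _.
(* The box starts at [-N] and the finite transform at 0; the phase of the corner, of modulus one,
   makes up for it. *)
rewrite -[RHS]mul1r -(nsq_pw x y (- N%:Z, - N%:Z)) -nsqM; congr nsq.
rewrite /ft /bsum /isum mulr_sumr; apply: eq_bigr => i1 _.
rewrite mulr_sumr; apply: eq_bigr => i2 _.
rewrite mulrCA; congr (_ * _); rewrite (pwD x y (i1%:Z, i2%:Z)) mulrC; congr (_ * _).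
rewrite /pw !omegaX -expiD /x /y /= !natrM; congr expi.
by rewrite !mulrA ![_ / _ * _]mulrAC ![_ * j1%:R * _]mulrAC ![_ * j2%:R * _]mulrAC.
Qed.

Lemma expi_grid p (l : nat) (k : int) : (0 < p)%N ->
  expi (2 * pi * l%:R / p%:R * k%:~R) = omega R p ^+ (l * absz (k %% p)%Z).
Proof.
move=> p0; have p0' : p%:Z != 0 by lia.
rewrite omegaX {1}(divz_eq k p) intrD intrM mulrDr expiD.
have pR : p%:R != 0 :> R by rewrite pnatr_eq0; lia.
have -> : 2 * pi * l%:R / p%:R * ((k %/ p)%Z%:~R * p%:~R) =
    2 * pi * ((l%:Z * (k %/ p)%Z)%:~R) :> R.
  by rewrite intrM -!pmulrn; field.
have e : (absz (k %% p)%Z)%:R = ((k %% p)%Z)%:~R :> R.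
  by rewrite -[in RHS](gez0_abs (modz_ge0 k p0')).
by rewrite expi2piz mul1r; congr expi; rewrite natrM e; ring.
Qed.


End Waves.

(** * Plane waves of one fibre and the matrix of the potential *)

Section Fibers.
Variable R : realType.
Local Notation C := R[i].
Variables (p1 p2 : nat).
Hypotheses (p1_gt0 : (0 < p1)%N) (p2_gt0 : (0 < p2)%N).
Local Notation I := ('I_p1 * 'I_p2)%type.
Implicit Types (l c : I) (n : Z2).

Definition char l c : C := omega R p1 ^+ (l.1 * c.1) * omega R p2 ^+ (l.2 * c.2).

Definition wave (x y : R) l n : C :=
  pw (x + 2 * pi * l.1%:R / p1%:R) (y + 2 * pi * l.2%:R / p2%:R) n.

Definition cell n : I := (Ordinal (mod_ord p1_gt0 n.1), Ordinal (mod_ord p2_gt0 n.2)).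

Definition of_cell c : Z2 := (c.1%:Z, c.2%:Z).

(** Bloch form: a phase common to the whole fibre times a periodic function. The quasimomentum
    enters only through the phase. *)
Lemma wave_char x y l n : wave x y l n = pw x y n * char l (cell n).
Proof.
rewrite /wave /pw /char -!expi_grid // -!expiD; congr expi; ring.
Qed.

Lemma char_orth c c' : \sum_l (char l c)^* * char l c' = (p1 * p2 * (c == c'))%:R.
Proof.
rewrite -(pair_bigA _ (fun (a : 'I_p1) (b : 'I_p2) =>
  (omega R p1 ^+ (a * c.1) * omega R p2 ^+ (b * c.2))^* *
  (omega R p1 ^+ (a * c'.1) * omega R p2 ^+ (b * c'.2)))) /=.
transitivity ((\sum_(a < p1) (omega R p1 ^+ c'.1 * (omega R p1)^* ^+ c.1) ^+ a)
  * (\sum_(b < p2) (omega R p2 ^+ c'.2 * (omega R p2)^* ^+ c.2) ^+ b)).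
  rewrite mulr_suml; apply: eq_bigr => a _; rewrite mulr_sumr.
  apply: eq_bigr => b _; rewrite conjM mulrACA.
  have h K (k m m' : nat) : (omega R K ^+ (k * m))^* * omega R K ^+ (k * m')
      = (omega R K ^+ m' * (omega R K)^* ^+ m) ^+ k.
    by rewrite conjX exprMn -!exprM ![(_ * k)%N]mulnC mulrC.
  by rewrite !h.
rewrite !omega_orth -natrM mulnACA ![c'.1 == _]eq_sym ![c'.2 == _]eq_sym.
by case: c c' => [a b] [a' b']; rewrite xpair_eqE mulnb.
Qed.

Lemma char_parseval (g : I -> C) :
  \sum_c nsq (\sum_l g l * char l c) = (p1 * p2)%:R * \sum_l nsq (g l).
Proof.
have -> : \sum_l nsq (g l) = \sum_a \sum_b nsq (g (a, b)).
  by rewrite pair_bigA; apply: eq_bigr => -[].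
rewrite -(parseval2 (fun a b => g (a, b))) pair_bigA; apply: eq_bigr => c _.
by rewrite pair_bigA; congr nsq; apply: eq_bigr => -[a b] _.
Qed.

Variable Q : Z2 -> R.
Hypothesis Q_per : biperiodic p1 p2 Q.

Lemma Q_cell n : Q n = Q (of_cell (cell n)).
Proof.
case: n => a b; rewrite (@per_mod _ p1 (fun a => Q (a, b))); last first.
  by move=> k; have [] := Q_per k b.
rewrite (@per_mod _ p2 (fun b => Q ((a %% p1)%Z, b))); last first.
  by move=> k; have [] := Q_per (a %% p1)%Z k.
by rewrite /of_cell /= !gez0_abs // modz_ge0 //; lia.
Qed.

(* Matrix of the multiplication by [Q] in the basis of plane waves of a fibre;
   it does not depend on the quasimomentum. *)
Definition potential_coef l l' : C :=
  (p1 * p2)%:R^-1 * \sum_c (Q (of_cell c))%:C * (char l' c * (char l c)^*).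

Lemma pq_neq0 : (p1 * p2)%:R != 0 :> C.
Proof. by rewrite pnatr_eq0; lia. Qed.

(** Once the sum over [l'] is taken first, orthogonality of the characters leaves only the term of
    the cell of [n]. *)
Lemma potential_wave x y l n :
  (Q n)%:C * wave x y l n = \sum_l' potential_coef l' l * wave x y l' n.
Proof.
rewrite Q_cell; under eq_bigr do rewrite wave_char mulrCA.
rewrite -mulr_sumr wave_char mulrCA; congr (_ * _).
set c := cell n; rewrite /potential_coef.
under eq_bigr do rewrite -mulrA mulr_suml.
rewrite -mulr_sumr exchange_big /=.
under eq_bigr => c' _.
  under eq_bigr do rewrite -!mulrA.
  rewrite -!mulr_sumr char_orth.
  over.
rewrite (bigD1 c) //= [X in _ + X]big1 => [|c' /negPf ->]; last by rewrite muln0 !mulr0.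
rewrite eqxx muln1 addr0 /char /=; move: (p1 * p2)%:R pq_neq0 => z z0.
by field.
Qed.

Lemma potential_coefJ l l' : (potential_coef l l')^* = potential_coef l' l.
Proof.
rewrite /potential_coef conjM conj_sum; congr (_ * _).
  rewrite -(rmorph_nat (real_complex R)) -fmorphV; exact: conjc_real.
apply: eq_bigr => c _; rewrite conjM conjR (conjM (char l' c)) conjCK.
by congr (_ * _); rewrite mulrC.
Qed.

End Fibers.

Section FreeSymbol.
Variable R : realType.
Local Notation C := R[i].

Definition fc (t : R) : R := 1 + 2 * cos t.

Lemma sum_expi_offs (x : R) : \sum_(a <- offs) expi (x * a%:~R) = (fc x)%:C.
Proof.
rewrite sum_offs mulr0 expi0 mulr1 mulrN1 expiN.
apply/eqP; rewrite eq_complex /= /fc; apply/andP; split; apply/eqP; ring.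
Qed.

Lemma sum_pw_offs (x y : R) :
  \sum_(a <- offs) \sum_(b <- offs) pw x y (a, b) = (fc x * fc y)%:C.
Proof.
rewrite rmorphM /= -!sum_expi_offs mulr_suml; apply: eq_bigr => a _.
by rewrite mulr_sumr; apply: eq_bigr => b _; rewrite -expiD.
Qed.

Lemma realC_subr1 (a : R) (z : C) : (a - 1)%:C * z = a%:C * z - z.
Proof. by rewrite rmorphB rmorph1 mulrBl mul1r. Qed.

Lemma lap_pw (x y : R) n : lap (pw x y) n = (fc x * fc y - 1)%:C * pw x y n.
Proof.
rewrite /lap realC_subr1 -sum_pw_offs mulr_suml; congr (_ - _).
apply: eq_bigr => a _; rewrite mulr_suml; apply: eq_bigr => b _.
by rewrite pwD mulrC.
Qed.

(** The box exceeds the support of [u], so translating the sum by an offset leaves no boundary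
    term. *)
Lemma ft_lap N M (u : Z2 -> C) (x y : R) : supp N u -> (N < M)%N ->
  ft M (lap u) x y = (fc x * fc y - 1)%:C * ft M u x y.
Proof.
move=> u0 NM; rewrite realC_subr1 -sum_pw_offs.
have -> : \sum_(a <- offs) \sum_(b <- offs) pw x y (a, b) =
    \sum_(a <- offs) \sum_(b <- offs) pw x y (- a, - b).
  rewrite (offsN (fun a => \sum_(b <- offs) pw x y (a, - b))).
  by apply: eq_bigr => a _; rewrite (offsN (fun b => pw x y (a, b))).
rewrite /ft.
rewrite (eq_bsum (G := fun n => (\sum_(a <- offs) \sum_(b <- offs)
  u (n.1 + a, n.2 + b) * pw x y n) + -1 * (u n * pw x y n))); last first.
  move=> n _; rewrite /lap mulrBl mulN1r mulr_suml; congr (_ - _).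
  by apply: eq_bigr => a _; rewrite mulr_suml.
rewrite bsumD bsumZ mulN1r; congr (_ - _); rewrite bsum_sum mulr_suml.
apply: eq_big_seq => a ao; rewrite bsum_sum mulr_suml.
apply: eq_big_seq => b bo; rewrite -bsumZ.
pose F (n : Z2) := u n * pw x y (n.1 - a, n.2 - b).
transitivity (bsum M (fun n => F (n.1 + a, n.2 + b))).
  by apply: eq_bsum => -[n m] _; rewrite /F /= !addrK.
rewrite (@bsum_shift _ N) ?offs_norm // => [|n nb]; last by rewrite /F u0 ?mul0r.
by apply: eq_bsum => -[n m] _; rewrite /F (pwD x y (n, m)) mulrA mulrC.
Qed.

End FreeSymbol.

Section FiberMatrix.
Variable R : realType.
Local Notation C := R[i].
Variables (p1 p2 : nat).
Hypotheses (p1_gt0 : (0 < p1)%N) (p2_gt0 : (0 < p2)%N).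
Local Notation I := ('I_p1 * 'I_p2)%type.
Local Notation dim := #|{: I}|.
Variable Q : Z2 -> R.
Hypothesis Q_per : biperiodic p1 p2 Q.
Implicit Types (l c : I) (n : Z2) (x y E : R).

Definition freeval x y l : R :=
  fc (x + 2 * pi * l.1%:R / p1%:R) * fc (y + 2 * pi * l.2%:R / p2%:R) - 1.

Definition potmx : 'M[C]_dim :=
  \matrix_(k, k') potential_coef Q (enum_val k) (enum_val k').

Definition fibmx x y : 'M[C]_dim :=
  diag_mx (\row_k (freeval x y (enum_val k))%:C) + potmx.

Lemma sum_enum_val (V : nmodType) (F : I -> V) :
  \sum_(k < dim) F (enum_val k) = \sum_l F l.
Proof. by rewrite -(big_enum_val (A := predT)). Qed.

Lemma fib_herm x y : fibmx x y \is hermsymmx.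
Proof.
rewrite hermsymE; apply/eqP/matrixP => k k'; rewrite !mxE [RHS]rmorphD.
rewrite /= potential_coefJ //; congr (_ + _); rewrite [k' == k]eq_sym.
by case: eqP => [->|_]; rewrite ?mulr1n ?conjR // !mulr0n conjC0.
Qed.

Lemma hop_wave x y l n :
  hop (fun n => (Q n)%:C) (wave x y l) n = (freeval x y l)%:C * wave x y l n
  + \sum_l' potential_coef Q l' l * wave x y l' n.
Proof. by rewrite /hop lap_pw potential_wave. Qed.

Definition fibft M (u : Z2 -> C) x y : 'rV[C]_dim :=
  \row_k bsum M (fun n => u n * wave x y (enum_val k) n).

Lemma fibft_hop N M (u : Z2 -> C) x y E : supp N u -> (N < M)%N ->
  fibft M (fun n => hop (fun n => (Q n)%:C) u n - E%:C * u n) x y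
  = fibft M u x y *m (fibmx x y - E%:C%:M).
Proof.
move=> u0 NM; rewrite mulmxBr mulmxDr mul_mx_diag mul_mx_scalar.
apply/rowP => k; rewrite !mxE /hop.
rewrite (eq_bsum (G := fun n => lap u n * wave x y (enum_val k) n +
  ((Q n)%:C * (u n * wave x y (enum_val k) n) +
  (- E%:C) * (u n * wave x y (enum_val k) n)))); last by move=> n _; ring.
rewrite !bsumD !bsumZ mulNr addrA; congr (_ + _ - _).
  by rewrite [LHS](ft_lap _ _ u0 NM) mulrC.
under [RHS]eq_bigr do rewrite !mxE.
rewrite (sum_enum_val (fun l => bsum M (fun n => u n * wave x y l n)
  * potential_coef Q l (enum_val k))).
transitivity (bsum M (fun n => \sum_l u n * wave x y l n
    * potential_coef Q l (enum_val k))).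
  apply: eq_bsum => n _; rewrite mulrCA potential_wave // mulr_sumr.
  by apply: eq_bigr => l _; rewrite [potential_coef _ _ _ * _]mulrC mulrA.
rewrite bsum_sum; apply: eq_bigr => l _.
by rewrite mulrC -bsumZ; apply: eq_bsum => n _; rewrite mulrC.
Qed.

Lemma sqnormC m (v : 'rV[C]_m) : sqnorm v = (\sum_k nsq (v 0 k))%:C.
Proof. by rewrite rmorph_sum; apply: eq_bigr => k _; exact/esym/nsq_normE. Qed.

(** The side [2 N] is a multiple of each period. Writing [2 N = p * L], the frequency [t + L * l] is
    the base frequency [t] shifted by [2 pi l / p], so Parseval on the box sums over complete
    fibres. *)
Lemma fibft_parseval (u : Z2 -> C) M (N := (M * (p1 * p2))%N) : (0 < M)%N ->
  (N.*2 * N.*2)%:R * bsum N (fun n => nsq (u n))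
  = \sum_(t1 < M * p2.*2) \sum_(t2 < M * p1.*2) \sum_k
    nsq (fibft N u (2 * pi * t1%:R / (N.*2)%:R) (2 * pi * t2%:R / (N.*2)%:R) 0 k).
Proof.
move=> M0; have N0 : (0 < N)%N by rewrite !muln_gt0 M0 p1_gt0 p2_gt0.
have e1 : N.*2 = (p1 * (M * p2.*2))%N by rewrite /N; lia.
have e2 : N.*2 = (p2 * (M * p1.*2))%N by rewrite /N; lia.
rewrite -parseval_box //.
pose G (a b : nat) := nsq (ft N u (2 * pi * a%:R / (N.*2)%:R) (2 * pi * b%:R / (N.*2)%:R)).
transitivity (\sum_(a < p1 * (M * p2.*2)) \sum_(b < p2 * (M * p1.*2)) G a b).
  by rewrite -e1 -e2.
rewrite (big_ord_regroup p1 (M * p2.*2) (fun a => \sum_(b < _) G a b)).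
apply: eq_bigr => t1 _.
under eq_bigr do rewrite (big_ord_regroup p2 (M * p1.*2) (fun b => G _ b)).
rewrite exchange_big; apply: eq_bigr => t2 _ /=; rewrite pair_bigA -sum_enum_val.
apply: eq_bigr => k _; rewrite mxE /G /ft /wave.
have N0R : (N.*2)%:R != 0 :> R by rewrite pnatr_eq0; lia.
have p1R : p1%:R != 0 :> R by rewrite pnatr_eq0; lia.
have p2R : p2%:R != 0 :> R by rewrite pnatr_eq0; lia.
have e p (L t l : nat) : N.*2 = (p * L)%N -> p%:R != 0 :> R ->
    2 * pi * (t + L * l)%:R / (N.*2)%:R
    = 2 * pi * t%:R / (N.*2)%:R + 2 * pi * l%:R / p%:R :> R.
  move=> e pR; move: N0R; rewrite natrD mulrDr mulrDl e !natrM => h; congr (_ + _).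
  by field; rewrite pR; move: h; rewrite mulf_eq0 negb_or => /andP[_ ->].
by rewrite (e p1 (M * p2.*2)%N) // (e p2 (M * p1.*2)%N).
Qed.

End FiberMatrix.

(** * Fibres and the resolvent set *)

Section LowerBound.
Variable R : realType.
Local Notation C := R[i].

Lemma hop_sum (I : Type) (r : seq I) (q : Z2 -> C) (a : I -> C) (f : I -> Z2 -> C) n :
  hop q (fun n => \sum_(i <- r) a i * f i n) n = \sum_(i <- r) a i * hop q (f i) n.
Proof.
rewrite /hop /lap; under eq_bigr do rewrite exchange_big /=.
rewrite exchange_big /= mulr_sumr -sumrB -big_split /=; apply: eq_bigr => i _.
rewrite mulrDr mulrBr mulrCA mulr_sumr; congr (_ - _ + _).
by apply: eq_bigr => b _; rewrite mulr_sumr.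
Qed.

Lemma nsq_sum_offs (F : int -> C) :
  nsq (\sum_(a <- offs) F a) <= 3 * \sum_(a <- offs) nsq (F a).
Proof.
rewrite !sum_offs; case: (F (-1)) (F 0) (F 1) => [a b] [c d] [e f]; rewrite /nsq /=.
have := sqr_ge0 (a - c); have := sqr_ge0 (b - d); have := sqr_ge0 (a - e).
have := sqr_ge0 (b - f); have := sqr_ge0 (c - e); have := sqr_ge0 (d - f).
nra.
Qed.

(** The factor 18 is 2 for splitting off the diagonal term, times 3 for Cauchy-Schwarz in each of
    the two directions. *)
Lemma nsq_hop_le (q : Z2 -> C) (z : C) (u : Z2 -> C) n :
  nsq (hop q u n - z * u n) <=
  18 * (\sum_(a <- offs) \sum_(b <- offs) nsq (u (n.1 + a, n.2 + b)))
  + 2 * nsq (q n - z - 1) * nsq (u n).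
Proof.
have -> : hop q u n - z * u n =
    \sum_(a <- offs) \sum_(b <- offs) u (n.1 + a, n.2 + b) + (q n - z - 1) * u n.
  by rewrite /hop /lap; ring.
apply: le_trans (nsqD_le _ _) _; rewrite nsqM [2 * (_ * _)]mulrA lerD2r.
have -> : (18 : R) = 2 * (3 * 3) by ring.
rewrite -mulrA ler_wpM2l // -mulrA; apply: le_trans (nsq_sum_offs _) _.
rewrite ler_wpM2l // mulr_sumr; apply: ler_sum => a _; exact: nsq_sum_offs.
Qed.

(** The factor 162 is 18 times the nine translates, each of which fits into the next larger box. *)
Lemma bsum_hop_le (q : Z2 -> C) (z : C) (u : Z2 -> C) N K :
  (forall n, nsq (q n - z - 1) <= K) ->
  bsum N (fun n => nsq (hop q u n - z * u n))
  <= (162 + 2 * K) * bsum N.+1 (fun n => nsq (u n)).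
Proof.
move=> hK.
have K0 : 0 <= K by apply: le_trans (hK (0, 0)); exact: nsq_ge0.
apply: (le_trans (bsum_le _ (nsq_hop_le q z u))).
rewrite bsumD bsumZ [leRHS]mulrDl; apply: lerD.
  have -> : (162 : R) = 18 * 9 by ring.
  rewrite -mulrA ler_wpM2l // bsum_sum.
  have -> : 9 * bsum N.+1 (fun n => nsq (u n)) =
     \sum_(a <- offs) \sum_(b <- offs) bsum N.+1 (fun n => nsq (u n)).
    by rewrite !sum_offs; ring.
  rewrite big_seq [leRHS]big_seq; apply: ler_sum => a ao.
  rewrite bsum_sum big_seq [leRHS]big_seq; apply: ler_sum => b bo.
  by apply: (@bsum_shift_le _ N a b (fun n => nsq (u n)));
    rewrite ?offs_norm // => n; exact: nsq_ge0.
apply: (@le_trans _ _ (bsum N (fun n => 2 * K * nsq (u n)))).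
  by apply: bsum_le => n; rewrite ler_wpM2r ?nsq_ge0 // ler_wpM2l.
rewrite bsumZ ler_wpM2l ?mulr_ge0 //; apply: bsum_mono => // n; exact: nsq_ge0.
Qed.

Variables (p1 p2 : nat).
Hypotheses (p1_gt0 : (0 < p1)%N) (p2_gt0 : (0 < p2)%N).
Local Notation I := ('I_p1 * 'I_p2)%type.
Local Notation dim := #|{: I}|.
Variable Q : Z2 -> R.
Hypothesis Q_per : biperiodic p1 p2 Q.
Local Notation H := (hop (fun n => (Q n)%:C)).

(* Equivalent to [E] being in the resolvent set, by [below_of_resolvent] and
   [resolvent_of_coercive]. *)
Definition below (E : R) := exists2 e : R, 0 < e &
  forall N (u : Z2 -> C), supp N u ->
  e * bsum N (fun n => nsq (u n))
  <= bsum N.+1 (fun n => nsq (H u n - E%:C * u n)).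

(** By Parseval on a box containing the supports of [u] and of [(H - E) u], the estimate is a sum of
    estimates over the fibres. *)
Lemma fiber_below (E r : R) : 0 < r ->
  (forall x y (v : 'rV[C]_dim),
    r%:C * sqnorm v <= sqnorm (v *m (fibmx p1 p2 Q x y - E%:C%:M))) ->
  below E.
Proof.
move=> r0 hr; exists r => // N u u0; pose M := (N.+2 * (p1 * p2))%N.
have NM : (N.+1 < M)%N by rewrite /M leq_pmulr // muln_gt0 p1_gt0.
have n0 : nsq (0 : C) = 0 := nsq0 R.
have s1 : supp N (fun n => nsq (u n)) by move=> n nb; rewrite u0.
pose w n := H u n - E%:C * u n.
have s2 : supp N.+1 (fun n => nsq (w n)).
  by move=> n nb; rewrite /w (supp_hop _ _ u0 nb).
rewrite -(bsum_ext s1 (M := M)) ?(ltnW (ltnW NM)) //.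
rewrite -(bsum_ext s2 (M := M)) ?(ltnW NM) //.
have k0 : 0 < (M.*2 * M.*2)%:R :> R by rewrite ltr0n; lia.
rewrite -(ler_pM2l k0) mulrCA !fibft_parseval // mulr_sumr; apply: ler_sum => t1 _.
rewrite mulr_sumr; apply: ler_sum => t2 _; rewrite -lecR rmorphM /= -!sqnormC.
by rewrite (fibft_hop p1_gt0 p2_gt0 Q_per _ _ _ u0 (ltnW NM)).
Qed.

Lemma potential_bounded : exists q : R, forall n, `|Q n| <= q.
Proof.
exists (\sum_(c : I) `|Q (of_cell c)|) => n; rewrite (Q_cell p1_gt0 p2_gt0 Q_per n).
by rewrite (bigD1 (cell p1_gt0 p2_gt0 n)) //= lerDl sumr_ge0.
Qed.

Lemma shift_bounded (z : C) : exists K : R, forall n, nsq ((Q n)%:C - z - 1) <= K.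
Proof.
have [q hq] := potential_bounded; exists (2 * q ^+ 2 + 2 * nsq (- z - 1)) => n.
rewrite -addrA; apply: le_trans (nsqD_le _ _) _; rewrite lerD2r ler_wpM2l //.
by rewrite nsqC -[Q n ^+ 2]real_normK ?num_real // lerXn2r ?nnegrE // (le_trans _ (hq n)).
Qed.

Lemma isum_mod p (p0 : (0 < p)%N) (V : comNzRingType) M (h : 'I_p -> V) :
  isum (M * p) (fun k => h (Ordinal (mod_ord p0 k))) = (M.*2)%:R * \sum_i h i.
Proof.
rewrite /isum; pose F (j : nat) := h (Ordinal (mod_ord p0 (j%:Z - (M * p)%N%:Z))).
rewrite -[LHS]/(\sum_(j < (M * p).*2) F j) doubleMl big_ord_regroup mulr_sumr.
apply: eq_bigr => t _; rewrite -[RHS](_ : \sum_(l < M.*2) h t = _).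
  apply: eq_bigr => l _; congr h; apply: val_inj => /=.
  have -> : (t + p * l)%N%:Z - (M * p)%N%:Z = (l%:Z - M%:Z) * p%:Z + t%:Z by lia.
  by rewrite modzMDl modz_small //= ltz_nat ltn_ord.
by rewrite sumr_const card_ord mulr_natl.
Qed.

Lemma bsum_cell (V : comNzRingType) L (g : I -> V) :
  bsum (L * (p1 * p2)) (fun n => g (cell p1_gt0 p2_gt0 n))
  = ((L * p2).*2 * (L * p1).*2)%:R * \sum_c g c.
Proof.
have e1 : (L * (p1 * p2) = L * p2 * p1)%N by lia.
have e2 : (L * (p1 * p2) = L * p1 * p2)%N by lia.
rewrite /bsum {1}e1 e2.
transitivity (isum (L * p2 * p1) (fun a =>
   (fun i => (L * p1).*2%:R * \sum_j g (i, j)) (Ordinal (mod_ord p1_gt0 a)))).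
  apply: eq_isum => a _ _.
  exact: (isum_mod p2_gt0 _ (fun j => g (_, j))).
rewrite (isum_mod p1_gt0 (L * p2) (fun i => (L * p1).*2%:R * \sum_j g (i, j))).
rewrite -mulr_sumr mulrA natrM pair_bigA; congr (_ * _).
by apply: eq_bigr => -[].
Qed.

(** [v] solves a row equation, while the coefficients of a Bloch wave solve the column equation. As
    the matrix is Hermitian, conjugation turns one into the other; hence the conjugates. *)
Lemma eigenvector_bloch x y (E : R) (v : 'rV[C]_dim) n :
  v *m (fibmx p1 p2 Q x y - E%:C%:M) = 0 ->
  H (fun n => \sum_k (v 0 k)^* * wave x y (enum_val k) n) n
  = E%:C * \sum_k (v 0 k)^* * wave x y (enum_val k) n.
Proof.
move=> vE; rewrite hop_sum.
have coef k' : \sum_k (v 0 k)^* * potential_coef Q (enum_val k') (enum_val k)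
    = E%:C * (v 0 k')^* - (freeval x y (enum_val k'))%:C * (v 0 k')^*.
  have : (v *m (fibmx p1 p2 Q x y - E%:C%:M)) 0 k' = 0 by rewrite vE mxE.
  rewrite mulmxBr mulmxDr mul_mx_diag mul_mx_scalar !mxE.
  under eq_bigr do rewrite mxE.
  move=> /eqP; rewrite subr_eq0 addrC => /eqP /(canRL (addrK _)).
  move=> /(congr1 (fun z : C => z^*)); rewrite conj_sum.
  rewrite (eq_bigr (fun k => (v 0 k)^* * potential_coef Q (enum_val k') (enum_val k))).
    move=> ->; rewrite rmorphB [X in X - _]conjM [X in _ - X]conjM !conjR.
    by rewrite [X in _ - X]mulrC.
  by move=> k _; rewrite -(potential_coefJ Q (enum_val k)); exact: conjM.
under eq_bigr do rewrite (hop_wave p1_gt0 p2_gt0 Q_per).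
rewrite mulr_sumr; under eq_bigr do rewrite mulrDr -(sum_enum_val
  (fun l => potential_coef Q l _ * wave x y l n)) mulr_sumr.
rewrite big_split /= exchange_big /= -big_split; apply: eq_bigr => k _ /=.
under [X in _ + X]eq_bigr do rewrite mulrA.
by rewrite -mulr_suml coef; ring.
Qed.

(* A Bloch wave cut off to a box of side [N] has squared norm of order [N ^ 2],
   while [H - E] maps it to the boundary layer, whose size is of order [N]. *)
Lemma below_unit x y (E : R) : below E ->
  fibmx p1 p2 Q x y - E%:C%:M \in unitmx.
Proof.
case=> e e0 he; rewrite -row_free_unit -kermx_eq0; apply/negPn/negP.
move=> /rowV0Pn[v /sub_kermxP vE v0].
pose psi n := \sum_k (v 0 k)^* * wave x y (enum_val k) n.
have Hpsi n : H psi n = E%:C * psi n by exact: eigenvector_bloch.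
pose g (c : I) := nsq (\sum_k (v 0 k)^* * char R (enum_val k) c).
have psig n : nsq (psi n) = g (cell p1_gt0 p2_gt0 n).
  rewrite /psi; under eq_bigr do rewrite (wave_char p1_gt0 p2_gt0) mulrCA.
  by rewrite -mulr_sumr nsqM nsq_pw mul1r.
pose S := \sum_c g c.
have S0 : 0 < S.
  have -> : S = (p1 * p2)%:R * \sum_k nsq (v 0 k).
    have h := char_parseval (fun l => (v 0 (enum_rank l))^*).
    have -> : \sum_k nsq (v 0 k) = \sum_l nsq ((v 0 (enum_rank l))^*).
      by rewrite -sum_enum_val; apply: eq_bigr => k _; rewrite nsqJ enum_valK.
    rewrite -h; apply: eq_bigr => c _; congr nsq.
    rewrite -sum_enum_val; apply: eq_bigr => k _; by rewrite enum_valK.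
  rewrite mulr_gt0 // ?ltr0n ?muln_gt0 ?p1_gt0 //.
  by have := sqnorm_gt0 v0; rewrite sqnormC ltcR.
have gS c : g c <= S.
  rewrite /S (bigD1 c) //= lerDl; apply: sumr_ge0 => i _; exact: nsq_ge0.
have [K hK] := shift_bounded E%:C.
have K0 : 0 <= K by apply: le_trans (hK (0, 0)); exact: nsq_ge0.
pose B := (162 + 2 * K) * S.
have B0 : 0 <= B by rewrite mulr_ge0 ?(ltW S0) // addr_ge0 // mulr_ge0.
pose trunc N n : C := if inbox N n then psi n else 0.
have trunc_supp N : supp N (trunc N) by move=> n; rewrite /trunc => /negPf ->.
have truncS N n : nsq (trunc N n) <= S.
  by rewrite /trunc; case: ifP => _; rewrite ?nsq0 ?(ltW S0) // psig.
(* The operator has range one: in the inner box it only sees the untruncated wave, an exact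
   solution. *)
have layer N n : nsq (H (trunc N.+1) n - E%:C * trunc N.+1 n)
    <= B * (1 - (inbox N n)%:R).
  have [nb|nb] := boolP (inbox N n).
    rewrite subrr mulr0 le_eqVlt; apply/orP; left; rewrite nsq_eq0 subr_eq0.
    suff -> : H (trunc N.+1) n = H psi n.
      by rewrite Hpsi /trunc ifT //; move: nb; rewrite /inbox; lia.
    rewrite /hop /lap; congr (_ - _ + _ * _).
    - apply: eq_big_seq => a /offs_norm a1; apply: eq_big_seq => b /offs_norm b1.
      by rewrite /trunc ifT //; move: nb; rewrite /inbox /=; lia.
    - by rewrite /trunc ifT //; move: nb; rewrite /inbox; lia.
    - by rewrite /trunc ifT //; move: nb; rewrite /inbox; lia.
  rewrite subr0 mulr1; apply: le_trans (nsq_hop_le _ _ _ _) _.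
  rewrite /B [leRHS]mulrDl; apply: lerD; last first.
    by rewrite ler_pM ?nsq_ge0 // ?mulr_ge0 ?nsq_ge0 // ler_wpM2l.
  have -> : (162 : R) = 18 * 9 by ring.
  rewrite -mulrA ler_wpM2l //.
  have -> : 9 * S = \sum_(a <- offs) \sum_(b <- offs) S by rewrite !sum_offs; ring.
  by apply: ler_sum => a _; apply: ler_sum => b _.
(* The layer between the boxes [N] and [N + 2] has [4 (N + 2)^2 - 4 N^2 = 16 (N + 1)] points. *)
have up N : bsum N.+2 (fun n => nsq (H (trunc N.+1) n - E%:C * trunc N.+1 n))
    <= B * (16 * (N.+1)%:R).
  apply: le_trans (bsum_le _ (layer N)) _; rewrite bsumZ ler_wpM2l //.
  rewrite (eq_bsum (G := fun n => 1 + -1 * (inbox N n)%:R)) => [|n _]; last first.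
    by rewrite mulN1r.
  rewrite bsumD bsumZ (@bsum_ext _ N N.+2 (fun n => (inbox N n)%:R)); [|by move=> n /negPf ->|by lia].
  rewrite [X in _ + _ * X](eq_bsum (G := fun=> 1)) => [|n ->//]; rewrite !bsum1.
  by rewrite mulN1r lerBlDr -natrM -natrD ler_nat; lia.
have low L : (0 < L)%N ->
    bsum (L * (p1 * p2)) (fun n => nsq (trunc (L * (p1 * p2)) n))
    = (4 * L ^ 2 * (p1 * p2))%:R * S.
  move=> L0; rewrite (eq_bsum (G := fun n => g (cell p1_gt0 p2_gt0 n))).
    by rewrite bsum_cell; congr (_%:R * _); lia.
  by move=> n nb; rewrite /trunc nb psig.
(* The mass [4 L^2 p1 p2 S] of the wave against [16 L p1 p2 B] for the layer: division by
   [4 L p1 p2] leaves a bound linear in [L], absurd for large [L]. *)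
have main L : (0 < L)%N -> e * L%:R * S <= 4 * B.
  move=> L0; pose N := (L * (p1 * p2)).-1.
  have NE : N.+1 = (L * (p1 * p2))%N by rewrite prednK // !muln_gt0 L0 p1_gt0.
  have := le_trans (he _ _ (trunc_supp N.+1)) (up N).
  rewrite NE low // !natrM => h.
  have c0 : 0 < 4 * L%:R * (p1%:R * p2%:R) :> R by rewrite !mulr_gt0 ?ltr0n.
  rewrite -(ler_pM2l c0); move: h.
  by congr (_ <= _); ring.
have eS0 : 0 < e * S by rewrite mulr_gt0.
have [L hL] : exists L : nat, 4 * B / (e * S) < L%:R.
  by exists (Num.truncn (4 * B / (e * S))).+1; exact: truncnS_gt.
have L0 : (0 < L)%N.
  rewrite -(ltr0n R); apply: le_lt_trans hL.
  by apply: divr_ge0; [apply: mulr_ge0|exact: ltW].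
have := main L L0; rewrite leNgt => /negP; apply.
by rewrite (mulrAC e) -ltr_pdivrMl // mulrC.
Qed.

End LowerBound.

(** * Square-summable functions through box sums *)

Section Ell2.
Variable R : realType.
Local Notation C := R[i].
Implicit Types (psi phi : Z2 -> C).

Definition box_seq N : seq Z2 :=
  [seq (i%:Z - N%:Z, j%:Z - N%:Z) | i <- iota 0 N.*2, j <- iota 0 N.*2].

Lemma mem_box_seq N n : (n \in box_seq N) = inbox N n.
Proof.
case: n => a b; apply/allpairsP/idP => [[[i j] /= [iN jN [-> ->]]]|nb].
  by move: iN jN; rewrite !mem_iota /inbox /=; lia.
exists (absz (a + N%:Z), absz (b + N%:Z)) => /=; rewrite !mem_iota.
by move: nb; rewrite /inbox /= => nb; split; try lia; congr (_, _); lia.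
Qed.

Lemma box_seq_uniq N : uniq (box_seq N).
Proof.
apply: allpairs_uniq; rewrite ?iota_uniq // => -[i j] [i' j'] _ _ /= [h1 h2].
by congr (_, _); lia.
Qed.

Lemma bsum_box_seq N (F : Z2 -> R) : bsum N F = \sum_(n <- box_seq N) F n.
Proof.
rewrite /bsum /isum /box_seq big_allpairs_dep /=.
have -> : iota 0 N.*2 = index_iota 0 N.*2 by rewrite /index_iota subn0.
rewrite big_mkord.
by apply: eq_bigr => i _; rewrite big_mkord.
Qed.

Lemma sqmodE psi n : sqmod psi n = (nsq (psi n))%:E.
Proof.
rewrite /sqmod; congr (_%:E); case: (psi n) => a b; rewrite /nsq /=.
by rewrite sqr_sqrtr // addr_ge0 ?sqr_ge0.
Qed.

(** Square-summability with an explicit bound, phrased by finite sums so that extended reals stay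
    confined to this section. *)
Definition l2le psi (B : R) := forall N, bsum N (fun n => nsq (psi n)) <= B.

Lemma bsum_le_esum psi N :
  ((bsum N (fun n => nsq (psi n)))%:E <= \esum_(n in [set: Z2]) sqmod psi n)%E.
Proof.
apply: esum_ge; exists [set` box_seq N].
  by split => //; exact: finite_seq.
rewrite -fsbig_seq ?box_seq_uniq // bsum_box_seq -sumEFin.
by apply: lee_sum => n _; rewrite sqmodE.
Qed.

(** Every finite set of lattice points lies in a box. *)
Lemma esum_le_l2 psi B : l2le psi B -> (\esum_(n in [set: Z2]) sqmod psi n <= B%:E)%E.
Proof.
move=> hB; apply: ge_ereal_sup => _ [A [/finite_seqP[s ->] _] <-].
have [N sN] : exists N, {subset s <= box_seq N}.
  elim: s => [|[a b] s [N IH]]; first by exists 0%N.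
  exists (N + absz a + absz b).+1 => -[c d]; rewrite inE => /predU1P[[-> ->]|/IH];
    by rewrite !mem_box_seq /inbox /=; lia.
apply: (@le_trans _ _ (\sum_(n \in [set` box_seq N]) sqmod psi n)).
  apply: lee_fsum_nneg_subset; [exact: finite_seq|exact: finite_seq| |].
    by move=> n; rewrite !inE /=; exact: sN.
  by move=> n _; rewrite sqmodE lee_fin nsq_ge0.
rewrite -fsbig_seq ?box_seq_uniq //; under eq_bigr do rewrite sqmodE.
by rewrite sumEFin lee_fin -bsum_box_seq.
Qed.

Lemma ell2_esum psi : ell2 psi <-> (\esum_(n in [set: Z2]) sqmod psi n < +oo)%E.
Proof.
rewrite /ell2 /= /summable; suff -> : (fun n => `|sqmod psi n|%E) = sqmod psi by [].
by apply/funext => n; rewrite sqmodE /= ger0_norm // nsq_ge0.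
Qed.

Lemma ell2P psi : ell2 psi <-> exists B, l2le psi B.
Proof.
split=> [/ell2_esum h|[B hB]]; last first.
  by apply/ell2_esum; apply: le_lt_trans (esum_le_l2 hB) _; rewrite ltry.
exists (fine (\esum_(n in [set: Z2]) sqmod psi n)) => N.
rewrite -lee_fin fineK ?bsum_le_esum // ge0_fin_numE // esum_ge0 // => n _.
by rewrite sqmodE lee_fin nsq_ge0.
Qed.

Lemma l2le_norm psi : ell2 psi -> l2le psi (ell2norm psi ^+ 2).
Proof.
move=> /ell2_esum h N; have h0 : (0 <= \esum_(n in [set: Z2]) sqmod psi n)%E.
  by apply: esum_ge0 => n _; rewrite sqmodE lee_fin nsq_ge0.
rewrite /ell2norm sqr_sqrtr ?fine_ge0 //.
by rewrite -lee_fin fineK ?bsum_le_esum // ge0_fin_numE.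
Qed.

Lemma ell2norm_le psi B : l2le psi B -> ell2norm psi ^+ 2 <= B.
Proof.
move=> hB; have h0 : (0 <= \esum_(n in [set: Z2]) sqmod psi n)%E.
  by apply: esum_ge0 => n _; rewrite sqmodE lee_fin nsq_ge0.
rewrite /ell2norm sqr_sqrtr ?fine_ge0 // -lee_fin fineK ?esum_le_l2 //.
by rewrite ge0_fin_numE // (le_lt_trans (esum_le_l2 hB)) // ltry.
Qed.

Lemma ell2norm_ge0 psi : 0 <= ell2norm psi.
Proof. exact: sqrtr_ge0. Qed.

(** Listing the eight neighbours turns the sum over a set into a sum over a sequence; the centre of
    the block cancels in [lap]. *)
Lemma laplacian_sqnE psi : laplacian_sqn psi = lap psi.
Proof.
apply/funext => -[a b]; pose s : seq Z2 := [:: (a - 1, b - 1); (a - 1, b); (a - 1, b + 1);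
  (a, b - 1); (a, b + 1); (a + 1, b - 1); (a + 1, b); (a + 1, b + 1)].
have -> : laplacian_sqn psi (a, b) = \sum_(n <- s) psi n.
  have us : uniq s by rewrite /s /= !inE !xpair_eqE; lia.
  rewrite (fsbig_seq _ _ us) /laplacian_sqn.
  suff -> : [set n' | nbr_sqn (a, b) n'] = [set` s] by [].
  apply/seteqP; split => -[c d] /=; rewrite /nbr_sqn /= /s !inE !xpair_eqE; lia.
rewrite /lap !sum_offs /s !big_cons big_nil /= !addr0; ring.
Qed.

End Ell2.

Section HopLinear.
Variables (K : comNzRingType) (q : Z2 -> K).
Implicit Types (u v : Z2 -> K).

Lemma hop_lin (a : K) u v n :
  hop q (fun n => a * u n + v n) n = a * hop q u n + hop q v n.
Proof. by rewrite /hop /lap !sum_offs; ring. Qed.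

(** The right-hand side is symmetric in [z] and [w], so the two factors commute; for conjugate [z]
    and [w] its coefficients are real. *)
Lemma hop_shift2 (z w : K) u n :
  hop q (fun n => hop q u n - w * u n) n - z * (hop q u n - w * u n)
  = hop q (hop q u) n - (z + w) * hop q u n + z * w * u n.
Proof.
rewrite (_ : (fun n => hop q u n - w * u n) = (fun n => - w * u n + hop q u n)).
  by rewrite hop_lin; ring.
by apply/funext => m; rewrite mulNr addrC.
Qed.

Lemma eq_hop u v n : (forall a b, `|a| <= 1 -> `|b| <= 1 ->
  u (n.1 + a, n.2 + b) = v (n.1 + a, n.2 + b)) -> hop q u n = hop q v n.
Proof.
move=> uv; have uvn : u n = v n.
  by have := uv 0 0; rewrite normr0 !addr0 -surjective_pairing; apply.
rewrite /hop /lap uvn; congr (_ - _ + _).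
by apply: eq_big_seq => a /offs_norm a1; apply: eq_big_seq => b /offs_norm b1; exact: uv.
Qed.

(** Translating the sum by an offset moves it from [v] to [u] with opposite sign, and the set of
    offsets is symmetric. Only [u] has to be finitely supported. *)
Lemma hop_sym N M u v : supp N u -> (N < M)%N ->
  bsum M (fun n => u n * hop q v n) = bsum M (fun n => hop q u n * v n).
Proof.
move=> u0 NM; pose S (a b : int) := bsum M (fun n => u n * v (n.1 + a, n.2 + b)).
pose W (a b : int) := bsum M (fun n => u (n.1 + a, n.2 + b) * v n).
have SW a b : a \in offs -> b \in offs -> S a b = W (- a) (- b).
  move=> ao bo; pose F (n : Z2) := u n * v (n.1 + a, n.2 + b).
  rewrite /S /W -(@bsum_shift _ N M (- a) (- b) F) ?normrN ?offs_norm //.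
    by apply: eq_bsum => -[c d] _; rewrite /F /= !subrK.
  by move=> n nb; rewrite /F u0 // mul0r.
have -> : bsum M (fun n => u n * hop q v n) =
   \sum_(a <- offs) \sum_(b <- offs) S a b + bsum M (fun n => (q n - 1) * (u n * v n)).
  under [X in X + _]eq_bigr do rewrite -bsum_sum.
  rewrite -bsum_sum -bsumD; apply: eq_bsum => n _; rewrite /hop /lap.
  by rewrite !sum_offs; ring.
have -> : bsum M (fun n => hop q u n * v n) =
   \sum_(a <- offs) \sum_(b <- offs) W a b + bsum M (fun n => (q n - 1) * (u n * v n)).
  under [X in X + _]eq_bigr do rewrite -bsum_sum.
  rewrite -bsum_sum -bsumD; apply: eq_bsum => n _; rewrite /hop /lap.
  by rewrite !sum_offs; ring.
congr (_ + _); rewrite -(offsN (fun a => \sum_(b <- offs) W a b)).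
apply: eq_big_seq => a ao; rewrite -(offsN (fun b => W _ b)).
by apply: eq_big_seq => b bo; exact: SW.
Qed.

End HopLinear.

(* [contr = 1 - sqop / bigM], with [sqop = (H - x)^2 + y2], is a contraction of
   l^2, so that [sqop] is inverted by a Neumann series.  All coefficients are
   real, which allows for working with real-valued functions. *)
Section Neumann.
Variable R : realType.
Variables (q : Z2 -> R) (x y2 K e : R).
Implicit Types (u v : Z2 -> R).

Definition shiftop u (n : Z2) : R := hop q u n - x * u n.

Definition sqop u (n : Z2) : R := shiftop (shiftop u) n + y2 * u n.

Hypotheses (y2_ge0 : 0 <= y2) (e_gt0 : 0 < e).
Hypothesis hK : forall n, (q n - x - 1) ^+ 2 <= K.
Hypothesis coercive : forall N u, supp N u ->
  e * bsum N (fun n => u n ^+ 2)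
  <= bsum N.+1 (fun n => shiftop u n ^+ 2) + y2 * bsum N (fun n => u n ^+ 2).

Lemma shift_bound_ge0 : 0 <= K.
Proof. by apply: le_trans (hK (0, 0)); exact: sqr_ge0. Qed.

Lemma hop_realC (u : Z2 -> R) n :
  hop (fun n => (q n)%:C) (fun n => (u n)%:C) n = (hop q u n)%:C.
Proof.
rewrite /hop /lap rmorphD rmorphB rmorphM rmorph_sum /=; congr (_ - _ + _).
by apply: eq_bigr => a _; rewrite rmorph_sum.
Qed.

Lemma bsum_shiftop_le N u : bsum N (fun n => shiftop u n ^+ 2)
  <= (162 + 2 * K) * bsum N.+1 (fun n => u n ^+ 2).
Proof.
have := @bsum_hop_le R (fun n => (q n)%:C) x%:C (fun n => (u n)%:C) N K.
have -> : bsum N.+1 (fun n => nsq (u n)%:C) = bsum N.+1 (fun n => u n ^+ 2).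
  by apply: eq_bsum => n _; rewrite nsqC.
move=> h; apply: le_trans (h _); last first.
  by move=> n; rewrite -rmorphB -(rmorph1 (real_complex R)) -rmorphB nsqC.
apply: bsum_le => n; rewrite hop_realC -rmorphM -rmorphB nsqC //.
Qed.

(** A bound for the positive operator [sqop]: [162 + 2 * K] bounds the squared norm of [shiftop],
    and the factors 2 come from splitting a square of a sum. *)
Definition bigM : R := 2 * (162 + 2 * K) + 2 * y2.

Lemma bigM_gt0 : 0 < bigM.
Proof. have := shift_bound_ge0; have := y2_ge0; rewrite /bigM; lra. Qed.

Definition contr u (n : Z2) : R := u n - bigM^-1 * sqop u n.

(** Contraction rate for squared norms. The maximum with one half keeps it positive, so that it can
    be cancelled and its square root used as a ratio. *)
Definition theta : R := Num.max (1 - bigM^-1 * e) 2^-1.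

Lemma theta_bounds : 0 < theta < 1.
Proof.
rewrite /theta lt_max gt_max invr_gt0 ltr0n orbT /=.
have := mulr_gt0 (_ : 0 < bigM^-1) e_gt0; rewrite invr_gt0 bigM_gt0 => /(_ isT); lra.
Qed.

Lemma supp_shiftop N u : supp N u -> supp N.+1 (shiftop u).
Proof. exact: supp_hop. Qed.

(** With [S = sqop], [|u - S u / bigM|^2 = |u|^2 - 2 <u, S u> / bigM + |S u|^2 / bigM^2]. Since
    [|S u|^2 <= bigM <u, S u>], this is at most [|u|^2 - <u, S u> / bigM], and coercivity gives
    [<u, S u> >= e |u|^2]. *)
Lemma contr_supp N u : supp N u ->
  bsum N.+2 (fun n => contr u n ^+ 2) <= theta * bsum N (fun n => u n ^+ 2).
Proof.
move=> u0; pose M := N.+4.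
have sq0 N' (v : Z2 -> R) : supp N' v -> supp N' (fun n => v n ^+ 2).
  by move=> v0 n nb; rewrite v0 // expr0n.
have u1 := supp_shiftop u0; have u2 := supp_shiftop u1.
have ext N' (v : Z2 -> R) : supp N' v -> (N' <= M)%N ->
  bsum N' (fun n => v n ^+ 2) = bsum M (fun n => v n ^+ 2).
  by move=> v0 h; rewrite (bsum_ext (sq0 _ _ v0) h).
have uT : supp N.+2 (contr u).
  move=> n nb; rewrite /contr /sqop u2 // (suppS (suppS u0)) //.
  by rewrite mulr0 addr0 mulr0 subr0.
rewrite (ext _ _ uT) ?(ext _ _ u0) //; try by rewrite /M; lia.
have := coercive u0; rewrite (ext _ _ u1) ?(ext _ _ u0) //; try by rewrite /M; lia.
set U := bsum M (fun n => u n ^+ 2); set V := bsum M (fun n => shiftop u n ^+ 2).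
move=> co.
have U0 : 0 <= U by apply: bsum_ge0 => n; exact: sqr_ge0.
have V0 : 0 <= V by apply: bsum_ge0 => n; exact: sqr_ge0.
pose W := bsum M (fun n => shiftop (shiftop u) n ^+ 2).
have WV : W <= (162 + 2 * K) * V.
  rewrite /W -(ext _ _ u2); last by rewrite /M; lia.
  apply: le_trans (bsum_shiftop_le _ _) _; rewrite (ext N.+3) //; last first.
    exact: (suppS (suppS u1)).
have uAu : bsum M (fun n => u n * sqop u n) = V + y2 * U.
  have -> : bsum M (fun n => u n * sqop u n) =
    bsum M (fun n => u n * hop q (shiftop u) n) +
    ((- x) * bsum M (fun n => u n * shiftop u n) + y2 * U).
    rewrite -!bsumZ -!bsumD; apply: eq_bsum => n _.
    by rewrite /sqop {1}/shiftop; ring.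
  rewrite (hop_sym _ _ u0); last by rewrite /M; lia.
  rewrite addrA; congr (_ + _); rewrite -bsumZ -bsumD; apply: eq_bsum => n _.
  by rewrite /shiftop; ring.
have AA : bsum M (fun n => sqop u n ^+ 2) <= bigM * (V + y2 * U).
  apply: (@le_trans _ _ (2 * W + 2 * y2 ^+ 2 * U)).
    rewrite /W /U -!bsumZ -bsumD; apply: bsum_le => n; rewrite /sqop.
    have := sqr_ge0 (shiftop (shiftop u) n - y2 * u n); nra.
  have k0 : 0 <= 162 + 2 * K by have := shift_bound_ge0; lra.
  have h1 : 0 <= (162 + 2 * K) * (y2 * U) by rewrite !mulr_ge0.
  have h2 : 0 <= y2 * V by rewrite mulr_ge0.
  rewrite /bigM; lra.
have -> : bsum M (fun n => contr u n ^+ 2) =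
   U - 2 * bigM^-1 * (V + y2 * U) + bigM^-1 ^+ 2 * bsum M (fun n => sqop u n ^+ 2).
  rewrite -uAu -mulNr -!bsumZ -!bsumD; apply: eq_bsum => n _; rewrite /contr; ring.
have M0 := bigM_gt0; have M1 : 0 < bigM^-1 by rewrite invr_gt0.
apply: (@le_trans _ _ (U - bigM^-1 * (V + y2 * U))).
  have : bigM^-1 ^+ 2 * bsum M (fun n => sqop u n ^+ 2) <= bigM^-1 * (V + y2 * U).
    rewrite expr2 -mulrA ler_pM2l // ler_pdivrMl //.
  lra.
apply: (@le_trans _ _ ((1 - bigM^-1 * e) * U)).
  by rewrite mulrBl mul1r lerB // -mulrA ler_pM2l.
by rewrite ler_wpM2r // /theta le_max lexx.
Qed.

Definition r2le u (B : R) := forall N, bsum N (fun n => u n ^+ 2) <= B.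

(* [contr] has finite range, so on each box it only sees a truncation of [u]. *)
Lemma contr_r2le u B : r2le u B -> r2le (contr u) (theta * B).
Proof.
move=> uB N; pose v n := if inbox N.+2 n then u n else 0.
have v0 : supp N.+2 v by move=> n; rewrite /v => /negPf ->.
have vE n : inbox N.+2 n -> v n = u n by rewrite /v => ->.
have sE n : inbox N.+1 n -> shiftop v n = shiftop u n.
  move=> nb; rewrite /shiftop vE; last by move: nb; rewrite /inbox; lia.
  congr (_ - _); apply: eq_hop => a b a1 b1; apply: vE.
  by move: nb; rewrite /inbox /=; lia.
have -> : bsum N (fun n => contr u n ^+ 2) = bsum N (fun n => contr v n ^+ 2).
  apply: eq_bsum => n nb; rewrite /contr /sqop vE; last first.
    by move: nb; rewrite /inbox; lia.
  rewrite {1 3}/shiftop sE; last by move: nb; rewrite /inbox; lia.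
  rewrite (@eq_hop _ q (shiftop v) (shiftop u)) // => a b a1 b1; apply: sE.
  by move: nb; rewrite /inbox /=; lia.
apply: (@le_trans _ _ (bsum N.+4 (fun n => contr v n ^+ 2))).
  apply: bsum_mono => [n|]; first exact: sqr_ge0.
  by lia.
apply: le_trans (contr_supp v0) _.
rewrite ler_pM2l; last by case/andP: theta_bounds.
rewrite (eq_bsum (G := fun n => u n ^+ 2)) // => n nb; by rewrite vE.
Qed.

Fixpoint neumann_term u k : Z2 -> R :=
  if k is k'.+1 then contr (neumann_term u k') else u.

Fixpoint neumann_sum u k : Z2 -> R :=
  if k is k'.+1 then fun n => u n + contr (neumann_sum u k') n else fun=> 0.

Lemma contrD u v n : contr (fun n => u n + v n) n = contr u n + contr v n.
Proof.
rewrite /contr /sqop /shiftop.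
have hopD (a b : Z2 -> R) m : hop q (fun n => a n + b n) m = hop q a m + hop q b m.
  rewrite -[hop q a m]mul1r -hop_lin; congr (hop q _ m).
  by apply/funext => k; rewrite mul1r.
have -> : (fun n => hop q (fun n => u n + v n) n - x * (u n + v n)) =
   (fun n => (hop q u n - x * u n) + (hop q v n - x * v n)).
  by apply/funext => m; rewrite hopD; ring.
by rewrite !hopD; ring.
Qed.

(** The recursion of [neumann_sum] is the fixed-point iteration, suited to uniform bounds; read as
    partial sums of a series it converges pointwise. *)
Lemma neumann_sumE u k n : neumann_sum u k.+1 n = neumann_sum u k n + neumann_term u k n.
Proof.
elim: k n => [|k IH] n.
  by rewrite /= /contr /sqop /shiftop /hop /lap !sum_offs; ring.
rewrite [LHS]/=; rewrite [neumann_term _ _]/=.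
rewrite -[neumann_sum u k.+1 n]/(u n + contr (neumann_sum u k) n) -addrA -contrD.
by congr (_ + _); congr (contr _ n); apply/funext => m; rewrite -IH.
Qed.

Lemma neumann_term_r2le u B k : r2le u B -> r2le (neumann_term u k) (theta ^+ k * B).
Proof.
move=> uB; elim: k => [|k IH]; first by rewrite mul1r.
by rewrite exprS -mulrA; exact: contr_r2le.
Qed.

Lemma r2le_ge0 u B : r2le u B -> 0 <= B.
Proof. by move=> /(_ 0%N); apply: le_trans; apply: bsum_ge0 => n; exact: sqr_ge0. Qed.

Lemma r2le_point u B n : r2le u B -> u n ^+ 2 <= B.
Proof.
move=> /(_ (absz n.1 + absz n.2).+1); apply: le_trans.
case: n => a b; apply: (@le_bsum R _ (fun n => u n ^+ 2) (a, b)); last by rewrite /inbox /=; lia.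
by move=> n; exact: sqr_ge0.
Qed.

(** Solves [1 + 1 / dl = dl * solC] for [dl = (1 - theta) / 2]. *)
Definition solC : R := 2 * (1 + 2 / (1 - theta)) / (1 - theta).

(** From [(a + b)^2 <= (1 + 1 / dl) a^2 + (1 + dl) b^2], the bound [solC * B] reproduces itself
    under the iteration, because [dl + (1 + dl) * theta <= 1]. *)
Lemma neumann_sum_r2le u B k : r2le u B -> r2le (neumann_sum u k) (solC * B).
Proof.
move=> uB; have B0 := r2le_ge0 uB; have /andP[t0 t1] := theta_bounds.
have d0 : 0 < 1 - theta by lra.
elim: k => [|k IH] N.
  rewrite /= (eq_bsum (G := fun=> 0 * 1)) => [|n _]; last by rewrite expr0n mul0r.
  rewrite bsumZ mul0r mulr_ge0 // /solC; apply: divr_ge0; last exact: ltW.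
  by rewrite mulr_ge0 // addr_ge0 // divr_ge0 // ltW.
have hT := contr_r2le IH N; have hu := uB N.
pose dl := (1 - theta) / 2.
have dl0 : 0 < dl by rewrite divr_gt0.
apply: (@le_trans _ _ ((1 + dl^-1) * bsum N (fun n => u n ^+ 2)
   + (1 + dl) * bsum N (fun n => contr (neumann_sum u k) n ^+ 2))).
  rewrite -!bsumZ -bsumD; apply: bsum_le => n /=.
  move: (u n) (contr _ n) => a b.
  have : 0 <= dl^-1 * (a - dl * b) ^+ 2 by rewrite mulr_ge0 ?sqr_ge0 // invr_ge0 ltW.
  have -> : dl^-1 * (a - dl * b) ^+ 2 = dl^-1 * a ^+ 2 - 2 * a * b + dl * b ^+ 2.
    by field; rewrite gt_eqF.
  nra.
apply: (@le_trans _ _ ((1 + dl^-1) * B + (1 + dl) * (theta * (solC * B)))).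
  apply: lerD; first by rewrite ler_wpM2l // addr_ge0 // invr_ge0 ltW.
  by rewrite ler_wpM2l // addr_ge0 // ltW.
have S0 : 0 <= solC * B.
  by rewrite mulr_ge0 // /solC divr_ge0 ?(ltW d0) // mulr_ge0 // addr_ge0 // divr_ge0 // ltW.
have -> : (1 + dl^-1) * B = dl * (solC * B).
  by rewrite /dl /solC; field; rewrite gt_eqF.
rewrite [(1 + dl) * (theta * _)]mulrA -mulrDl ler_piMl //.
rewrite /dl; nra.
Qed.

Lemma cvg_sumr (J : Type) (r : seq J) (f : J -> nat -> R) (a : J -> R) :
  (forall j, f j k @[k --> \oo] --> a j) ->
  (\sum_(j <- r) f j k) @[k --> \oo] --> \sum_(j <- r) a j.
Proof. by move=> h; apply: cvg_big => //; exact: add_continuous. Qed.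

Lemma cvg_bsum (w : nat -> Z2 -> R) (w' : Z2 -> R) N :
  (forall n, w k n @[k --> \oo] --> w' n) ->
  bsum N (w k) @[k --> \oo] --> bsum N w'.
Proof. by move=> h; apply: cvg_sumr => i; apply: cvg_sumr => j; exact: h. Qed.

Lemma cvg_hop (w : nat -> Z2 -> R) (w' : Z2 -> R) n :
  (forall n, w k n @[k --> \oo] --> w' n) ->
  hop q (w k) n @[k --> \oo] --> hop q w' n.
Proof.
move=> h; apply: cvgD; last by apply: cvgM; [exact: cvg_cst|exact: h].
apply: cvgB; last exact: h.
by apply: cvg_sumr => i; apply: cvg_sumr => j; exact: h.
Qed.

Lemma cvg_shiftop (w : nat -> Z2 -> R) (w' : Z2 -> R) n :
  (forall n, w k n @[k --> \oo] --> w' n) ->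
  shiftop (w k) n @[k --> \oo] --> shiftop w' n.
Proof.
move=> h; apply: cvgB; first exact: cvg_hop.
by apply: cvgM; [exact: cvg_cst|exact: h].
Qed.

Lemma cvg_contr (w : nat -> Z2 -> R) (w' : Z2 -> R) n :
  (forall n, w k n @[k --> \oo] --> w' n) ->
  contr (w k) n @[k --> \oo] --> contr w' n.
Proof.
move=> h; apply: cvgB; first exact: h.
apply: cvgM; first exact: cvg_cst.
apply: cvgD; last by apply: cvgM; [exact: cvg_cst|exact: h].
by apply: cvg_shiftop => m; exact: cvg_shiftop.
Qed.

Lemma sqopZ (a : R) u n : sqop (fun n => a * u n) n = a * sqop u n.
Proof.
have hopZ (v : Z2 -> R) m : hop q (fun n => a * v n) m = a * hop q v m.
  by rewrite /hop /lap !sum_offs; ring.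
rewrite /sqop /shiftop.
have -> : (fun n => hop q (fun n => a * u n) n - x * (a * u n)) =
    (fun n => a * (hop q u n - x * u n)).
  by apply/funext => m; rewrite hopZ; ring.
by rewrite !hopZ; ring.
Qed.

(** The partial Neumann sums converge at each point. The uniform bound on boxes passes to the limit,
    and so does the fixed-point equation, [contr] having finite range. *)
Lemma sqop_solve u B : r2le u B ->
  exists2 phi, r2le phi (bigM^-1 ^+ 2 * (solC * B)) & forall n, sqop phi n = u n.
Proof.
move=> uB; have B0 := r2le_ge0 uB; have /andP[t0 t1] := theta_bounds.
have M0 := bigM_gt0.
pose w k n := neumann_sum u k n.
have wE n : (fun k => w k n) = series (fun k => neumann_term u k n).
  apply/funext => k; elim: k => [|k IH]; first by rewrite /series /= big_geq.
  by rewrite seriesSr -IH /w neumann_sumE.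
have wcvg n : cvgn (fun k => w k n).
  rewrite wE; apply: normed_cvg.
  (* [theta ^ k * B] bounds the squares of the terms, hence the square roots. *)
  apply: (@series_le_cvg _ _ (geometric (Num.sqrt B) (Num.sqrt theta))) => [k|k|k|].
  - exact: normr_ge0.
  - by rewrite /geometric /= mulr_ge0 ?sqrtr_ge0 // exprn_ge0 // sqrtr_ge0.
  - rewrite /geometric /= -ler_sqr; last 2 first.
    + by rewrite nnegrE normr_ge0.
    + by rewrite nnegrE mulr_ge0 ?sqrtr_ge0 // exprn_ge0 // sqrtr_ge0.
    rewrite real_normK ?num_real // exprMn exprAC !sqr_sqrtr ?(ltW t0) // mulrC.
    exact: r2le_point (neumann_term_r2le k uB).
  apply: is_cvg_geometric_series.
  by rewrite ger0_norm ?sqrtr_ge0 // -sqrtr1 ltr_sqrt.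
pose phi n := limn (fun k => w k n).
have wphi n : w k n @[k --> \oo] --> phi n by exact: wcvg.
have phiB : r2le phi (solC * B).
  move=> N; apply: (@ler_cvg_to nat \oo _ _ (fun k => bsum N (fun n => w k n ^+ 2))
      (fun=> solC * B)).
  - apply: (@cvg_bsum (fun k n => w k n ^+ 2) (fun n => phi n ^+ 2)) => n.
    by rewrite expr2; apply: cvgM; exact: wphi.
  - exact: cvg_cst.
  - by apply: nearW => k; exact: neumann_sum_r2le.
have Tphi n : phi n = u n + contr phi n.
  have : w k.+1 n @[k --> \oo] --> phi n.
    by rewrite (cvg_shiftS (fun k => w k n)); exact: wphi.
  have h : w k.+1 n @[k --> \oo] --> u n + contr phi n.
    by apply: cvgD; [exact: cvg_cst|exact: cvg_contr].
  move=> h'; exact: (cvg_unique _ h' h).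
(* [phi = u + contr phi] says [sqop phi = bigM * u]. *)
exists (fun n => bigM^-1 * phi n) => [N|n].
  rewrite (eq_bsum (G := fun n => bigM^-1 ^+ 2 * phi n ^+ 2)) => [|n _].
    by rewrite bsumZ ler_wpM2l ?sqr_ge0.
  by rewrite exprMn.
rewrite sqopZ; have := Tphi n; rewrite /contr => h.
lra.
Qed.

(** A zero of [sqop] is fixed by [contr], so its squared norm is at most [theta ^ k * B] for every
    [k]. *)
Lemma sqop_eq0 u B : r2le u B -> (forall n, sqop u n = 0) -> forall n, u n = 0.
Proof.
move=> uB u0 n; have /andP[t0 t1] := theta_bounds.
have Tu : contr u = u by apply/funext => m; rewrite /contr u0 mulr0 subr0.
have h k : u n ^+ 2 <= theta ^+ k * B.
  apply: r2le_point; elim: k => [|k IH]; first by rewrite mul1r.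
  by rewrite -Tu exprS -mulrA; exact: contr_r2le.
have : u n ^+ 2 <= 0.
  apply: (@ler_cvg_to nat \oo _ _ (fun=> u n ^+ 2) (geometric B theta)).
  - exact: cvg_cst.
  - by apply: cvg_geometric; rewrite ger0_norm // ltW.
  - by apply: nearW => k; rewrite /geometric /= mulrC.
by move=> h0; apply/eqP; rewrite -sqrf_eq0 eq_le h0 sqr_ge0.
Qed.

End Neumann.

(** * The resolvent set and lower bounds *)

Section Resolvent.
Variable R : realType.
Local Notation C := R[i].
Variables (p1 p2 : nat).
Hypotheses (p1_gt0 : (0 < p1)%N) (p2_gt0 : (0 < p2)%N).
Variable Q : Z2 -> R.
Hypothesis Q_per : biperiodic p1 p2 Q.
Local Notation QC := (fun n => (Q n)%:C).
Local Notation H := (hop QC).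
Implicit Types (psi phi : Z2 -> C) (z : C).

Lemma schrodingerE psi : schrodinger_sqn Q psi = H psi.
Proof. by apply/funext => n; rewrite /schrodinger_sqn laplacian_sqnE. Qed.

Lemma shift_operatorE z psi :
  shift_operator (schrodinger_sqn Q) z psi = (fun n => H psi n - z * psi n).
Proof. by rewrite /shift_operator schrodingerE. Qed.

Lemma l2le_shift z : exists2 K, 0 <= K & forall psi B, l2le psi B ->
  l2le (fun n => H psi n - z * psi n) (K * B).
Proof.
have [K hK] := shift_bounded p1_gt0 p2_gt0 Q_per z.
have k0 : 0 <= K by apply: le_trans (hK (0, 0)); exact: nsq_ge0.
have K0 : 0 <= 162 + 2 * K by lra.
exists (162 + 2 * K) => // psi B hB N; apply: le_trans (@bsum_hop_le R QC z psi N K hK) _.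
by rewrite ler_wpM2l.
Qed.

Lemma l2le_supp N psi : supp N psi -> l2le psi (bsum N (fun n => nsq (psi n))).
Proof.
move=> s0 M; have s1 : supp N (fun n => nsq (psi n)).
  by move=> n nb; rewrite s0 // nsq0.
rewrite -(bsum_ext s1 (leq_addr M N)); apply: bsum_mono => [n|]; first exact: nsq_ge0.
exact: leq_addl.
Qed.

Lemma below_of_resolvent (E : R) :
  resolvent_set (schrodinger_sqn Q) E%:C -> below Q E.
Proof.
(* [1 + M^2] is positive whatever the value of [M]. *)
case=> S [Sl2 _ [M hM]] hS; exists (1 + M ^+ 2)^-1.
  by rewrite invr_gt0 ltr_wpDr // sqr_ge0.
have M0 : 0 < 1 + M ^+ 2 by rewrite ltr_wpDr // sqr_ge0.
move=> N u u0; rewrite ler_pdivrMl //.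
set w := fun n => H u n - E%:C * u n.
have w2 : ell2 w by apply/ell2P; exists (bsum N.+1 (fun n => nsq (w n)));
  apply: l2le_supp; exact: supp_hop.
have u2 : ell2 u by apply/ell2P; exists (bsum N (fun n => nsq (u n))); exact: l2le_supp.
have Swu : S w = u by have [+ _] := hS u u2; rewrite shift_operatorE.
apply: le_trans (l2le_norm u2 N) _.
have wB := ell2norm_le (l2le_supp (supp_hop QC E%:C u0)).
have := hM w w2; rewrite Swu => h.
have h2 : ell2norm u ^+ 2 <= M ^+ 2 * ell2norm w ^+ 2.
  rewrite -exprMn lerXn2r ?nnegrE ?ell2norm_ge0 //.
  by apply: le_trans h; exact: ell2norm_ge0.
apply: le_trans h2 _; apply: le_trans (_ : (1 + M ^+ 2) * ell2norm w ^+ 2 <= _).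
  by rewrite ler_wpM2r ?sqr_ge0 // lerDr.
by rewrite ler_pM2l.
Qed.

(** For [z = x + i y], positivity of [(H - x)^2 + y^2] has two sources: [y^2] when [z] is not real,
    and the lower bound on [H - x] otherwise. *)
Lemma resolvent_coercive z : complex.Im z != 0 \/ below Q (complex.Re z) ->
  exists2 e, 0 < e & forall N (u : Z2 -> R), supp N u ->
    e * bsum N (fun n => u n ^+ 2)
    <= bsum N.+1 (fun n => shiftop Q (complex.Re z) u n ^+ 2)
       + complex.Im z ^+ 2 * bsum N (fun n => u n ^+ 2).
Proof.
case=> [y0|[e e0 he]].
  exists (complex.Im z ^+ 2) => [|N u u0].
    by rewrite lt_def sqr_ge0 sqrf_eq0 y0.
  by rewrite lerDr; apply: bsum_ge0 => n; exact: sqr_ge0.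
exists e => // N u u0.
have u0' : supp N (fun n => (u n)%:C) by move=> n nb; rewrite u0.
have := he N _ u0'; rewrite (eq_bsum (G := fun n => u n ^+ 2)) => [h|n _]; last first.
  by rewrite nsqC.
rewrite (le_trans h) // (eq_bsum (G := fun n => shiftop Q (complex.Re z) u n ^+ 2)).
  rewrite lerDl mulr_ge0 ?sqr_ge0 //; apply: bsum_ge0 => n; exact: sqr_ge0.
by move=> n _; rewrite hop_realC -rmorphM -rmorphB nsqC.
Qed.

Lemma hop_Re psi n : complex.Re (H psi n) = hop Q (fun n => complex.Re (psi n)) n.
Proof.
rewrite /hop /lap !sum_offs /=; case: (psi n) => c d.
do !case: (psi _) => ? ?.
by rewrite /= mul0r subr0.
Qed.

Lemma hop_Im psi n : complex.Im (H psi n) = hop Q (fun n => complex.Im (psi n)) n.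
Proof.
rewrite /hop /lap !sum_offs /=; case: (psi n) => c d.
do !case: (psi _) => ? ?.
by rewrite /= mul0r addr0.
Qed.

Lemma l2le_ReIm psi B : l2le psi B ->
  r2le (fun n => complex.Re (psi n)) B /\ r2le (fun n => complex.Im (psi n)) B.
Proof.
move=> hB; split=> N; apply: le_trans (hB N); apply: bsum_le => n.
  by rewrite lerDl sqr_ge0.
by rewrite lerDr sqr_ge0.
Qed.

Lemma l2le_lin (a : C) psi phi A B : l2le psi A -> l2le phi B ->
  l2le (fun n => a * psi n + phi n) (2 * nsq a * A + 2 * B).
Proof.
move=> hA hB N; apply: le_trans (_ : 2 * nsq a * bsum N (fun n => nsq (psi n))
  + 2 * bsum N (fun n => nsq (phi n)) <= _).
  rewrite -!bsumZ -bsumD; apply: bsum_le => n.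
  by apply: le_trans (nsqD_le _ _) _; rewrite nsqM mulrA.
by apply: lerD; rewrite ler_wpM2l // mulr_ge0 // nsq_ge0.
Qed.

Lemma ell2_lin (a : C) psi phi : ell2 psi -> ell2 phi ->
  ell2 (fun n => a * psi n + phi n).
Proof.
move=> /ell2P[A hA] /ell2P[B hB]; apply/ell2P.
exists (2 * nsq a * A + 2 * B); exact: l2le_lin.
Qed.

(** The product of [H - z] and [H - conj z] has real coefficients, so it is solved on real and
    imaginary parts separately; applying [H - conj z] to the solution inverts [H - z]. Injectivity
    follows since the factors commute. The inverse is obtained by choice, and injectivity makes it
    linear. *)
Lemma resolvent_of_coercive z : complex.Im z != 0 \/ below Q (complex.Re z) ->
  resolvent_set (schrodinger_sqn Q) z.
Proof.
move=> /resolvent_coercive[e e0 he]; set x := complex.Re z; set y := complex.Im z.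
have y2 : 0 <= y ^+ 2 by exact: sqr_ge0.
have [K hK] : exists K, forall n, (Q n - x - 1) ^+ 2 <= K.
  have [K hK] := shift_bounded p1_gt0 p2_gt0 Q_per x%:C.
  by exists K => n; have := hK n; rewrite -(rmorph1 (real_complex R)) -!rmorphB nsqC.
pose A := sqop Q x (y ^+ 2).
pose G w (psi : Z2 -> C) n := H psi n - w * psi n.
have GG psi n : (complex.Re (G z (G z^* psi) n) = A (fun n => complex.Re (psi n)) n)
   /\ (complex.Im (G z (G z^* psi) n) = A (fun n => complex.Im (psi n)) n).
  rewrite /G hop_shift2 /A /sqop /shiftop hop_shift2 hop_shift2.
  have zz : z + z^* = (2 * x)%:C.
    by rewrite /x; case: (z) => a b; apply/eqP; rewrite eq_complex /= subrr eqxx andbT mulr_natl mulr2n.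
  have zzz : z * z^* = (x ^+ 2 + y ^+ 2)%:C by rewrite -nsqE.
  rewrite zz zzz.
  have ReL (s t : R) (a b c : C) : complex.Re (a - s%:C * b + t%:C * c)
      = complex.Re a - s * complex.Re b + t * complex.Re c.
    by case: a b c => [? ?] [? ?] [? ?] /=; ring.
  have ImL (s t : R) (a b c : C) : complex.Im (a - s%:C * b + t%:C * c)
      = complex.Im a - s * complex.Im b + t * complex.Im c.
    by case: a b c => [? ?] [? ?] [? ?] /=; ring.
  have HRe : complex.Re (H (H psi) n) = hop Q (hop Q (fun n => complex.Re (psi n))) n.
    by rewrite hop_Re; congr (hop Q _ n); apply/funext => m; rewrite hop_Re.
  have HIm : complex.Im (H (H psi) n) = hop Q (hop Q (fun n => complex.Im (psi n))) n.
    by rewrite hop_Im; congr (hop Q _ n); apply/funext => m; rewrite hop_Im.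
  rewrite ReL ImL HRe HIm hop_Re hop_Im.
  by split; ring.
have GC psi : G z (G z^* psi) = G z^* (G z psi).
  by apply/funext => n; rewrite /G !hop_shift2; ring.
have [K1 K10 hK1] := l2le_shift z.
have [K2 K20 hK2] := l2le_shift z^*.
have kerG psi : ell2 psi -> (forall n, G z psi n = 0) -> psi = fun=> 0.
  move=> /ell2P[B /l2le_ReIm[B1 B2]] G0.
  have G00 n : G z (G z^* psi) n = 0.
    rewrite GC; have -> : G z psi = fun=> 0 by apply/funext.
    by rewrite /G /hop /lap !sum_offs; ring.
  have R0 := sqop_eq0 y2 e0 hK he B1 (fun n => etrans (esym (GG psi n).1) (congr1 _ (G00 n))).
  have I0 := sqop_eq0 y2 e0 hK he B2 (fun n => etrans (esym (GG psi n).2) (congr1 _ (G00 n))).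
  by apply/funext => n; have := R0 n; have := I0 n; case: (psi n) => c d /= -> ->.
pose c := K2 * (2 * ((bigM (y ^+ 2) K)^-1 ^+ 2 * solC (y ^+ 2) K e)).
have solve psi : exists phi, ell2 psi ->
    [/\ ell2 phi, G z phi = psi & ell2norm phi ^+ 2 <= c * ell2norm psi ^+ 2].
  have [h|h] := pselect (ell2 psi); last by exists psi.
  have [B1 B2] := l2le_ReIm (l2le_norm h).
  have [u uB Au] := sqop_solve y2 e0 hK he B1.
  have [v vB Av] := sqop_solve y2 e0 hK he B2.
  pose w n : C := u n +i* v n.
  have wB := fun N => lerD (uB N) (vB N).
  have {}wB : l2le w (2 * ((bigM (y ^+ 2) K)^-1 ^+ 2 * solC (y ^+ 2) K e) * ell2norm psi ^+ 2).
    move=> N; have := wB N; rewrite -bsumD => hh.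
    by apply: le_trans hh _; rewrite le_eqVlt; apply/orP; left; apply/eqP; ring.
  have phiB := hK2 _ _ wB; exists (G z^* w) => _; split.
  - by apply/ell2P; eexists; exact: phiB.
  - apply/funext => n; have [] := GG w n; rewrite /A Au Av.
    by case: (G z _ n) => a b /= -> ->; case: (psi n).
  - by apply: ell2norm_le; rewrite /c -mulrA.
have [S hS] := choice solve.
have uniq psi phi : ell2 psi -> ell2 phi -> G z psi = G z phi -> psi = phi.
  move=> h1 h2 e12.
  have /kerG : ell2 (fun n => -1 * phi n + psi n) by exact: ell2_lin.
  have -> : (fun n => -1 * phi n + psi n) = fun n => psi n - phi n.
    by apply/funext => n; rewrite mulN1r addrC.
  move=> k; apply/funext => n; apply/eqP; rewrite -subr_eq0; apply/eqP.
  apply: (congr1 (fun f : Z2 -> C => f n) (k _)) => {}n.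
  have -> : G z (fun n => psi n - phi n) n = G z psi n - G z phi n.
    by rewrite /G /hop /lap !sum_offs; ring.
  by rewrite e12 subrr.
have Gl2 psi : ell2 psi -> ell2 (G z psi).
  move=> /ell2P[B hB]; apply/ell2P; exists (K1 * B); exact: hK1.
exists S.
  split=> [psi h|a psi phi h1 h2|]; first by have [] := hS psi h.
    have [s1 g1 _] := hS psi h1; have [s2 g2 _] := hS phi h2.
    have h3 := ell2_lin a h1 h2; have [s3 g3 _] := hS _ h3.
    apply: uniq => //; first exact: ell2_lin.
    rewrite g3; apply/funext => n.
    transitivity (a * G z (S psi) n + G z (S phi) n); first by rewrite g1 g2.
    by rewrite /G hop_lin; ring.
  exists (Num.sqrt c) => psi h; have [_ _ hn] := hS psi h.
  have c0 : 0 <= c * ell2norm psi ^+ 2 by apply: le_trans hn; exact: sqr_ge0.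
  have := ler_wsqrtr hn; rewrite sqrtr_sqr ger0_norm ?ell2norm_ge0 //.
  have cc : 0 <= c.
    rewrite /c mulr_ge0 // mulr_ge0 // mulr_ge0 ?sqr_ge0 // /solC.
    have /andP[t0 t1] := theta_bounds y2 e0 hK.
    have d0 : 0 <= 1 - theta (y ^+ 2) K e by lra.
    by rewrite divr_ge0 // mulr_ge0 // addr_ge0 // divr_ge0.
  by rewrite sqrtrM // sqrtr_sqr ger0_norm ?ell2norm_ge0.
move=> psi h; rewrite shift_operatorE; have h' := Gl2 psi h.
have [s1 g1 _] := hS psi h; have [s2 g2 _] := hS _ h'.
by split; [exact: uniq|rewrite shift_operatorE].
Qed.

End Resolvent.

(** * Counting eigenvalues of the fibres *)

Section BandIndex.
Variable R : realType.
Local Notation C := R[i].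
Variables (p1 p2 : nat).
Hypotheses (p1_gt0 : (0 < p1)%N) (p2_gt0 : (0 < p2)%N).
Local Notation I := ('I_p1 * 'I_p2)%type.
Local Notation dim := #|{: I}|.
Variable Q : Z2 -> R.
Hypothesis Q_per : biperiodic p1 p2 Q.
Implicit Types (x y E : R) (l : I).

Local Notation shifted x y E := (fibmx p1 p2 Q x y - E%:C%:M).

Lemma realC_real (a : R) : a%:C \is Num.real.
Proof. by rewrite complex_real. Qed.

Lemma shifted_herm x y E : shifted x y E \is hermsymmx.
Proof. by apply: hermsym_shift; [exact: realC_real|exact: fib_herm]. Qed.

Lemma continuous_fc : continuous (@fc R).
Proof.
move=> t; apply: cvgD; first exact: cvg_cst.
by apply: cvgM; [exact: cvg_cst|exact: continuous_cos].
Qed.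

Lemma continuous_freeval (f g : R -> R) l : continuous f -> continuous g ->
  continuous (fun t => freeval (f t) (g t) l).
Proof.
move=> cf cg t; apply: cvgB; last exact: cvg_cst.
apply: cvgM.
  apply: (@continuous_comp _ _ _ (fun t => f t + 2 * pi * l.1%:R / p1%:R) (@fc R)).
    by apply: cvgD; [exact: cf|exact: cvg_cst].
  exact: continuous_fc.
apply: (@continuous_comp _ _ _ (fun t => g t + 2 * pi * l.2%:R / p2%:R) (@fc R)).
  by apply: cvgD; [exact: cg|exact: cvg_cst].
exact: continuous_fc.
Qed.

Lemma qform_shifted_diff x y x' y' E (v : 'rV[C]_dim) :
  qform (shifted x y E - shifted x' y' E) v =
  (\sum_k (freeval x y (enum_val k) - freeval x' y' (enum_val k)) * nsq (v 0 k))%:C.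
Proof.
have -> : shifted x y E - shifted x' y' E =
   diag_mx (\row_k (freeval x y (enum_val k) - freeval x' y' (enum_val k))%:C).
  apply/matrixP => k k'; rewrite !mxE; case: (k == k'); rewrite ?mulr1n ?mulr0n ?rmorphB /=; ring.
rewrite qform_diag rmorph_sum; apply: eq_bigr => k _.
by rewrite mxE -nsq_normE -rmorphM.
Qed.

(** Along a segment the index is locally constant, so its cast to [R] is continuous. If the ends
    differed, it would take a half-integer value by the intermediate value theorem. *)
Lemma negidx_const x y x' y' E : below Q E ->
  negidx (shifted x y E) = negidx (shifted x' y' E).
Proof.
move=> bE; pose f t : R := x + t * (x' - x); pose g t : R := y + t * (y' - y).
pose N t : nat := negidx (shifted (f t) (g t) E).
have uM t : shifted (f t) (g t) E \in unitmx by exact: below_unit.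
have cf a b : continuous (fun t : R => a + t * b).
  move=> t; apply: cvgD; first exact: cvg_cst.
  by apply: cvgM; [exact: cvg_id|exact: cvg_cst].
have Nloc t0 : \forall t \near t0, N t = N t0.
  have [mu mu0 hmu] := negidx_locally_constant (shifted_herm (f t0) (g t0) E) (uM t0).
  have mur : mu = (complex.Re mu)%:C by rewrite RRe_real // ger0_real // ltW.
  have mu0' : 0 < complex.Re mu by move: mu0; rewrite {1}mur ltcR.
  have e0 : 0 < complex.Re mu / 2 by rewrite divr_gt0.
  have near_l : \forall t \near t0, forall l : I,
      `|freeval (f t) (g t) l - freeval (f t0) (g t0) l| < complex.Re mu / 2.
    apply: (@filter_forall R I (fun l t =>
      `|freeval (f t) (g t) l - freeval (f t0) (g t0) l| < complex.Re mu / 2) (nbhs t0) (nbhs_filter t0)) => l.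
    exact: (cvgr_distC_lt _ _ (@continuous_freeval f g l (cf _ _) (cf _ _) t0) _ e0).
  apply: filterS near_l => t ht; apply: hmu => //; first exact: shifted_herm.
  move=> v v0; have := sqnorm_gt0 v0; rewrite sqnormC ltcR => S0.
  rewrite qform_shifted_diff normc_def /= expr0n addr0 sqrtr_sqr.
  rewrite mur -rmorphM ltcR; apply: le_lt_trans (_ : complex.Re mu / 2 * \sum_k nsq (v 0 k) < _).
    apply: le_trans (ler_norm_sum _ _ _) _; rewrite mulr_sumr; apply: ler_sum => k _.
    rewrite normrM [X in _ * X]ger0_norm ?nsq_ge0 // ler_wpM2r ?nsq_ge0 //.
    exact: ltW.
  by rewrite ltr_pM2r // ltr_pdivrMr // ltr_pMr // ltr1n.
have NR : continuous (fun t => (N t)%:R : R).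
  by move=> t0; apply: cvg_near_cst; apply: filterS (Nloc t0) => t ->.
have ends : N 0 = negidx (shifted x y E) /\ N 1 = negidx (shifted x' y' E).
  by rewrite /N /f /g !mul0r !mul1r !addr0 ![_ + (_ - _)]addrC !subrK.
case: ends => <- <-; apply/eqP; apply/negPn/negP => neq.
pose v : R := (minn (N 0) (N 1))%:R + 2^-1.
have hv : Num.min (N 0)%:R (N 1)%:R <= v <= Num.max (N 0)%:R (N 1)%:R.
  have h2 : (0 : R) < 2^-1 by rewrite invr_gt0.
  have h3 : (2^-1 : R) <= 1 by rewrite invf_le1 // ler1n.
  have h a b : (a < b)%N -> a%:R + 2^-1 <= b%:R :> R.
    rewrite -(ler_nat R) -[a.+1%:R]natr1 => ab; lra.
  rewrite /v; have [lt|lt|e] := ltngtP (N 0) (N 1).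
  - by rewrite min_l ?max_r ?ler_nat ?(ltnW lt) // lerDl (ltW h2) h.
  - by rewrite min_r ?max_l ?ler_nat ?(ltnW lt) // lerDl (ltW h2) h.
  - by rewrite e eqxx in neq.
have [c _ hc] := IVT (@ler01 R) (continuous_subspaceT NR) hv.
have : (2 * N c)%:R = (2 * minn (N 0) (N 1) + 1)%:R :> R.
  rewrite natrM hc /v natrD natrM mulrDr divff //.
by move/eqP; rewrite eqr_nat => /eqP; lia.
Qed.

(** The characters diagonalise the potential back into position space, where its form is visibly
    bounded by the supremum of [Q]. *)
Lemma qform_potmx (v : 'rV[C]_dim) : qform (potmx p1 p2 Q) v =
  ((p1 * p2)%:R^-1 * \sum_c Q (of_cell c) *
    nsq (\sum_l (v 0 (enum_rank l))^* * char R l c))%:C.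
Proof.
have -> : qform (potmx p1 p2 Q) v = \sum_l \sum_l'
    v 0 (enum_rank l) * potential_coef Q l l' * (v 0 (enum_rank l'))^*.
  pose F l l' := v 0 (enum_rank l) * potential_coef Q l l' * (v 0 (enum_rank l'))^*.
  transitivity (\sum_(k < dim) \sum_(k' < dim) F (enum_val k) (enum_val k')); last first.
    rewrite (sum_enum_val (fun l => \sum_(k' < dim) F l (enum_val k'))).
    by apply: eq_bigr => l _; rewrite sum_enum_val.
  rewrite /qform mxE exchange_big; apply: eq_bigr => k' _; rewrite !mxE mulr_suml.
  by apply: eq_bigr => k _; rewrite !mxE /F !enum_valK.
rewrite rmorphM fmorphV rmorph_nat rmorph_sum /=.
pose G l l' i : C := (Q (of_cell i))%:C *
   ((v 0 (enum_rank l'))^* * char R l' i * ((v 0 (enum_rank l))^* * char R l i)^*).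
transitivity ((p1 * p2)%:R^-1 * \sum_l \sum_l' \sum_i G l l' i).
  rewrite mulr_sumr; apply: eq_bigr => l _; rewrite mulr_sumr; apply: eq_bigr => l' _.
  rewrite /potential_coef mulrCA -!mulrA; congr (_ * _); rewrite mulr_suml mulr_sumr.
  have e (a b : C) : (a^* * b)^* = a * b^* by rewrite conjM conjCK.
  by apply: eq_bigr => i _; rewrite /G e; ring.
rewrite (eq_bigr (fun l => \sum_i \sum_l' G l l' i)); last first.
  by move=> l _; exact: exchange_big.
rewrite exchange_big /=; congr (_ * _); apply: eq_bigr => i _.
rewrite rmorphM /= nsq_sumE exchange_big /= mulr_sumr; apply: eq_bigr => l _.
by rewrite mulr_sumr.
Qed.

Variable c : R.
Hypothesis Q_le : forall n, `|Q n| <= c.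

Lemma qform_potmx_le (v : 'rV[C]_dim) : `|qform (potmx p1 p2 Q) v| <= c%:C * sqnorm v.
Proof.
rewrite qform_potmx normc_def /= expr0n addr0 sqrtr_sqr sqnormC -rmorphM lecR.
have P0 : 0 < (p1 * p2)%:R :> R by rewrite ltr0n muln_gt0 p1_gt0.
rewrite normrM gtr0_norm ?invr_gt0 // ler_pdivrMl //.
have h := char_parseval (fun l => (v 0 (enum_rank l))^*).
have -> : \sum_k nsq (v 0 k) = \sum_l nsq ((v 0 (enum_rank l))^*).
  by rewrite -sum_enum_val; apply: eq_bigr => k _; rewrite nsqJ enum_valK.
rewrite mulrCA -h mulr_sumr; apply: le_trans (ler_norm_sum _ _ _) _.
apply: ler_sum => i _; rewrite normrM [X in _ * X]ger0_norm ?nsq_ge0 //.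
by rewrite ler_wpM2r ?nsq_ge0.
Qed.

Definition coordmx (J : {pred 'I_dim}) : 'M[C]_(#|J|, dim) := rowsub enum_val 1%:M.

Lemma coordmxE (J : {pred 'I_dim}) (u : 'rV[C]_#|J|) :
  (forall k, (u *m coordmx J) 0 (enum_val k) = u 0 k) /\
  (forall j, j \notin J -> (u *m coordmx J) 0 j = 0).
Proof.
split=> [k|j jJ]; rewrite mxE.
  rewrite (bigD1 k) //= !mxE eqxx mulr1 big1 ?addr0 // => i ik.
  by rewrite !mxE (inj_eq enum_val_inj) (negPf ik) mulr0.
rewrite big1 // => i _; rewrite !mxE; case: eqVneq => [e|]; last by rewrite mulr0.
by move: jJ; rewrite -e enum_valP.
Qed.

Lemma qform_shifted x y E v : qform (shifted x y E) v =
  (\sum_k (freeval x y (enum_val k) - E) * nsq (v 0 k))%:C + qform (potmx p1 p2 Q) v.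
Proof.
have -> : shifted x y E =
   diag_mx (\row_k (freeval x y (enum_val k) - E)%:C) + potmx p1 p2 Q.
  by apply/matrixP => k k'; rewrite !mxE; case: (k == k');
    rewrite ?mulr1n ?mulr0n ?rmorphB /=; ring.
rewrite qformD qform_diag rmorph_sum; congr (_ + _); apply: eq_bigr => k _.
by rewrite mxE -nsq_normE -rmorphM.
Qed.

(* On the coordinate subspace [J] the free form is [< - c] (times the sign [s]),
   and the potential cannot compensate for it. *)
Lemma qform_coord_lt0 (s : R) x y E (J : {pred 'I_dim}) (u : 'rV[C]_#|J|) :
  `|s| = 1 -> (forall k, k \in J -> s * (freeval x y (enum_val k) - E) < - c) ->
  u != 0 -> s%:C * qform (shifted x y E) (u *m coordmx J) < 0.
Proof.
move=> s1 hJ u0; set v := u *m coordmx J; have [vJ vn] := coordmxE u.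
have [k0 uk0] : exists k, u 0 k != 0.
  apply/existsP; apply: contraR u0 => /existsPn h; apply/eqP/rowP => k.
  by rewrite mxE; apply/eqP; apply: contraT => /(fun h' => negP (h k) h').
have pr : qform (potmx p1 p2 Q) v \is Num.real.
  by rewrite qform_potmx realC_real.
rewrite qform_shifted mulrDr; have := qform_potmx_le v.
rewrite sqnormC => hp; apply: le_lt_trans (_ : s%:C * (\sum_k (freeval x y (enum_val k) - E)
   * nsq (v 0 k))%:C + (c * \sum_k nsq (v 0 k))%:C < 0).
  rewrite lerD2l rmorphM; apply: le_trans hp.
  apply: le_trans (real_ler_norm _) _; first by rewrite realM ?realC_real.
  by rewrite normrM normc_def /= expr0n addr0 sqrtr_sqr s1 mul1r.
rewrite -rmorphM -rmorphD (ltcR _ 0) !mulr_sumr -big_split /=.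
have t0 j : s * ((freeval x y (enum_val j) - E) * nsq (v 0 j)) + c * nsq (v 0 j) <= 0.
  have [jJ|/vn ->] := boolP (j \in J); last by rewrite nsq0 !mulr0 addr0.
  rewrite mulrA -mulrDl mulr_le0_ge0 ?nsq_ge0 // -lerBrDr sub0r; exact/ltW/hJ.
rewrite (bigD1 (enum_val k0)) //= -[ltRHS]addr0; apply: ltr_leD; last by apply: sumr_le0.
rewrite mulrA -mulrDl vJ nmulr_rlt0; last by rewrite -ltrBrDr sub0r hJ ?enum_valP.
by rewrite lt_def nsq_ge0 nsq_eq0 uk0.
Qed.

Lemma card_enum_val (P : pred I) : #|[pred k : 'I_dim | P (enum_val k)]| = #|P|.
Proof.
rewrite -[LHS]sum1_card -[RHS]sum1_card big_mkcond [RHS]big_mkcond /=.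
by rewrite -(sum_enum_val (fun l => if P l then 1 else 0)%N).
Qed.

Lemma negidx_count x y E :
  (#|[pred l : I | (freeval x y l < E - c)%R]| <= negidx (shifted x y E))%N.
Proof.
rewrite -(card_enum_val (fun l => freeval x y l < E - c)).
apply: (@negidx_ge _ _ _ _ (coordmx _)); first exact: shifted_herm.
move=> u u0; rewrite -[qform _ _]mul1r -(rmorph1 (real_complex R)).
apply: qform_coord_lt0 => // [|k]; first by rewrite normr1.
by rewrite inE mul1r => h; lra.
Qed.

Lemma posidx_count x y E :
  (#|[pred l : I | (E + c < freeval x y l)%R]| <= posidx (shifted x y E))%N.
Proof.
rewrite -(card_enum_val (fun l => E + c < freeval x y l)).
apply: (@posidx_ge _ _ _ _ (coordmx _)); first exact: shifted_herm.
move=> u u0; rewrite -oppr_lt0 -mulN1r -(rmorph1 (real_complex R)) -rmorphN.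
apply: qform_coord_lt0 => // [|k]; first by rewrite normrN normr1.
by rewrite inE mulN1r => h; lra.
Qed.

Lemma shifted_idxD x y E : below Q E ->
  (negidx (shifted x y E) + posidx (shifted x y E) = p1 * p2)%N.
Proof.
move=> bE; transitivity #|{: I}|; last by rewrite card_prod !card_ord.
by apply: negidxD; [exact: shifted_herm|exact: below_unit].
Qed.

(** If [below Q E] held, the first count would be at most the common negative index and the second
    at most the complementary positive one, with sum at most [p1 * p2]. *)
Lemma not_below_overlap x y x' y' E :
  (p1 * p2 < #|[pred l : I | (freeval x y l < E - c)%R]|
    + #|[pred l : I | (E + c < freeval x' y' l)%R]|)%N -> ~ below Q E.
Proof.
move=> lt bE; have := shifted_idxD x y bE; have := shifted_idxD x' y' bE.
have := negidx_const x y x' y' bE; have := negidx_count x y E.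
have := posidx_count x' y' E; lia.
Qed.

(** At [(x, y)] no free eigenvalue is within [c] of [[E1, E2]], which forces equal indices at [E1]
    and [E2] there, hence at every quasimomentum. So no fibre has an eigenvalue in between. *)
Lemma below_split x y E1 E2 E : (forall l, freeval x y l < E1 - c \/ E2 + c < freeval x y l) ->
  below Q E1 -> below Q E2 -> E1 <= E <= E2 -> below Q E.
Proof.
move=> hl b1 b2 /andP[E1E EE2].
have [->//|ne1] := eqVneq E E1; have [->//|ne2] := eqVneq E E2.
have u1 x' y' := below_unit p1_gt0 p2_gt0 Q_per x' y' b1.
have u2 x' y' := below_unit p1_gt0 p2_gt0 Q_per x' y' b2.
have lt1 : E1 < E by rewrite lt_neqAle eq_sym ne1.
have lt2 : E < E2 by rewrite lt_neqAle ne2.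
have eqidx : negidx (shifted x y E1) = negidx (shifted x y E2).
  have := shifted_idxD x y b1; have := shifted_idxD x y b2.
  have := negidx_count x y E1; have := posidx_count x y E1.
  have := negidx_count x y E2; have := posidx_count x y E2.
  have c0 : 0 <= c by apply: le_trans (Q_le (0, 0)).
  have eN : #|[pred l : I | freeval x y l < E2 - c]|
    = #|[pred l : I | freeval x y l < E1 - c]|.
    by apply: eq_card => l; rewrite !inE; have := hl l; case=> h; apply/idP/idP; lra.
  have eP : #|[pred l : I | E1 + c < freeval x y l]|
    = #|[pred l : I | E2 + c < freeval x y l]|.
    by apply: eq_card => l; rewrite !inE; have := hl l; case=> h; apply/idP/idP; lra.
  have cc : (#|[pred l : I | (freeval x y l < E1 - c)%R]|
     + #|[pred l : I | (E2 + c < freeval x y l)%R]| = p1 * p2)%N.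
    transitivity #|{: I}|; last by rewrite card_prod !card_ord.
    rewrite -(cardC [pred l : I | freeval x y l < E1 - c]); congr addn.
    by apply: eq_card => l; rewrite !inE; have := hl l; case=> h; apply/idP/idP; lra.
  rewrite eN eP; move: cc.
  move: #|[pred l : I | freeval x y l < E1 - c]| #|[pred l : I | E2 + c < freeval x y l]|.
  move: (negidx _) (posidx _) (negidx _) (posidx _); lia.
(* The distance to the ends does not depend on the fibre, so the bound is uniform. *)
pose r := Num.min (E - E1) (E2 - E).
have r0 : 0 < r by rewrite lt_min !subr_gt0 lt1 lt2.
apply: (fiber_below p1_gt0 p2_gt0 Q_per (r := r ^+ 2)); first by rewrite exprn_gt0.
move=> x' y' v; rewrite rmorphXn.
have eqi : negidx (shifted x' y' E1) = negidx (shifted x' y' E2).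
  by rewrite -(negidx_const x y x' y' b1) -(negidx_const x y x' y' b2).
have rC : 0 <= r%:C by rewrite ler0c ltW.
have h1 : E1%:C + r%:C <= E%:C by rewrite -rmorphD lecR -lerBrDl ge_min lexx.
have h2 : E%:C + r%:C <= E2%:C by rewrite -rmorphD lecR -lerBrDl ge_min lexx orbT.
exact: (sqnorm_shift_ge v (realC_real E1) (realC_real E2) (fib_herm p1 p2 Q x' y')
  (u1 x' y') (u2 x' y') eqi rC h1 h2).
Qed.

End BandIndex.

(** * Overlap of the free bands *)

Section FreeBands.
Variable R : realType.
Implicit Types (t u x y E : R).

Lemma fc_ge t : -1 <= fc t.
Proof. by have := cos_geN1 t; rewrite /fc; lra. Qed.

Lemma cos_tripling t : cos (3 * t) = 4 * cos t ^+ 3 - 3 * cos t.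
Proof.
have -> : 3 * t = t *+ 2 + t by rewrite -mulr_natl; ring.
by rewrite cosD cos_mulr2n sin_mulr2n -mulrnAl -mulrA -expr2 sin2cos2; ring.
Qed.

(** A zero of [fc] has [cos t = -1/2], where the tripled angle has cosine 1. The condition
    [cos (3 * t) != 1] also excludes the maximum of [fc], see [cos_neq1]. *)
Lemma fc_neq0 t : cos (3 * t) != 1 -> fc t != 0.
Proof.
apply: contra => /eqP f0; apply/eqP; rewrite cos_tripling.
have -> : cos t = - 2^-1 by rewrite /fc in f0; lra.
by field.
Qed.

Lemma cos_neq1 t : cos (3 * t) != 1 -> cos t < 1.
Proof.
move=> h; rewrite lt_neqAle cos_le1 andbT; apply: contra h => /eqP c1.
by rewrite cos_tripling c1; apply/eqP; ring.
Qed.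

Lemma cos_2pi3 : cos (2 * pi / 3) = - 2^-1 :> R.
Proof.
have c1 : cos (2 * pi / 3) < 1 :> R by have := pi_gt0 R; move=> ?; apply: cos_lt1; lra.
have : cos (3 * (2 * pi / 3)) = 1 :> R.
  have -> : 3 * (2 * pi / 3) = pi *+ 2 :> R by rewrite -mulr_natl; field.
  exact: cos2pi.
rewrite cos_tripling; set c := cos _ in c1 *; move=> h.
(* Factorisation of [4 c^3 - 3 c - 1]. *)
have : (c - 1) * (2 * c + 1) ^+ 2 = 0 by lra.
move/eqP; rewrite mulf_eq0 sqrf_eq0 => /orP[/eqP|/eqP]; lra.
Qed.

Lemma cos3_shift t : cos (3 * (t + 2 * pi / 3)) = cos (3 * t).
Proof.
have -> : 3 * (t + 2 * pi / 3) = 3 * t + pi *+ 2 by rewrite -mulr_natl; field.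
exact: cosD2pi.
Qed.

(* The product of the three values is [-2 (1 - c) (1 + 2 c)^2] with [c = cos t],
   their sum is [3]. *)
Lemma fc_three t : cos (3 * t) != 1 ->
  ((0 < fc t)%R + (0 < fc (t + 2 * pi / 3))%R
    + (0 < fc (t + 2 * pi / 3 + 2 * pi / 3))%R = 2)%N.
Proof.
move=> h; have f0 := fc_neq0 h.
have h1 : cos (3 * (t + 2 * pi / 3)) != 1 by rewrite cos3_shift.
have f1 := fc_neq0 h1.
have f2 : fc (t + 2 * pi / 3 + 2 * pi / 3) != 0 by apply: fc_neq0; rewrite cos3_shift.
have c1 := cos_neq1 h.
pose s : R := sin (2 * pi / 3).
have s2 : s ^+ 2 = 3 / 4 by rewrite /s sin2cos2 cos_2pi3; field.
have e1 : fc (t + 2 * pi / 3) = 1 - cos t - 2 * s * sin t.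
  by rewrite /fc cosD cos_2pi3 -/s; field.
have e2 : fc (t + 2 * pi / 3 + 2 * pi / 3) = 1 - cos t + 2 * s * sin t.
  rewrite /fc !cosD !sinD cos_2pi3 -/s.
  have -> : 1 + 2 * ((cos t * - 2^-1 - sin t * s) * - 2^-1 - (sin t * - 2^-1 + cos t * s) * s)
    = 1 + cos t / 2 - 2 * s ^+ 2 * cos t + 2 * s * sin t by field.
  by rewrite s2; field.
have sm : fc t + fc (t + 2 * pi / 3) + fc (t + 2 * pi / 3 + 2 * pi / 3) = 3.
  by rewrite e1 e2 /fc; ring.
have pr : fc t * (fc (t + 2 * pi / 3) * fc (t + 2 * pi / 3 + 2 * pi / 3)) < 0.
  have -> : fc t * (fc (t + 2 * pi / 3) * fc (t + 2 * pi / 3 + 2 * pi / 3))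
    = - (2 * (1 - cos t) * fc t ^+ 2).
    by rewrite e1 e2 -subr_sqr !exprMn s2 sin2cos2 /fc; field.
  have p1 : 0 < 2 * (1 - cos t) by lra.
  have p2 : 0 < fc t ^+ 2 by rewrite exprn_even_gt0.
  by rewrite oppr_lt0 mulr_gt0.
move: f0 f1 f2 sm pr; move: (fc t) (fc (t + 2 * pi / 3)) (fc (t + 2 * pi / 3 + 2 * pi / 3)).
move=> a b c a0 b0 c0 sm pr.
have [a1|a1|a1] := ltgtP a 0; last by rewrite a1 eqxx in a0.
all: have [b1|b1|b1] := ltgtP b 0; try by rewrite b1 eqxx in b0.
all: have [d1|d1|d1] := ltgtP c 0; try by rewrite d1 eqxx in c0.
all: move: pr; rewrite ?(pmulr_rlt0 _ a1) ?(nmulr_rlt0 _ a1) //.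
all: rewrite ?(pmulr_rlt0 _ b1) ?(nmulr_rlt0 _ b1) ?(pmulr_rgt0 _ b1) ?(nmulr_rgt0 _ b1) //.
all: by move=> pr; exfalso; lra.
Qed.

(* Angles of the form [2 asin t] make the symbol algebraic in the parameter, so
   that the expansions below only involve limits. *)
Lemma fc_asin u t : -1 <= t <= 1 ->
  fc (u + 2 * asin t) = fc u - 4 * t * (t * cos u + Num.sqrt (1 - t ^+ 2) * sin u).
Proof.
move=> t1; have -> : 2 * asin t = asin t *+ 2 by rewrite mulr_natl.
rewrite /fc cosD cos_mulr2n sin_mulr2n.
rewrite cos_asin // asinK ?in_itv //= sqr_sqrtr; first ring.
by rewrite subr_ge0; nra.
Qed.

Lemma card_overlap (I : finType) (A B : pred I) (l0 : I) :
  (forall l, A l || B l) -> A l0 && B l0 -> (#|I| < #|A| + #|B|)%N.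
Proof.
move=> AB AB0; rewrite -cardUI.
have -> : #|[predU A & B]| = #|I| by apply: eq_card => l; rewrite !inE; exact: AB.
by rewrite -addn1 leq_add2l (cardD1 l0) !inE; move: AB0; rewrite /in_mem /= => ->.
Qed.

Lemma near_right_gt0 (f : R -> R) : continuous f -> 0 < f 0 ->
  \forall s \near (0 : R)^'+, 0 < f s.
Proof.
move=> cf f0; exact: (cvgr_gt _ (cvg_at_right_filter (cf 0)) _ f0).
Qed.

Lemma near_right_ltB a b : a < b -> \forall c \near (0 : R)^'+, a < b - c.
Proof.
move=> ab; have h : 0 < b - a by rewrite subr_gt0.
apply: filterS (nbhs_right_lt h) => c; lra.
Qed.

(** This is [sin (u + asin t)], and for nonzero [t] the quotient
    [(fc u - fc (u + 2 asin t)) / (4 t)]; it is continuous with value [sin u] at 0. *)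
Definition asin_slope u (t : R) := t * cos u + Num.sqrt (1 - t ^+ 2) * sin u.

Lemma continuous_asin_slope u : continuous (asin_slope u).
Proof.
move=> t; apply: cvgD; first by apply: cvgM; [exact: cvg_id|exact: cvg_cst].
apply: cvgM; last exact: cvg_cst.
apply: (@continuous_comp _ _ _ (fun t => 1 - t ^+ 2) Num.sqrt); last exact: sqrt_continuous.
apply: cvgB; first exact: cvg_cst.
by rewrite expr2; apply: cvgM; exact: cvg_id.
Qed.

Lemma asin_slope0 u : asin_slope u 0 = sin u.
Proof. by rewrite /asin_slope expr0n subr0 sqrtr1 mul0r add0r mul1r. Qed.

Variables (p1 p2 : nat).
Hypotheses (p1_gt0 : (0 < p1)%N) (p2_gt0 : (0 < p2)%N).
Local Notation I := ('I_p1 * 'I_p2)%type.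
Implicit Types (l : I).

(** Different free counts at two quasimomenta, with margin [c]: this keeps [E] in the spectrum for
    every periodic potential bounded by [c]. *)
Definition overlap E c := exists x y x' y',
  (p1 * p2 < #|[pred l : I | (freeval x y l < E - c)%R]|
    + #|[pred l : I | (E + c < freeval x' y' l)%R]|)%N.

Lemma overlap_margin x y x' y' E :
  (p1 * p2 < #|[pred l : I | (freeval x y l < E)%R]|
    + #|[pred l : I | (E < freeval x' y' l)%R]|)%N ->
  exists2 c, 0 < c & overlap E c.
Proof.
move=> lt.
have h1 : \forall c \near (0 : R)^'+, forall l, freeval x y l < E -> freeval x y l < E - c.
  apply: (@filter_forall R I (fun l c => freeval x y l < E -> freeval x y l < E - c)) => l.
  have [h|h] := boolP (freeval x y l < E); last by apply: nearW.
  by apply: filterS (near_right_ltB h).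
have h2 : \forall c \near (0 : R)^'+, forall l, E < freeval x' y' l -> E + c < freeval x' y' l.
  apply: (@filter_forall R I (fun l c => E < freeval x' y' l -> E + c < freeval x' y' l)) => l.
  have [h|h] := boolP (E < freeval x' y' l); last by apply: nearW.
  apply: filterS (near_right_ltB h) => c; lra.
have [c [[c1 c2] c0]] := filter_ex (filterI (filterI h1 h2) (nbhs_right_gt (0 : R))).
exists c => //; exists x, y, x', y'; apply: leq_trans lt _.
apply: leq_add; apply: subset_leq_card; apply/fintype.subsetP => l; rewrite !inE.
  exact: c1.
exact: c2.
Qed.

Lemma overlap_open E c E' : overlap E c -> `|E' - E| <= c / 2 -> overlap E' (c / 2).
Proof.
move=> [x [y [x' [y' lt]]]]; rewrite ler_norml => /andP[h1 h2].
exists x, y, x', y'; apply: leq_trans lt _.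
by apply: leq_add; apply: subset_leq_card; apply/fintype.subsetP => l; rewrite !inE => h; lra.
Qed.

Lemma overlap_le E c c' : c' <= c -> overlap E c -> overlap E c'.
Proof.
move=> h [x [y [x' [y' lt]]]]; exists x, y, x', y'; apply: leq_trans lt _.
by apply: leq_add; apply: subset_leq_card; apply/fintype.subsetP => l; rewrite !inE => h'; lra.
Qed.

Section Interior.
Variables (E x0 : R).
Let lam : R := E + 1.
Hypothesis lam0 : lam != 0.
Hypothesis fcx0 : fc x0 = lam / 3.
Hypothesis sinx0 : 0 < sin x0.
(** Scale of the shift in [x]. At [l0] the shift in [y] changes the value divided by [lam] by
    [-(4/3) s^2]; with this [k] the shift in [x] adds [2 s^2] to leading order, so the sum is
    positive. *)
Let k : R := - lam / (6 * sin x0).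
Let u l := x0 + 2 * pi * l.1%:R / p1%:R.
Let v l : R := 2 * pi * l.2%:R / p2%:R.
(** [lower] and [upper] are [(freeval + 1) / lam] at [(x0, 2 asin s)] and at
    [(x0 + 2 asin (k s^2), 2 asin s)]. Division by [lam] treats both signs of [lam] together: 1
    stands for the energy [E], and a value below 1 has moved towards [0]. *)
Let lower l (s : R) := fc (u l) * (fc (v l) - 4 * s * asin_slope (v l) s) / lam.
Let upper l (s : R) :=
  (fc (u l) - 4 * (k * s ^+ 2) * asin_slope (u l) (k * s ^+ 2))
  * (fc (v l) - 4 * s * asin_slope (v l) s) / lam.

Let cont_sq : continuous (fun s : R => k * s ^+ 2).
Proof.
move=> s; apply: cvgM; first exact: cvg_cst.
by rewrite expr2; apply: cvgM; exact: cvg_id.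
Qed.

Let cont_slope_sq w : continuous (fun s : R => asin_slope w (k * s ^+ 2)).
Proof.
move=> s; apply: (@continuous_comp _ _ _ (fun s : R => k * s ^+ 2) (asin_slope w)).
  exact: cont_sq.
exact: continuous_asin_slope.
Qed.

Let cont_cst (a : R) : continuous (fun _ : R => a).
Proof. by move=> s; exact: cvg_cst. Qed.

Let cont_id : continuous (fun s : R => s).
Proof. by move=> s; exact: cvg_id. Qed.

Let contM (f g : R -> R) : continuous f -> continuous g -> continuous (fun s : R => f s * g s).
Proof. by move=> cf cg s; apply: cvgM; [exact: cf|exact: cg]. Qed.

Let contB (f g : R -> R) : continuous f -> continuous g -> continuous (fun s : R => f s - g s).
Proof. by move=> cf cg s; apply: cvgB; [exact: cf|exact: cg]. Qed.

Let contD (f g : R -> R) : continuous f -> continuous g -> continuous (fun s : R => f s + g s).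
Proof. by move=> cf cg s; apply: cvgD; [exact: cf|exact: cg]. Qed.

Let cont_right l : continuous (fun s : R => fc (v l) - 4 * s * asin_slope (v l) s).
Proof.
apply: contB => //; apply: contM; last exact: continuous_asin_slope.
exact: contM.
Qed.

Let cont_left l : continuous
  (fun s : R => fc (u l) - 4 * (k * s ^+ 2) * asin_slope (u l) (k * s ^+ 2)).
Proof.
apply: contB => //; apply: contM; last exact: cont_slope_sq.
exact: contM.
Qed.

(** At a critical point in [y], [fc (v l)] is 3 or -1 and has the sign of [cos (v l)]. Hence
    [fc (u l) * cos (v l) / lam] is 1/3 or 1, in both cases positive, and the value drops by [4 s^2]
    times this. *)
Let sin0_lower l s : fc (u l) * fc (v l) = lam -> sin (v l) = 0 -> 0 < s ->
  lower l s < 1.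
Proof.
move=> r1 sv s0; have c1 : cos (v l) = 1 \/ cos (v l) = -1.
  have : cos (v l) ^+ 2 = 1 by rewrite cos2sin2 sv expr0n subr0.
  by move/eqP; rewrite sqrf_eq1 => /orP[] /eqP ->; [left|right].
have s2 : 0 < s ^+ 2 by rewrite exprn_gt0.
rewrite /lower /asin_slope sv mulr0 addr0.
have -> : fc (u l) * (fc (v l) - 4 * s * (s * cos (v l))) / lam =
   (fc (u l) * fc (v l)) / lam - 4 * s ^+ 2 * (fc (u l) * cos (v l) / lam) by ring.
rewrite r1 divff //; suff : 0 < fc (u l) * cos (v l) / lam by nra.
move: r1; rewrite /fc -/(fc (u l)); case: c1 => -> r1.
  have -> : fc (u l) * 1 / lam = 3^-1 by rewrite -r1; field; move: lam0; rewrite -r1;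
    apply: contraNneq => ->; rewrite mul0r.
  by rewrite invr_gt0.
have -> : fc (u l) * -1 / lam = 1 by rewrite -r1; field; move: lam0; rewrite -r1;
  apply: contraNneq => ->; rewrite mul0r.
by [].
Qed.

(** Values other than 1 at [s = 0] are settled by continuity, critical ones by [sin0_lower].
    Otherwise the sign of the first-order term in [s] decides: it carries [lower] below 1 or [upper]
    above 1. *)
Lemma interior_near l : \forall s \near (0 : R)^'+, lower l s < 1 \/ 1 < upper l s.
Proof.
pose r := fc (u l) * fc (v l) / lam.
have lowE s : lower l s = r - 4 * s * (fc (u l) / lam * asin_slope (v l) s).
  by rewrite /lower /r; ring.
have [r1|r1|r1] := ltgtP r 1.
- have : \forall s \near (0 : R)^'+, 0 < 1 - lower l s.
    apply: near_right_gt0; last by rewrite /lower !(mulr0, mul0r) subr0 subr_gt0.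
    apply: contB => //; apply: contM => //; exact: contM.
  by apply: filterS => s; rewrite subr_gt0; left.
- have : \forall s \near (0 : R)^'+, 0 < upper l s - 1.
    apply: near_right_gt0; last first.
      by rewrite /upper expr0n /= !(mulr0, mul0r) !subr0 subr_gt0.
    apply: contB => //; apply: contM => //; exact: contM.
  by apply: filterS => s; rewrite subr_gt0; right.
have rl : fc (u l) * fc (v l) = lam by rewrite -[LHS](divfK lam0) -/r r1 mul1r.
have [sv|sv] := eqVneq (sin (v l)) 0.
  by apply: filterS (nbhs_right_gt (0 : R)) => s s0; left; exact: sin0_lower.
have fu0 : fc (u l) != 0 by move: lam0; rewrite -rl; apply: contraNneq => ->; rewrite mul0r.
have [d0|d0|d0] := ltgtP (fc (u l) / lam * sin (v l)) 0.
(* The quotient [(upper l s - 1) / s]; the terms due to the shift in [x] vanish at 0. *)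
- pose h s := (- 4 * fc (u l) * asin_slope (v l) s
     - 4 * (k * s) * asin_slope (u l) (k * s ^+ 2) * fc (v l)
     + 16 * (k * s ^+ 2) * asin_slope (u l) (k * s ^+ 2) * asin_slope (v l) s) / lam.
  have hup s : upper l s = 1 + s * h s.
    by rewrite -r1 /r /upper /h; ring.
  have : \forall s \near (0 : R)^'+, 0 < h s.
    apply: near_right_gt0; last first.
      rewrite /h expr0n /= !(mulr0, mul0r) subr0 addr0 asin_slope0.
      have -> : - 4 * fc (u l) * sin (v l) / lam = - 4 * (fc (u l) / lam * sin (v l)).
        by ring.
      lra.
    apply: contM => //; apply: contD; last first.
      apply: contM; last exact: continuous_asin_slope.
      by apply: contM; [exact: contM|exact: cont_slope_sq].
    apply: contB; first by apply: contM => //; exact: continuous_asin_slope.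
    apply: contM => //; apply: contM; last exact: cont_slope_sq.
    by apply: contM => //; exact: contM.
  move=> hn; apply: filterS (filterI hn (nbhs_right_gt (0 : R))) => s [hs s0].
  by right; rewrite hup ltrDl mulr_gt0.
- have : \forall s \near (0 : R)^'+, 0 < fc (u l) / lam * asin_slope (v l) s.
    apply: near_right_gt0; last by rewrite asin_slope0.
    by apply: contM => //; exact: continuous_asin_slope.
  move=> hn; apply: filterS (filterI hn (nbhs_right_gt (0 : R))) => s [hs s0].
  by left; rewrite lowE r1; nra.
- by move/eqP: d0; rewrite !mulf_eq0 invr_eq0 (negPf fu0) (negPf lam0) (negPf sv).
Qed.

Let l0 : I := (Ordinal p1_gt0, Ordinal p2_gt0).

Lemma interior_near0 : \forall s \near (0 : R)^'+, lower l0 s < 1 /\ 1 < upper l0 s.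
Proof.
have ue : u l0 = x0 by rewrite /u /= mulr0 mul0r addr0.
have ve : v l0 = 0 by rewrite /v /= mulr0 mul0r.
have fv : fc (v l0) = 3 by rewrite ve /fc cos0; ring.
(* The quotient [(upper l0 s - 1) / s^2], with value 2/3 at 0. *)
pose h s := (- 4 * fc x0 - 12 * k * asin_slope x0 (k * s ^+ 2)
   + 16 * (k * s ^+ 2) * asin_slope x0 (k * s ^+ 2)) / lam.
have hup s : upper l0 s = 1 + s ^+ 2 * h s.
  rewrite /upper fv ue ve {2}/asin_slope cos0 sin0 mulr0 addr0 mulr1 /h fcx0; field.
  exact: lam0.
have : \forall s \near (0 : R)^'+, 0 < h s.
  apply: near_right_gt0; last first.
    rewrite /h expr0n /= !(mulr0, mul0r) addr0 asin_slope0 fcx0 /k.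
    have -> : (- 4 * (lam / 3) - 12 * (- lam / (6 * sin x0)) * sin x0) / lam = 2 / 3.
      by field; rewrite lam0 gt_eqF.
    by rewrite divr_gt0.
  apply: contM => //; apply: contD; last first.
    by apply: contM; [exact: contM|exact: cont_slope_sq].
  apply: contB => //; apply: contM => //; exact: cont_slope_sq.
move=> hn; apply: filterS (filterI hn (nbhs_right_gt (0 : R))) => s [hs s0]; split.
  by apply: sin0_lower => //; rewrite ?fv ?ue ?fcx0 ?ve ?sin0 ?divfK.
by rewrite hup ltrDl mulr_gt0 // exprn_gt0.
Qed.

Lemma interior_overlap : exists2 c, 0 < c & overlap E c.
Proof.
have n1 : \forall s \near (0 : R)^'+, forall l, lower l s < 1 \/ 1 < upper l s.
  apply: (@filter_forall R I (fun l s => lower l s < 1 \/ 1 < upper l s)) => l.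
  exact: interior_near.
have n2 : \forall s \near (0 : R)^'+, 0 < (1 - (k * (s : R) ^+ 2) ^+ 2 : R).
  apply: near_right_gt0; last by rewrite expr0n mulr0 expr0n subr0.
  by apply: contB => //; rewrite /=; apply: (contM cont_sq cont_sq).
have n3 : \forall s \near (0 : R)^'+, s < 1 by exact: nbhs_right_lt.
have n4 : \forall s \near (0 : R)^'+, 0 < s by exact: nbhs_right_gt.
near (0 : R)^'+ => s.
have h1 : forall l, lower l s < 1 \/ 1 < upper l s by near: s.
have h2 : 0 < 1 - (k * s ^+ 2) ^+ 2 by near: s.
have h3 : s < 1 by near: s.
have h4 : lower l0 s < 1 /\ 1 < upper l0 s by near: s; exact: interior_near0.
have s0 : 0 < s by near: s.
have s1 : -1 <= s <= 1 by rewrite /= in s0 h3 *; lra.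
have ks1 : -1 <= k * s ^+ 2 <= 1 by move: h2; rewrite /=; nra.
pose y := 2 * asin s; pose x' := x0 + 2 * asin (k * s ^+ 2).
have lowE l : (freeval x0 y l + 1) / lam = lower l s.
  rewrite /freeval subrK /lower -/(u l); congr (_ * _ / _).
  by rewrite /y [2 * asin s + _]addrC fc_asin.
have upE l : (freeval x' y l + 1) / lam = upper l s.
  rewrite /freeval subrK /upper; congr (_ * _ / _).
    by rewrite /x' addrAC fc_asin.
  by rewrite /y [2 * asin s + _]addrC fc_asin.
have [lt0|gt0] : lam < 0 \/ 0 < lam.
  by move: lam0; rewrite neq_lt => /orP[]; [left|right].
- apply: (@overlap_margin x' y x0 y).
  have -> : (p1 * p2 = #|{: I}|)%N by rewrite card_prod !card_ord.
  apply: (@card_overlap _ _ _ l0) => [l|].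
    rewrite !inE; have := h1 l; rewrite -lowE -upE.
    rewrite ltr_ndivrMr // ltr_ndivlMr // !mul1r /lam => -[h|h]; apply/orP; [right|left]; lra.
  rewrite !inE; have := h4; rewrite -lowE -upE.
  by rewrite ltr_ndivrMr // ltr_ndivlMr // !mul1r /lam => -[ha hb]; apply/andP; split; lra.
- apply: (@overlap_margin x0 y x' y).
  have -> : (p1 * p2 = #|{: I}|)%N by rewrite card_prod !card_ord.
  apply: (@card_overlap _ _ _ l0) => [l|].
    rewrite !inE; have := h1 l; rewrite -lowE -upE.
    rewrite ltr_pdivrMr // ltr_pdivlMr // !mul1r /lam => -[h|h]; apply/orP; [left|right]; lra.
  rewrite !inE; have := h4; rewrite -lowE -upE.
  by rewrite ltr_pdivrMr // ltr_pdivlMr // !mul1r /lam => -[ha hb]; apply/andP; split; lra.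
Unshelve. all: by end_near.
Qed.

End Interior.

(** For [-4 < E < 8] the number [(E + 1) / 3] lies strictly between -1 and 3, the values of [fc] at
    0 and [pi] excluded, so [x0] exists with positive sine. *)
Lemma overlap_interior E : -4 < E -> E < 8 -> E != -1 ->
  exists2 c, 0 < c & overlap E c.
Proof.
move=> E4 E8 E1; pose x0 := acos (((E + 1) / 3 - 1) / 2).
have x0h : -1 < ((E + 1) / 3 - 1) / 2 < 1 by lra.
have /andP[a1 a2] := x0h.
have cx0 : cos x0 = ((E + 1) / 3 - 1) / 2.
  by apply: acosK; rewrite in_itv /=; lra.
apply: (@interior_overlap E x0).
- by apply: contra E1 => /eqP h; apply/eqP; lra.
- by rewrite /fc cx0; field.
by apply: sin_gt0_pi; rewrite acos_gt0 ?acos_ltpi ?(ltW a1) ?(ltW a2) //= ?a1 ?a2.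
Qed.

End FreeBands.

(** * Grids of quasimomenta and the energy -1 *)

Section Grids.
Variable R : realType.
Implicit Types (x y t : R).

(** The tripled angle is [2 pi (1 + 6 m) / (2 p)], and [1 + 6 m] is odd. *)
Lemma cos3_grid p m : (0 < p)%N ->
  cos (3 * (pi / (3 * p%:R) + 2 * pi * m%:R / p%:R)) != 1 :> R.
Proof.
move=> p0; have pR : p%:R != 0 :> R by rewrite pnatr_eq0; lia.
apply/eqP => h; have : (2 * p %| 1 + 6 * m)%N.
  apply: (@cos_dvdn R); first by lia.
  apply: etrans h; congr cos; rewrite natrD !natrM; field; exact: pR.
move=> /(dvdn_trans (dvdn_mulr _ (dvdnn 2))).
by rewrite dvdn_addl // dvdn_mulr.
Qed.

(** The counts of positive values on three translates of the grid add up to [2 p], so one of them is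
    at least [2 p / 3], a strict majority. *)
Lemma grid_majority p : (0 < p)%N -> exists y,
  (forall m : nat, fc (y + 2 * pi * m%:R / p%:R) != 0) /\
  (p < 2 * #|[pred m : 'I_p | (0 < fc (y + 2 * pi * m%:R / p%:R))%R]|)%N.
Proof.
move=> p0; pose y0 : R := pi / (3 * p%:R).
pose a : R := 2 * pi / 3; pose g (m : nat) : R := 2 * pi * m%:R / p%:R.
pose N y := #|[pred m : 'I_p | (0 < fc (y + g m))%R]|.
have h0 m : cos (3 * (y0 + g m)) != 1 by exact: cos3_grid.
have sw y m : y + a + g m = y + g m + a by rewrite addrAC.
have f0 m : fc (y0 + g m) != 0 by exact: fc_neq0.
have f1 m : fc (y0 + a + g m) != 0 by rewrite sw fc_neq0 // cos3_shift.
have f2 m : fc (y0 + a + a + g m) != 0 by rewrite !sw fc_neq0 // !cos3_shift.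
(* Among three translates by [2 pi / 3], two values are positive. *)
have tot : (N y0 + N (y0 + a)%R + N (y0 + a + a)%R = p * 2)%N.
  rewrite /N -!sum1_card ![\sum_(_ in _) _]big_mkcond -!big_split /=.
  rewrite (eq_bigr (fun=> 2%N)) ?sum_nat_const ?card_ord // => m _.
  rewrite !inE !sw -(fc_three (h0 m)).
  by case: (0 < _); case: (0 < _); case: (0 < _).
have [h|h] := ltnP p (2 * N y0)%N; first by exists y0.
have [h'|h'] := ltnP p (2 * N (y0 + a)%R)%N; first by exists (y0 + a).
by exists (y0 + a + a); split => //; rewrite -/(N _); lia.
Qed.

Variables (p1 p2 : nat).
Hypotheses (p1_gt0 : (0 < p1)%N) (p2_gt0 : (0 < p2)%N).
Local Notation I := ('I_p1 * 'I_p2)%type.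
Implicit Types (l : I).

(** A zero would give [p1 %| 3 * l], hence [p1 %| l] by coprimality, against [0 < l < p1]. *)
Lemma fc_2pi3_neq0 (l : 'I_p1) : ~~ (3 %| p1)%N -> (0 < l)%N ->
  fc (2 * pi / 3 + 2 * pi * l%:R / p1%:R) != 0 :> R.
Proof.
move=> p3 l0; have pR : p1%:R != 0 :> R by rewrite pnatr_eq0; lia.
apply: fc_neq0; apply/eqP => h; have : (p1 %| 3 * l)%N.
  apply: (@cos_dvdn R) => //; apply: etrans h; rewrite -[LHS]cosD2pi; congr cos.
  by rewrite -mulr_natl natrM; field; exact: pR.
have cop : coprime p1 3 by rewrite coprime_sym prime_coprime.
by rewrite Gauss_dvdr // => /(dvdn_leq l0); rewrite leqNgt ltn_ord.
Qed.

(** Moving [x] across [2 pi / 3] changes the sign of [fc] only in the column [l.1 = 0]. Outside it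
    each index lies in exactly one of the two sets; inside it an index with [fc (v l.2) > 0] lies in
    both and the others in none. A strict majority of positive values makes the total exceed
    [p1 * p2]. *)
Lemma overlap_mid_left : ~~ (3 %| p1)%N -> exists2 c : R, 0 < c & @overlap R p1 p2 (-1) c.
Proof.
move=> p3; have [y [y0 maj]] := grid_majority p2_gt0.
pose u (l : nat) : R := 2 * pi / 3 + 2 * pi * l%:R / p1%:R.
pose v (m : nat) : R := y + 2 * pi * m%:R / p2%:R.
near (0 : R)^'+ => t.
have t0 : 0 < t by near: t; exact: nbhs_right_gt.
have pi0 := pi_gt0 R.
have tpi : t < pi / 3 by near: t; apply: nbhs_right_lt; rewrite divr_gt0 ?pi_gt0 ?ltr0n.
have same : forall l : 'I_p1, (0 < l)%N -> 0 < fc (u l + t) * fc (u l - t).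
  near: t; apply: (@filter_forall R _ (fun (l : 'I_p1) t =>
    (0 < l)%N -> 0 < fc (u l + t) * fc (u l - t))) => l.
  have [l0|l0] := posnP l; first by apply: nearW => t; rewrite l0.
  have cu (s : R) : continuous (fun t : R => fc (u l + s * t)).
    move=> t; apply: (@continuous_comp _ _ _ (fun t : R => u l + s * t) (@fc R)).
      apply: cvgD; first exact: cvg_cst.
      by apply: cvgM; [exact: cvg_cst|exact: cvg_id].
    exact: continuous_fc.
  have h : \forall t \near (0 : R)^'+, 0 < fc (u l + 1 * t) * fc (u l + -1 * t).
    apply: (near_right_gt0 (f := fun t : R => fc (u l + 1 * t) * fc (u l + -1 * t))).
      by move=> t; apply: cvgM; exact: cu.
    rewrite !mulr0 !addr0 -expr2 exprn_even_gt0 //= fc_2pi3_neq0 //.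
  by apply: filterS h => t; rewrite mul1r mulN1r.
have up0 : 0 < fc (2 * pi / 3 - t).
  have : cos (2 * pi / 3) < cos (2 * pi / 3 - t) by rewrite ltr_cos ?in_itv /=; lra.
  rewrite cos_2pi3 /fc; lra.
have dn0 : fc (2 * pi / 3 + t) < 0.
  have : cos (2 * pi / 3 + t) < cos (2 * pi / 3) by rewrite ltr_cos ?in_itv /=; lra.
  rewrite cos_2pi3 /fc; lra.
apply: (@overlap_margin _ _ _ (2 * pi / 3 + t) y (2 * pi / 3 - t) y).
pose A (l : I) : bool := freeval (2 * pi / 3 + t) y l < -1.
pose B (l : I) : bool := -1 < freeval (2 * pi / 3 - t) y l.
rewrite -[X in (_ < X)%N]/(#|[pred l | A l]| + #|[pred l | B l]|)%N.
have AE l : A l = (fc (u l.1 + t) * fc (v l.2) < 0).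
  rewrite /A /freeval /u /v addrAC; apply/idP/idP; lra.
have BE l : B l = (0 < fc (u l.1 - t) * fc (v l.2)).
  rewrite /B /freeval /u /v addrAC; apply/idP/idP; lra.
pose l0 : 'I_p1 := Ordinal p1_gt0.
pose w (l : I) : nat := if l.1 == l0 then (2 * (0 < fc (v l.2))%R)%N else 1%N.
have wAB l : (w l <= A l + B l)%N.
  rewrite AE BE /w; have v0 : fc (v l.2) != 0 by exact: y0.
  case: eqP => [->|/eqP l1].
    rewrite /u /= mulr0 mul0r addr0; have [vp|] := ltP 0 (fc (v l.2)) => //.
    by rewrite (nmulr_rlt0 _ dn0) (pmulr_rgt0 _ up0) vp.
  have l1' : (0 < l.1)%N by move: l1; rewrite -val_eqE /= -lt0n.
  have := same l.1 l1'; have [a|a|->] := ltgtP (fc (u l.1 + t)) 0; last by rewrite mul0r ltxx.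
    rewrite (nmulr_rgt0 _ a) (nmulr_rlt0 _ a) => b; rewrite (nmulr_rgt0 _ b).
    by move: v0; rewrite neq_lt => /orP[] ->; rewrite ?addn1 ?add1n.
  rewrite (pmulr_rgt0 _ a) (pmulr_rlt0 _ a) => b; rewrite (pmulr_rgt0 _ b).
  by move: v0; rewrite neq_lt => /orP[] ->; rewrite ?addn1 ?add1n.
have cA (P : I -> bool) : #|[pred l | P l]| = (\sum_l P l)%N.
  by rewrite -sum1_card big_mkcond; apply: eq_bigr => l _; rewrite inE; case: (P l).
rewrite !cA -big_split /=.
apply: leq_trans (_ : _ <= \sum_l w l)%N _; last exact: leq_sum.
rewrite -(pair_bigA _ (fun a b => w (a, b))) /= (bigD1 l0) //=.
have -> : (\sum_(j < p2) w (l0, j) = 2 * #|[pred m : 'I_p2 | (0 < fc (v m))%R]|)%N.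
  rewrite -sum1_card big_distrr [RHS]big_mkcond /=; apply: eq_bigr => j _.
  by rewrite /w eqxx /= inE; case: (0 < _).
have -> : (\sum_(i < p1 | i != l0) \sum_(j < p2) w (i, j) = (p1 - 1) * p2)%N.
  rewrite (eq_bigr (fun=> p2)) => [|i /negPf il]; last first.
    by rewrite (eq_bigr (fun=> 1%N)) ?sum1_card ?card_ord // => j _; rewrite /w /= il.
  rewrite sum_nat_const; congr (_ * _)%N.
  by rewrite (eq_card (B := predC1 l0)) // cardC1 card_ord subn1.
move: maj; rewrite -/(v _); set k := #|_| => maj.
have : (p1 * p2 = (p1 - 1) * p2 + p2)%N by case: (p1) p1_gt0 => // n _; lia.
by move: maj; rewrite /v; lia.
Unshelve. all: by end_near.
Qed.

(** On these shifted grids both factors are nonzero and lie in [[-1, 3)], so their product is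
    nonzero and strictly between -3 and 9. Finitely many strict inequalities leave a common margin
    [eta]. *)
Lemma split_point : exists x y eta : R, [/\ 0 < eta, eta < 1 & forall l,
  [/\ -4 + eta < freeval x y l, freeval x y l < 8 - eta &
      freeval x y l < -1 - eta \/ -1 + eta < freeval x y l]].
Proof.
pose x : R := pi / (3 * p1%:R); pose y : R := pi / (3 * p2%:R).
exists x, y.
have h l : [/\ -4 < freeval x y l, freeval x y l < 8 & freeval x y l != -1].
  rewrite /freeval; have hx := cos3_grid l.1 p1_gt0; have hy := cos3_grid l.2 p2_gt0.
  have a0 := fc_neq0 hx; have b0 := fc_neq0 hy.
  have a1 := cos_neq1 hx; have b1 := cos_neq1 hy.
  have a2 := fc_ge (x + 2 * pi * l.1%:R / p1%:R).
  have b2 := fc_ge (y + 2 * pi * l.2%:R / p2%:R).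
  have {}a1 : fc (x + 2 * pi * l.1%:R / p1%:R) < 3 by rewrite /fc /x; lra.
  have {}b1 : fc (y + 2 * pi * l.2%:R / p2%:R) < 3 by rewrite /fc /y; lra.
  have : fc (x + 2 * pi * l.1%:R / p1%:R) * fc (y + 2 * pi * l.2%:R / p2%:R) != 0.
    by rewrite mulf_neq0.
  move: a1 a2 b1 b2; move: (fc _) (fc _) => a b a1 a2 b1 b2 ab; split; try nra.
near (0 : R)^'+ => eta; exists eta; split.
- by near: eta; exact: nbhs_right_gt.
- by near: eta; apply: nbhs_right_lt.
move=> l; have [h1 h2 h3] := h l; split.
- have : forall l, -4 < freeval x y l - eta.
    by near: eta; apply: (@filter_forall R I (fun l eta => -4 < freeval x y l - eta)) => l';
      apply: near_right_ltB; case: (h l').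
  by move=> /(_ l); lra.
- have : forall l, freeval x y l < 8 - eta.
    by near: eta; apply: (@filter_forall R I (fun l eta => freeval x y l < 8 - eta)) => l';
      apply: near_right_ltB; case: (h l').
  by apply.
have : forall l, freeval x y l < -1 - eta \/ -1 + eta < freeval x y l.
  near: eta; apply: (@filter_forall R I (fun l eta =>
    freeval x y l < -1 - eta \/ -1 + eta < freeval x y l)) => l'.
  have [_ _] := h l'; rewrite neq_lt => /orP[a|a].
    by apply: filterS (near_right_ltB a) => eta; left.
  by apply: filterS (near_right_ltB a) => eta ?; right; lra.
by apply.
Unshelve. all: by end_near.
Qed.

End Grids.

Lemma overlap_swap (R : realType) p1 p2 (E c : R) :
  @overlap R p2 p1 E c -> @overlap R p1 p2 E c.
Proof.
move=> [x [y [x' [y' lt]]]]; exists y, x, y', x'.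
pose sw (l : 'I_p1 * 'I_p2) : 'I_p2 * 'I_p1 := (l.2, l.1).
have bij : bijective sw by exists (fun l => (l.2, l.1)) => -[].
have fs a b l : freeval a b (sw l) = freeval b a l :> R by rewrite /freeval mulrC.
have cs (P : pred ('I_p2 * 'I_p1)) : #|P| = #|[pred l | P (sw l)]|.
  by rewrite -[LHS]sum1_card (reindex sw) -?[RHS]sum1_card //; exact: onW_bij.
rewrite mulnC; move: lt; rewrite !cs.
by congr (_ < _ + _)%N; apply: eq_card => l; rewrite !inE fs.
Qed.

(** * From overlaps to the shape of the spectrum *)

Section BelowSet.
Variable R : realType.
Variables (p1 p2 : nat).
Hypotheses (p1_gt0 : (0 < p1)%N) (p2_gt0 : (0 < p2)%N).
Variable Q : Z2 -> R.
Hypothesis Q_per : biperiodic p1 p2 Q.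
Local Notation H := (hop (fun n => (Q n)%:C)).
Implicit Types (E : R).

Lemma below_open E : below Q E ->
  exists2 e, 0 < e & forall E', `|E' - E| < e -> below Q E'.
Proof.
(* With [d <= 1], the square of [E' - E] is at most [e / 4], which absorbs half of the lower
   bound. *)
case=> e e0 he; pose d := Num.min 1 (e / 4).
have d0 : 0 < d by rewrite lt_min ltr01 divr_gt0.
exists d => // E' EE'; exists (e / 4); first by rewrite divr_gt0.
move=> N u u0; have := he N u u0.
set U := bsum N _; pose V := bsum N.+1 (fun n => nsq (H u n - E'%:C * u n)).
rewrite -/V; set W := bsum N.+1 _ => h.
have U0 : 0 <= U by apply: bsum_ge0 => n; exact: nsq_ge0.
have : W <= 2 * V + 2 * (E' - E) ^+ 2 * U.
  have -> : U = bsum N.+1 (fun n => nsq (u n)).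
    by rewrite (@bsum_ext _ N N.+1) // => n nb; rewrite u0 // nsq0.
  rewrite -!bsumZ -bsumD; apply: bsum_le => n.
  have -> : H u n - E%:C * u n = (H u n - E'%:C * u n) + (E' - E)%:C * u n.
    by rewrite rmorphB /=; ring.
  by apply: le_trans (nsqD_le _ _) _; rewrite nsqM nsqC mulrA.
have : (E' - E) ^+ 2 <= e / 4.
  rewrite -real_normK ?num_real // expr2.
  move: EE'; rewrite lt_min => /andP[a b].
  by apply: le_trans (ltW b); rewrite ler_piMl // ltW.
move=> h1 h2; have : (E' - E) ^+ 2 * U <= e / 4 * U by rewrite ler_wpM2r.
lra.
Qed.

Lemma below_far : exists B, forall E, B < `|E| -> below Q E.
Proof.
have [K hK] := shift_bounded p1_gt0 p2_gt0 Q_per 0.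
(* A bound for the squared norm of [H], at least 1, so that [2 * L] also exceeds the norm itself. *)
pose L := 162 + 2 * K.
have L0 : 1 <= L.
  by have : 0 <= K by [apply: le_trans (hK (0, 0)); exact: nsq_ge0]; rewrite /L; lra.
exists (2 * L) => E EL; exists 1 => // N u u0; rewrite mul1r.
set U := bsum N _; set V := bsum N.+1 _.
have suppn M (w : Z2 -> R[i]) : supp M w -> supp M (fun n => nsq (w n)).
  by move=> w0 n nb; rewrite w0 // nsq0.
have UE : U = bsum N.+2 (fun n => nsq (u n)).
  by rewrite (@bsum_ext _ N N.+2) //; [exact: suppn|lia].
have U0 : 0 <= U by apply: bsum_ge0 => n; exact: nsq_ge0.
pose W := bsum N.+1 (fun n => nsq (H u n - 0 * u n)).
have WL : W <= L * U by rewrite UE; exact: (@bsum_hop_le R _ 0 u N.+1 K hK).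
have : E ^+ 2 * U <= 2 * V + 2 * W.
  have -> : U = bsum N.+1 (fun n => nsq (u n)).
    by rewrite (@bsum_ext _ N N.+1) //; exact: suppn.
  rewrite -!bsumZ -bsumD; apply: bsum_le => n; rewrite -nsqC -nsqM.
  have e : E%:C * u n = - (H u n - E%:C * u n) + (H u n - 0 * u n) by ring.
  by rewrite {1}e; apply: le_trans (nsqD_le _ _) _; rewrite nsqN.
have : (2 * L) ^+ 2 * U <= E ^+ 2 * U.
  have e2 : E ^+ 2 = `|E| ^+ 2 by rewrite real_normK ?num_real.
  by rewrite ler_wpM2r // e2; nra.
have h1 : U <= L * U by rewrite ler_peMl.
have h2 : L * U <= L * (L * U) by rewrite ler_wpM2l // (le_trans _ L0).
lra.
Qed.

End BelowSet.

(** * Shape of a compact subset of the line with two known bands *)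

Section RealLine.
Variable R : realType.
Variables (rho : set R) (l1 m1 m2 r1 : R).
Hypotheses (l1m1 : l1 < m1) (m1m2 : m1 < m2) (m2r1 : m2 < r1).
Hypothesis left_band : forall E, l1 <= E <= m1 -> ~ rho E.
Hypothesis right_band : forall E, m2 <= E <= r1 -> ~ rho E.
Hypothesis rho_low : forall E E', rho E -> E < l1 -> E' < E -> rho E'.
Hypothesis rho_high : forall E E', rho E -> r1 < E -> E < E' -> rho E'.
Hypothesis rho_mid : forall E1 E2 E, rho E1 -> rho E2 -> m1 < E1 -> E2 < m2 ->
  E1 <= E <= E2 -> rho E.
Hypothesis rho_open : forall E, rho E ->
  exists2 e, 0 < e & forall E', `|E' - E| < e -> rho E'.
Hypothesis rho_far : exists B, forall E, B < `|E| -> rho E.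

Let A : set R := [set x | ~ rho x].

Let A_bound : exists B, forall x, A x -> - B <= x <= B.
Proof.
have [B hB] := rho_far; exists B => x Ax.
by rewrite -ler_norml leNgt; apply/negP => /hB.
Qed.

Let sup_in (P : R -> Prop) : (exists x, A x /\ P x) ->
  let S := [set x | A x /\ P x] in A (sup S).
Proof.
move=> [x Sx] S rs; have [B hB] := A_bound.
have hs : has_sup S.
  split; first by exists x.
  by exists B => y [Ay _]; have /andP[] := hB y Ay.
have [e e0 he] := rho_open rs.
have [y Sy ylt] := sup_adherent e0 hs; have [Ay _] := Sy.
apply: Ay; apply: he; have : y <= sup S by apply: ub_le_sup => //; case: hs.
by move=> yle; rewrite distrC ger0_norm ?subr_ge0 //; lra.
Qed.

Let inf_in (P : R -> Prop) : (exists x, A x /\ P x) ->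
  let S := [set x | A x /\ P x] in A (inf S).
Proof.
move=> [x Sx] S rs; have [B hB] := A_bound.
have hs : has_inf S.
  split; first by exists x.
  by exists (- B) => y [Ay _]; have /andP[] := hB y Ay.
have [e e0 he] := rho_open rs.
have [y Sy ylt] := inf_adherent e0 hs; have [Ay _] := Sy.
apply: Ay; apply: he; have : inf S <= y by apply: ge_inf => //; case: hs.
by move=> yle; rewrite ger0_norm ?subr_ge0 //; lra.
Qed.

Lemma gap_region x : rho x -> [\/ x < l1, m1 < x < m2 | r1 < x].
Proof.
move=> rx; have [h1|h1] := ltP x l1; first by constructor 1.
have [h2|h2] := ltP r1 x; first by constructor 3.
constructor 2; apply/andP; split; rewrite ltNge; apply/negP => h.
  by apply: (left_band _ rx); rewrite h1 h.
by apply: (right_band _ rx); rewrite h h2.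
Qed.

Lemma band_hull : exists a d : R, [/\ A a, A d, a <= l1, r1 <= d & forall x, A x -> a <= x <= d].
Proof.
have [B hB] := A_bound.
have Al : A l1 by apply: left_band; rewrite lexx ltW.
have Ar : A r1 by apply: right_band; rewrite lexx andbT ltW.
pose S := [set x | A x /\ True].
have ub : has_ubound S by exists B => y [Ay _]; have /andP[] := hB y Ay.
have lb : has_lbound S by exists (- B) => y [Ay _]; have /andP[] := hB y Ay.
exists (inf S), (sup S); split.
- by apply: inf_in; exists l1.
- by apply: sup_in; exists l1.
- exact: ge_inf.
- exact: ub_le_sup.
- by move=> x Ax; rewrite ge_inf ?ub_le_sup.
Qed.

Lemma single_band : (forall E, m1 <= E <= m2 -> ~ rho E) ->
  exists a b : R, a < b /\ A = `[a, b]%classic.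
Proof.
move=> mid; have [a [d [Aa Ad al dr hA]]] := band_hull.
exists a, d; split; first by move: l1m1 m1m2 m2r1 => *; lra.
apply/seteqP; split => x /=; first by move=> /hA; rewrite in_itv.
rewrite in_itv /= => /andP[ax xd] rx; case: (gap_region rx) => [h|/andP[h h']|h].
- have [e|ne] := eqVneq a x; first by apply: Aa; rewrite e.
  by apply: Aa; apply: (rho_low rx h); rewrite lt_neqAle ne.
- by apply: (mid x) => //; rewrite !ltW.
- have [e|ne] := eqVneq x d; first by apply: Ad; rewrite -e.
  by apply: Ad; apply: (rho_high rx h); rewrite lt_neqAle ne.
Qed.

(** Given a point [E] of [rho] in the middle, the inner endpoints are the last point of [A] before
    [E] and the first after it. A further gap between [m1] and [E] would, by [rho_mid], put the
    former endpoint into [rho]; likewise on the right. *)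
Lemma two_bands : exists a b c d : R, [/\ a < b, c < d & A = `[a, b]%classic `|` `[c, d]%classic].
Proof.
have [[E [rE mE]]|nE] := pselect (exists E, rho E /\ m1 <= E <= m2); last first.
  have [|a [b [ab AE]]] := single_band; first by move=> E mE rE; apply: nE; exists E.
  (* A single interval counts as two equal ones. *)
  by exists a, b, a, b; rewrite setUid.
have [a [d [Aa Ad al dr hA]]] := band_hull.
have Am1 : A m1 by apply: left_band; rewrite lexx andbT ltW.
have Am2 : A m2 by apply: right_band; rewrite lexx ltW.
have /andP[mE1 mE2] := mE.
have m1E : m1 < E by rewrite lt_neqAle mE1 andbT; apply/eqP => e; apply: Am1; rewrite e.
have Em2 : E < m2 by rewrite lt_neqAle mE2 andbT; apply/eqP => e; apply: Am2; rewrite -e.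
pose S1 := [set x | A x /\ x <= E]; pose S2 := [set x | A x /\ E <= x].
have ub : has_ubound S1 by exists E => y [].
have lb : has_lbound S2 by exists E => y [].
have Ab : A (sup S1) by apply: sup_in; exists m1.
have Ac : A (inf S2) by apply: inf_in; exists m2.
have bm : m1 <= sup S1 by apply: ub_le_sup.
have cm : inf S2 <= m2 by apply: ge_inf.
have bE : sup S1 <= E by apply: sup_le_ub; [exists m1|move=> y []].
have cE : E <= inf S2 by apply: lb_le_inf; [exists m2|move=> y []].
exists a, (sup S1), (inf S2), d; split; [by move: l1m1 => *; lra|by move: m2r1 => *; lra|].
apply/seteqP; split => x /=; rewrite !in_itv /=.
  move=> Ax; have /andP[ax xd] := hA x Ax.
  have [xE|xE] := leP x E; [left|right]; rewrite ?ax ?xd ?andbT /=.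
    exact: ub_le_sup.
  by apply: ge_inf => //; split => //; exact: ltW.
move: l1m1 m1m2 m2r1 => ? ? ?.
move=> [/andP[ax xb]|/andP[cx xd]] rx; case: (gap_region rx) => [h|/andP[h h']|h]; try lra.
- have [e|ne] := eqVneq a x; first by apply: Aa; rewrite e.
  by apply: Aa; apply: (rho_low rx h); rewrite lt_neqAle ne.
- by apply: Ab; apply: (rho_mid rx rE) => //; rewrite xb.
- by apply: Ac; apply: (rho_mid rE rx) => //; rewrite cE.
- have [e|ne] := eqVneq x d; first by apply: Ad; rewrite -e.
  by apply: Ad; apply: (rho_high rx h); rewrite lt_neqAle ne.
Qed.

(** Outside the middle window a point of [rho] lies on a half-line contained in [rho], so its
    component is unbounded. *)
Lemma bounded_gap x : rho x -> bounded_set (connected_component rho x) ->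
  connected_component rho x `<=` `]m1, m2[%classic.
Proof.
move=> rx [M [_ hM]] y Cy.
have {}hM z : connected_component rho x z -> `|z| <= M + 1.
  by apply: hM; rewrite ltrDl.
have ry : rho y by exact: connected_component_sub Cy.
have comp (I : set R) : is_interval I -> I y -> I `<=` rho ->
    I `<=` connected_component rho x.
  move=> /connected_intervalP cI Iy Irho.
  rewrite (same_connected_component Cy); exact: connected_component_max.
have big (z : R) : `|z| = `|M| + `|y| + 2 -> ~ connected_component rho x z.
  move=> ze /hM; rewrite ze; have := ler_norm M; have := normr_ge0 y; lra.
have b0 : 0 <= `|M| + `|y| + 2 by rewrite !addr_ge0.
case: (gap_region ry) => [h|//|h].
  exfalso; apply: (big (- (`|M| + `|y| + 2))); first by rewrite normrN ger0_norm.
  apply: (comp [set t | t <= y]) => [a b|||].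
  - by move=> /= _ hb t /andP[_ tb]; exact: le_trans hb.
  - by rewrite /=.
  - move=> t /=; rewrite le_eqVlt => /orP[/eqP ->//|]; exact: rho_low.
  - rewrite /=; have := ler_norm (- y); rewrite normrN; have := normr_ge0 M; lra.
exfalso; apply: (big (`|M| + `|y| + 2)); first by rewrite ger0_norm.
apply: (comp [set t | y <= t]) => [a b|||].
- by move=> /= ha _ t /andP[ta _]; exact: le_trans ta.
- by rewrite /=.
- move=> t /=; rewrite le_eqVlt => /orP[/eqP <-//|]; exact: rho_high.
- rewrite /=; have := ler_norm y; have := normr_ge0 M; lra.
Qed.

End RealLine.

(** * Uniform margins and the spectrum of small potentials *)

Section Assembly.
Variable R : realType.
Variables (p1 p2 : nat).
Hypotheses (p1_gt0 : (0 < p1)%N) (p2_gt0 : (0 < p2)%N).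

(** Compactness of [[a, b]]: a margin [c] at one energy persists with [c / 2] on the ball of radius
    [c / 2]. *)
Lemma overlap_uniform (a b : R) :
  (forall E, a <= E <= b -> exists2 c, 0 < c & @overlap R p1 p2 E c) ->
  exists2 c : R, 0 < c & forall E, a <= E <= b -> @overlap R p1 p2 E c.
Proof.
move=> h.
have /compact_near_coveringP/(_ R (0 : R)^'+ (fun c E => @overlap R p1 p2 E c) _) :=
  @segment_compact R a b.
case=> [E /=|c0 /= c00 hc].
  rewrite in_itv /= => /h[c c0 hE].
  exists (ball E (c / 2), [set t | 0 < t < c / 2]).
    split; first by apply: nbhsx_ballx; rewrite divr_gt0.
    have n1 : \forall t \near (0 : R)^'+, 0 < t by exact: nbhs_right_gt.
    have n2 : \forall t \near (0 : R)^'+, t < c / 2.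
      by apply: nbhs_right_lt; rewrite divr_gt0.
    by apply: filterS (filterI n1 n2) => t [/= -> ->].
  move=> [E' t] [/= EE' /andP[t0 tc]]; apply: overlap_le (ltW tc) _.
  by apply: overlap_open hE _; rewrite distrC ltW.
exists (c0 / 2); first by rewrite divr_gt0.
move=> E aEb; apply: (hc (c0 / 2)) => /=.
- by rewrite sub0r normrN gtr0_norm ?divr_gt0 // ltr_pdivrMr // ltr_pMr // ltr1n.
- by rewrite divr_gt0.
- by rewrite in_itv.
Qed.

Lemma bands_uniform (k : R) : 0 < k -> exists2 c : R, 0 < c &
  forall E : R, (-4 + k <= E <= -1 - k) || (-1 + k <= E <= 8 - k) -> @overlap R p1 p2 E c.
Proof.
move=> k0.
have [c1 c10 h1] : exists2 c : R, 0 < c &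
    forall E, -4 + k <= E <= -1 - k -> @overlap R p1 p2 E c.
  apply: overlap_uniform => E h; apply: overlap_interior => //; first lra.
    by lra.
  by apply/eqP; lra.
have [c2 c20 h2] : exists2 c : R, 0 < c &
    forall E, -1 + k <= E <= 8 - k -> @overlap R p1 p2 E c.
  apply: overlap_uniform => E h; apply: overlap_interior => //; first lra.
    by lra.
  by apply/eqP; lra.
exists (Num.min c1 c2); first by rewrite lt_min c10.
move=> E /orP[/h1|/h2]; apply: overlap_le; first by rewrite ge_min lexx.
by rewrite ge_min lexx orbT.
Qed.

Variable Q : Z2 -> R.
Hypothesis Q_per : biperiodic p1 p2 Q.

Lemma sup_norm_ge n : `|Q n| <= sup_norm Q.
Proof.
apply: ub_le_sup; last by exists n.
have [q hq] := potential_bounded p1_gt0 p2_gt0 Q_per.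
by exists q => _ [m _ <-].
Qed.

(** Non-real energies always lie in the resolvent set; on the real line it coincides with
    [below Q]. *)
Lemma spectrumE : spectrum (schrodinger_sqn Q) = embedC [set x | ~ below Q x].
Proof.
apply/seteqP; split => [z|_ [x nb <-]] /=.
  move=> nz; exists (complex.Re z).
    move=> b; apply: nz; apply: (resolvent_of_coercive p1_gt0 p2_gt0 Q_per); by right.
  have [z0|z0] := eqVneq (complex.Im z) 0.
    by move: z0; case: (z) => a b /= ->.
  by exfalso; apply: nz; apply: (resolvent_of_coercive p1_gt0 p2_gt0 Q_per); left.
move=> r; apply: nb; exact: below_of_resolvent r.
Qed.

Lemma not_spectrumE : [set x : R | ~ spectrum (schrodinger_sqn Q) x%:C] = below Q.
Proof.
apply/seteqP; split => x /=; rewrite spectrumE.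
  move=> h; apply: contrapT => nb; apply: h; by exists x.
by move=> b [y nb /complexI yx]; apply: nb; rewrite yx.
Qed.

Section Bands.
(** [k] is the width of the windows cut out at -4, -1 and 8, and [c] bounds the potential. As
    [k + c <= eta / 2], energies in these windows stay further than [c] from all free eigenvalues at
    [(x0, y0)]. *)
Variables (x0 y0 eta k c : R).
Hypotheses (k_gt0 : 0 < k) (k_le : k <= eta / 4) (c_le : c <= eta / 4) (eta_lt1 : eta < 1).
Hypothesis split_xy : forall l : 'I_p1 * 'I_p2,
  [/\ -4 + eta < freeval x0 y0 l, freeval x0 y0 l < 8 - eta &
      freeval x0 y0 l < -1 - eta \/ -1 + eta < freeval x0 y0 l].
Hypothesis bands : forall E : R, (-4 + k <= E <= -1 - k) || (-1 + k <= E <= 8 - k) ->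
  @overlap R p1 p2 E c.
Hypothesis Q_le : sup_norm Q <= c.

Let Q_lec n : `|Q n| <= c.
Proof. exact: le_trans (sup_norm_ge n) Q_le. Qed.

Let not_below E : @overlap R p1 p2 E c -> ~ below Q E.
Proof.
move=> [x [y [x' [y' lt]]]]; exact: (not_below_overlap p1_gt0 p2_gt0 Q_per Q_lec lt).
Qed.

Let l1m1 : -4 + k < -1 - k.
Proof. by move: k_le eta_lt1 => *; lra. Qed.

Let m1m2 : -1 - k < -1 + k.
Proof. by move: k_gt0 => *; lra. Qed.

Let m2r1 : -1 + k < 8 - k.
Proof. by move: k_le eta_lt1 => *; lra. Qed.

Let left_band E : -4 + k <= E <= -1 - k -> ~ below Q E.
Proof. by move=> h; apply/not_below/bands; rewrite h. Qed.

Let right_band E : -1 + k <= E <= 8 - k -> ~ below Q E.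
Proof. by move=> h; apply/not_below/bands; rewrite h orbT. Qed.

(** Some energy [F] far to the left is in the resolvent set, and at [(x0, y0)] both [F] and [E] lie
    below all free eigenvalues by more than [c]; thus nothing separates them. *)
Let low E E' : below Q E -> E < -4 + k -> E' < E -> below Q E'.
Proof.
move=> bE Ek E'E; have [B hB] := below_far p1_gt0 p2_gt0 Q_per.
pose F := - (`|B| + `|E'| + 1).
have bF : below Q F.
  apply: hB; rewrite /F normrN ger0_norm; last by rewrite !addr_ge0.
  by have := ler_norm B; have := normr_ge0 E'; lra.
apply: (below_split p1_gt0 p2_gt0 Q_per Q_lec (x := x0) (y := y0)) bF bE _.
  by move=> l; right; have [h _ _] := split_xy l; move: k_le c_le k_gt0 => *; lra.
rewrite ltW ?andbT ?(ltW E'E) // /F.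
by have := ler_norm (- E'); rewrite normrN; have := normr_ge0 B; lra.
Qed.

Let high E E' : below Q E -> 8 - k < E -> E < E' -> below Q E'.
Proof.
move=> bE Ek EE'; have [B hB] := below_far p1_gt0 p2_gt0 Q_per.
pose F := `|B| + `|E'| + 1.
have bF : below Q F.
  apply: hB; rewrite /F ger0_norm; last by rewrite !addr_ge0.
  by have := ler_norm B; have := normr_ge0 E'; lra.
apply: (below_split p1_gt0 p2_gt0 Q_per Q_lec (x := x0) (y := y0)) bE bF _.
  by move=> l; left; have [_ h _] := split_xy l; move: k_le c_le k_gt0 => *; lra.
rewrite (ltW EE') /= /F.
by have := ler_norm E'; have := normr_ge0 B; lra.
Qed.

Let mid E1 E2 E : below Q E1 -> below Q E2 -> -1 - k < E1 -> E2 < -1 + k ->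
  E1 <= E <= E2 -> below Q E.
Proof.
move=> b1 b2 h1 h2.
apply: (below_split p1_gt0 p2_gt0 Q_per Q_lec (x := x0) (y := y0)) b1 b2.
move=> l; have [_ _ h] := split_xy l; move: k_le c_le k_gt0 => *.
by case: h => h; [left|right]; lra.
Qed.

Lemma spectrum_two_bands : at_most_two_intervals (spectrum (schrodinger_sqn Q)).
Proof.
have [a [b [c' [d [ab cd e]]]]] := two_bands l1m1 m1m2 m2r1 left_band right_band low high mid
  (@below_open R Q) (below_far p1_gt0 p2_gt0 Q_per).
by exists a, b, c', d; split => //; rewrite spectrumE -e.
Qed.

Lemma spectrum_single_band :
  (forall E, -1 - k <= E <= -1 + k -> @overlap R p1 p2 E c) ->
  single_interval (spectrum (schrodinger_sqn Q)).
Proof.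
move=> h.
have [a [b [ab e]]] := single_band l1m1 m1m2 m2r1 left_band right_band low high
  (@below_open R Q) (below_far p1_gt0 p2_gt0 Q_per) (fun E hE => not_below (h E hE)).
by exists a, b; split => //; rewrite spectrumE -e.
Qed.

Lemma gap_location x : below Q x -> bounded_set (connected_component (below Q) x) ->
  connected_component (below Q) x `<=` `](-1 - k), (-1 + k)[%classic.
Proof. exact: (bounded_gap left_band right_band low high). Qed.

End Bands.
End Assembly.

Unset Implicit Arguments.
Set Strict Implicit.
Set Printing Implicit Defensive.

Theorem theorem1p5 (R : realType) (p1 p2 : nat)
    (p1_gt0 : (0 < p1)%N) (p2_gt0 : (0 < p2)%N) :
  exists c : R, [/\ 0 < c,
    forall Q : Z2 -> R, biperiodic p1 p2 Q -> sup_norm Q <= c ->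
      at_most_two_intervals (spectrum (schrodinger_sqn Q)) /\
      (~~ (3 %| p1)%N \/ ~~ (3 %| p2)%N ->
        single_interval (spectrum (schrodinger_sqn Q)))
  & forall eps : R, 0 < eps ->
      exists delta : R, 0 < delta <= c /\
        forall Q : Z2 -> R, biperiodic p1 p2 Q -> sup_norm Q <= delta ->
          let gaps := [set x : R | ~ spectrum (schrodinger_sqn Q) x%:C] in
          forall x : R, gaps x ->
            bounded_set (connected_component gaps x) ->
            connected_component gaps x `<=` `](-1 - eps), (-1 + eps)[ ].
Proof.
have [x0 [y0 [eta [eta0 eta1 split_xy]]]] := split_point R p1_gt0 p2_gt0.
have e4 : 0 < eta / 4 by rewrite divr_gt0.
have [k [cm [k0 ke cm0 hm]]] : exists k cm : R, [/\ 0 < k, k <= eta / 4, 0 < cm &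
    ~~ (3 %| p1)%N \/ ~~ (3 %| p2)%N ->
    forall E, -1 - k <= E <= -1 + k -> @overlap R p1 p2 E cm].
  have [h|h] := pselect (~~ (3 %| p1)%N \/ ~~ (3 %| p2)%N); last first.
    (* Both periods are multiples of three: the last clause is vacuous and any positive [cm] will
       do. *)
    by exists (eta / 4), 1; split.
  have [c c0 hc] : exists2 c : R, 0 < c & @overlap R p1 p2 (-1) c.
    case: h => h; first exact: overlap_mid_left.
    by have [c c0 hc] := overlap_mid_left R p2_gt0 p1_gt0 h; exists c => //; exact: overlap_swap.
  (* The overlap at -1 persists with margin [c / 2] within distance [c / 2], so the window must not
     be wider than that. *)
  exists (Num.min (eta / 4) (c / 2)), (c / 2); split.
  - by rewrite lt_min e4 divr_gt0.
  - by rewrite ge_min lexx.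
  - by rewrite divr_gt0.
  move=> _ E /andP[h1 h2]; apply: overlap_open hc _.
  have : Num.min (eta / 4) (c / 2) <= c / 2 by rewrite ge_min lexx orbT.
  by move=> h3; rewrite ler_norml; apply/andP; split; lra.
have [cb cb0 hb] := bands_uniform p1_gt0 p2_gt0 k0.
pose c := Num.min (eta / 4) (Num.min cm cb).
have c0 : 0 < c by rewrite !lt_min e4 cm0 cb0.
have ce : c <= eta / 4 by rewrite ge_min lexx.
have ccm : c <= cm by rewrite /c !ge_min lexx orbT.
have ccb : c <= cb by rewrite /c !ge_min lexx !orbT.
exists c; split => // [Q Q_per Qc|eps eps0].
  have hbc E (hE : (-4 + k <= E <= -1 - k) || (-1 + k <= E <= 8 - k)) :=
    overlap_le ccb (hb E hE).
  split; first exact: (spectrum_two_bands p1_gt0 p2_gt0 Q_per k0 ke ce eta1 split_xy hbc Qc).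
  move=> h3.
  apply: (spectrum_single_band p1_gt0 p2_gt0 Q_per k0 ke ce eta1 split_xy hbc Qc) => E hE.
  exact: overlap_le ccm (hm h3 E hE).
(* Locating the gap amounts to the same analysis with a narrower window, at the price of a smaller
   bound on the potential. *)
pose k' := Num.min (eta / 4) eps.
have k'0 : 0 < k' by rewrite lt_min e4 eps0.
have ke' : k' <= eta / 4 by rewrite ge_min lexx.
have keps : k' <= eps by rewrite ge_min lexx orbT.
have [c' c'0 hc'] := bands_uniform p1_gt0 p2_gt0 k'0.
pose d := Num.min c c'.
have dc : d <= c by rewrite ge_min lexx.
have dc' : d <= c' by rewrite ge_min lexx orbT.
exists d; split; first by rewrite lt_min c0 c'0.
move=> Q Q_per Qd gaps x; rewrite /gaps (not_spectrumE p1_gt0 p2_gt0 Q_per) => bx bdd y Cy.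
have hbc E (hE : (-4 + k' <= E <= -1 - k') || (-1 + k' <= E <= 8 - k')) :=
  overlap_le dc' (hc' E hE).
have := gap_location p1_gt0 p2_gt0 Q_per k'0 ke' (le_trans dc ce) split_xy hbc Qd bx bdd Cy.
rewrite /= !in_itv /= => /andP[h1 h2]; apply/andP; split; lra.
Qed.
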